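(* The relation $\neq^*$ on $\omega^\omega$ does not have the universality property. In fact, for any countable model $M$ there is an eventually different real $d\in\omega^\omega$ over $M$ such that for any real $c\in\omega^\omega\setminus M$, $d$ is not eventually different over $M[c]$.
   Context: For $x,y\in\omega^\omega$, $x\neq^*y$ means $x(n)\neq y(n)$ for all but finitely many $n$. A model is a transitive set or class satisfying a fixed sufficiently large finite fragment of $\mathsf{ZF}+\mathsf{DC}$ including Powerset (e.g. restricted to $\Sigma_{2026}$-formulas). For a transitive model $N$, $d\in\omega^\omega$ is eventually different over $N$ if $x\neq^*d$ for all $x\in\omega^\omega\cap N$. For arbitrary $c$, ''$d$ is not eventually different over $M[c]$'' is understood as: $d$ is not eventually different over any transitive model $N$ with $M\cup\{c\}\subseteq N$. The relation $\neq^*$ has the universality property if for every countable model $M$, every $d\in\omega^\omega$ that is eventually different over $M$ and belongs to some forcing extension of $M$ is universally eventually different over $M$: for every forcing notion $\mathbb{Q}\in M$ there is a $\mathbb{Q}$-generic filter $G$ over $M$ such that $d$ is eventually different over $M[G]$. *)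

(* Defs.v *)
From Stdlib Require Import Arith.

(** ** The universe of sets

    Aczel's sets-as-trees.  Set equality is bisimilarity [≡], not Leibniz
    equality; classes are therefore asked to be invariant under [≡] wherever
    they are quantified over (see [is_class]). *)

Inductive V : Type := sup (A : Type) (f : A -> V).

Fixpoint eqV (x y : V) {struct x} : Prop :=
  match x, y with
  | sup A f, sup B g =>
      (forall a, exists b, eqV (f a) (g b)) /\
      (forall b, exists a, eqV (f a) (g b))
  end.

Definition mem (x y : V) : Prop :=
  match y with sup B g => exists b, eqV x (g b) end.

Infix "≡" := eqV (at level 70, no associativity).
Infix "∈" := mem (at level 70, no associativity).

Definition subset (x y : V) : Prop := forall z, z ∈ x -> z ∈ y.

Definition upair (x y : V) : V := sup bool (fun b => if b then x else y).
Definition opair (x y : V) : V := upair (upair x x) (upair x y).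

Definition empty : V := sup Empty_set (fun e => match e with end).

(** [adjoin x y] is x ∪ {y}. *)
Definition adjoin (x y : V) : V :=
  match x with
  | sup A f => sup (option A) (fun o => match o with Some a => f a | None => y end)
  end.

(** Von Neumann numerals. *)
Fixpoint numeral (n : nat) : V :=
  match n with
  | 0 => empty
  | S m => adjoin (numeral m) (numeral m)
  end.

(** Elements of ω^ω are Rocq functions [nat -> nat]; [real x] is the
    corresponding set, i.e. the graph of x. *)
Definition real (x : nat -> nat) : V :=
  sup nat (fun n => opair (numeral n) (numeral (x n))).

(** ** Classes and relativised quantifiers *)

Definition is_class (N : V -> Prop) : Prop := forall x y, x ≡ y -> N x -> N y.

Definition transitive_class (N : V -> Prop) : Prop :=
  forall x y, N x -> y ∈ x -> N y.

Definition countable_class (N : V -> Prop) : Prop :=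
  exists e : nat -> V, forall x, N x -> exists n, x ≡ e n.

Definition rall (N : V -> Prop) (P : V -> Prop) : Prop := forall x, N x -> P x.
Definition rex (N : V -> Prop) (P : V -> Prop) : Prop := exists x, N x /\ P x.

Notation "∀[ N ] x .. y , P" := (rall N (fun x => .. (rall N (fun y => P)) ..))
  (at level 200, x binder, y binder, P at level 200, right associativity).
Notation "∃[ N ] x .. y , P" := (rex N (fun x => .. (rex N (fun y => P)) ..))
  (at level 200, x binder, y binder, P at level 200, right associativity).

(** ** First-order formulas of the language {∈} and the Lévy hierarchy

    Variables are de Bruijn indices. *)

Inductive form : Type :=
| fmem (i j : nat)
| feq (i j : nat)
| fneg (p : form)
| fand (p q : form)
| for_ (p q : form)
| fimp (p q : form)
| fall (p : form)
| fex (p : form).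

Definition scons (x : V) (e : nat -> V) (i : nat) : V :=
  match i with 0 => x | S j => e j end.

Fixpoint sat (N : V -> Prop) (e : nat -> V) (p : form) : Prop :=
  match p with
  | fmem i j => e i ∈ e j
  | feq i j => e i ≡ e j
  | fneg p => ~ sat N e p
  | fand p q => sat N e p /\ sat N e q
  | for_ p q => sat N e p \/ sat N e q
  | fimp p q => sat N e p -> sat N e q
  | fall p => ∀[N] x, sat N (scons x e) p
  | fex p => ∃[N] x, sat N (scons x e) p
  end.

(** In the bounded quantifiers the bound [S i] refers to variable [i] of the
    surrounding context, so it is never the quantified variable itself. *)
Inductive Delta0 : form -> Prop :=
| D0_mem i j : Delta0 (fmem i j)
| D0_eq i j : Delta0 (feq i j)
| D0_neg p : Delta0 p -> Delta0 (fneg p)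
| D0_and p q : Delta0 p -> Delta0 q -> Delta0 (fand p q)
| D0_or p q : Delta0 p -> Delta0 q -> Delta0 (for_ p q)
| D0_imp p q : Delta0 p -> Delta0 q -> Delta0 (fimp p q)
| D0_all i p : Delta0 p -> Delta0 (fall (fimp (fmem 0 (S i)) p))
| D0_ex i p : Delta0 p -> Delta0 (fex (fand (fmem 0 (S i)) p)).

Inductive Sigma : nat -> form -> Prop :=
| Sigma_0 p : Delta0 p -> Sigma 0 p
| Sigma_Pi n p : Pi n p -> Sigma (S n) p
| Sigma_ex n p : Sigma (S n) p -> Sigma (S n) (fex p)
with Pi : nat -> form -> Prop :=
| Pi_0 p : Delta0 p -> Pi 0 p
| Pi_Sigma n p : Sigma n p -> Pi (S n) p
| Pi_all n p : Pi (S n) p -> Pi (S n) (fall p).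

(** ** The axioms of ZF + DC, relativised to a class N *)

Definition subset_in (N : V -> Prop) (x y : V) : Prop :=
  ∀[N] z, z ∈ x -> z ∈ y.

Definition empty_in (N : V -> Prop) (x : V) : Prop := ∀[N] z, ~ z ∈ x.

Definition succ_in (N : V -> Prop) (y x : V) : Prop :=
  ∀[N] z, z ∈ y <-> z ∈ x \/ z ≡ x.

Definition upair_in (N : V -> Prop) (p x y : V) : Prop :=
  ∀[N] z, z ∈ p <-> z ≡ x \/ z ≡ y.

Definition opair_in (N : V -> Prop) (p x y : V) : Prop :=
  ∃[N] u v, upair_in N u x x /\ upair_in N v x y /\ upair_in N p u v.

Definition related_in (N : V -> Prop) (r x y : V) : Prop :=
  ∃[N] p, opair_in N p x y /\ p ∈ r.

Definition inductive_in (N : V -> Prop) (w : V) : Prop :=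
  (∃[N] o, empty_in N o /\ o ∈ w) /\
  (∀[N] x, x ∈ w -> ∃[N] y, succ_in N y x /\ y ∈ w).

Definition omega_in (N : V -> Prop) (w : V) : Prop :=
  inductive_in N w /\ ∀[N] u, inductive_in N u -> subset_in N w u.

Definition function_in (N : V -> Prop) (f a b : V) : Prop :=
  (∀[N] p, p ∈ f -> ∃[N] x y, x ∈ a /\ y ∈ b /\ opair_in N p x y) /\
  (∀[N] x, x ∈ a ->
     ∃[N] y, related_in N f x y /\ ∀[N] y', related_in N f x y' -> y' ≡ y).

Definition Extensionality (N : V -> Prop) : Prop :=
  ∀[N] x y, (∀[N] z, z ∈ x <-> z ∈ y) -> x ≡ y.

Definition Foundation (N : V -> Prop) : Prop :=
  ∀[N] a, (∃[N] x, x ∈ a) -> ∃[N] x, x ∈ a /\ ∀[N] y, y ∈ x -> ~ y ∈ a.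

Definition Pairing (N : V -> Prop) : Prop :=
  ∀[N] x y, ∃[N] p, upair_in N p x y.

Definition Union (N : V -> Prop) : Prop :=
  ∀[N] a, ∃[N] u, ∀[N] x, x ∈ u <-> ∃[N] y, y ∈ a /\ x ∈ y.

Definition Powerset (N : V -> Prop) : Prop :=
  ∀[N] a, ∃[N] b, ∀[N] x, x ∈ b <-> subset_in N x a.

Definition Infinity (N : V -> Prop) : Prop := ∃[N] w, inductive_in N w.

Definition Separation (n : nat) (N : V -> Prop) : Prop :=
  forall p, Sigma n p ->
  forall e, (forall i, N (e i)) ->
  ∀[N] a, ∃[N] b, ∀[N] x, x ∈ b <-> x ∈ a /\ sat N (scons x e) p.

Definition Replacement (n : nat) (N : V -> Prop) : Prop :=
  forall p, Sigma n p ->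
  forall e, (forall i, N (e i)) ->
  ∀[N] a,
    (∀[N] x, x ∈ a ->
       ∃[N] y, sat N (scons y (scons x e)) p /\
               ∀[N] y', sat N (scons y' (scons x e)) p -> y' ≡ y) ->
    ∃[N] b, ∀[N] y, y ∈ b <-> ∃[N] x, x ∈ a /\ sat N (scons y (scons x e)) p.

Definition DependentChoice (N : V -> Prop) : Prop :=
  ∀[N] a r,
    (∃[N] x, x ∈ a) ->
    (∀[N] x, x ∈ a -> ∃[N] y, y ∈ a /\ related_in N r x y) ->
    ∃[N] w f, omega_in N w /\ function_in N f w a /\
      ∀[N] m k x y, m ∈ w -> succ_in N k m ->
        related_in N f m x -> related_in N f k y -> related_in N r x y.

(** Transitive classes (in particular sets) satisfying the fragment of ZF + DC
    in which the two schemata are restricted to Σ_n formulas.  For each n this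
    fragment is finitely axiomatisable, via a universal Σ_n formula. *)
Record model (n : nat) (N : V -> Prop) : Prop := {
  model_class : is_class N;
  model_transitive : transitive_class N;
  model_extensionality : Extensionality N;
  model_foundation : Foundation N;
  model_pairing : Pairing N;
  model_union : Union N;
  model_powerset : Powerset N;
  model_infinity : Infinity N;
  model_separation : Separation n N;
  model_replacement : Replacement n N;
  model_dc : DependentChoice N
}.

(** ** Forcing *)

(** A forcing notion is a nonempty preordered set (P, ≤); [opair p q ∈ le]
    means p ≤ q, i.e. p is stronger than q. *)
Definition forcing_notion (P le : V) : Prop :=
  (exists p, p ∈ P) /\
  (forall z, z ∈ le -> exists p q, p ∈ P /\ q ∈ P /\ z ≡ opair p q) /\
  (forall p, p ∈ P -> opair p p ∈ le) /\
  (forall p q r, opair p q ∈ le -> opair q r ∈ le -> opair p r ∈ le).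

Definition dense (P le D : V) : Prop :=
  subset D P /\ forall p, p ∈ P -> exists q, q ∈ D /\ opair q p ∈ le.

Definition filter (P le G : V) : Prop :=
  subset G P /\
  (exists p, p ∈ G) /\
  (forall p q, p ∈ G -> opair p q ∈ le -> q ∈ G) /\
  (forall p q, p ∈ G -> q ∈ G ->
     exists r, r ∈ G /\ opair r p ∈ le /\ opair r q ∈ le).

Definition generic (M : V -> Prop) (P le G : V) : Prop :=
  filter P le G /\
  forall D, M D -> dense P le D -> exists p, p ∈ G /\ p ∈ D.

(** P-names: hereditarily sets of pairs (σ, p) with σ a P-name and p ∈ P. *)
Inductive name (P : V) : V -> Prop :=
| name_intro t :
    (forall z, z ∈ t -> exists s p, name P s /\ p ∈ P /\ z ≡ opair s p) ->
    name P t.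

(** [val G t v] says v = t^G = { s^G : (s, p) ∈ t for some p ∈ G }; the two
    premises are the two inclusions. *)
Inductive val (G : V) : V -> V -> Prop :=
| val_intro t v :
    (forall w, w ∈ v -> exists s p, p ∈ G /\ opair s p ∈ t /\ val G s w) ->
    (forall s p, p ∈ G -> opair s p ∈ t -> exists w, w ∈ v /\ val G s w) ->
    val G t v.

(** M[G], for G ⊆ P. *)
Definition extension (M : V -> Prop) (P G : V) : V -> Prop :=
  fun v => exists t, M t /\ name P t /\ val G t v.

Definition in_some_forcing_extension (M : V -> Prop) (x : V) : Prop :=
  exists P le G, M (opair P le) /\ forcing_notion P le /\
                 generic M P le G /\ extension M P G x.

(** ** Eventually different reals *)

Definition neq_star (x y : nat -> nat) : Prop :=
  exists k, forall n, k <= n -> x n <> y n.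

Definition eventually_different_over (N : V -> Prop) (d : nat -> nat) : Prop :=
  forall x : nat -> nat, N (real x) -> neq_star x d.

Definition universally_eventually_different_over
    (M : V -> Prop) (d : nat -> nat) : Prop :=
  forall P le, M (opair P le) -> forcing_notion P le ->
  exists G, generic M P le G /\ eventually_different_over (extension M P G) d.

(** [n] is the level of the fixed fragment of ZF + DC; see [model]. *)
Definition neq_star_universality (n : nat) : Prop :=
  forall M, model n M -> countable_class M ->
  forall d, eventually_different_over M d ->
    in_some_forcing_extension M (real d) ->
    universally_eventually_different_over M d.

(** "d is not eventually different over M[c]", where c need not be generic
    over M, so that M[c] itself need not exist. *)
Definition not_eventually_different_over_adjoin
    (n : nat) (M : V -> Prop) (c d : nat -> nat) : Prop :=
  forall N, model n N -> (forall x, M x -> N x) -> N (real c) ->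
    ~ eventually_different_over N d.

(* Main.v *)
Require Import Defs.
From Stdlib Require Import Arith Lia List Setoid Morphisms.
From Stdlib Require Import Classical ClassicalEpsilon FunctionalExtensionality Cantor.
Import ListNotations.

(** Identify binary sequences with branches of the binary tree of positive integers ([s] has the
    children [2s] and [2s + 1]), partition ω into infinitely many infinite rows, and let a branch
    [b] determine the real sending [i] to [b (row i)]. The real [d] is built so that for every
    branch [b] outside [M] the equation [d i = b (row i)] holds infinitely often. A condition
    is a finite initial segment of [d] with a finite set A of reals of [M] which the rest of [d]
    must avoid. At most |A| branches can no longer be caught infinitely
    often: on a late level their nodes are distinct, and each of them is the value of some member
    of A at almost all positions of the corresponding row. When A grows, the newly uncatchable branches of [M] must
    first be caught; every other branch can be caught because, by compactness,
    finitely many catchable nodes bar all branches that do not start like an uncatchable branch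
    of [M]. Hence a branch that is caught only finitely often is the limit of a
    sequence from a fixed finite set of branches of [M], so it lies in [M].

    The conditions are reals of [M] and their order is definable in [M], so [d] lies in a forcing
    extension. Cohen forcing adds a branch [b] outside [M], and the real [b (row i)] has an
    explicit name; thus [d] is not eventually different over any Cohen extension. A countable
    model exists because Aczel's universe satisfies ZF + DC: take the transitive collapse of a
    countable elementary subclass. *)

(** One real has to catch uncountably many branches outside the model, and these need not be generic
    in any sense, so no list of dense sets can treat them one at a time. Compactness of the binary
    tree lets a single finite lengthening deal with all of them at once; this is the reason for
    working with binary branches instead of arbitrary reals. In the other direction, for a branch
    [b] of the model the real sending [i] to [b (row i)] lies in the model and has to be avoided
    from some point on, so uncatchable branches are bound to appear. Catching each of them before it
    becomes uncatchable has the effect that an outside branch which follows it long enough shares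
    the catch. An arbitrary real [c] enters through the branch that codes its graph: every model
    containing [c] contains this branch and the associated real, which is why nothing has to be
    known about [M[c]] itself. *)

(** * Extensional equality, pairs, numerals and reals *)

Lemma eqV_refl x : x ≡ x.
Proof. induction x as [A f IH]; simpl; split; intros a; exists a; auto. Qed.

Lemma eqV_sym x : forall y, x ≡ y -> y ≡ x.
Proof.
  induction x as [A f IH]; intros [B g] [H1 H2]; simpl; split.
  - intros b; destruct (H2 b) as [a Ha]; exists a; auto.
  - intros a; destruct (H1 a) as [b Hb]; exists b; auto.
Qed.

Lemma eqV_trans x : forall y z, x ≡ y -> y ≡ z -> x ≡ z.
Proof.
  induction x as [A f IH]; intros [B g] [C h] [H1 H2] [H3 H4]; simpl; split.
  - intros a; destruct (H1 a) as [b Hb]; destruct (H3 b) as [c Hc]; exists c; eauto.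
  - intros c; destruct (H4 c) as [b Hb]; destruct (H2 b) as [a Ha]; exists a; eauto.
Qed.

#[export] Instance eqV_equiv : Equivalence eqV.
Proof.
  split; [exact eqV_refl | intros x y; apply eqV_sym | intros x y z; apply eqV_trans].
Qed.

#[export] Instance mem_proper : Proper (eqV ==> eqV ==> iff) mem.
Proof.
  assert (H : forall x x' y y', x ≡ x' -> y ≡ y' -> x ∈ y -> x' ∈ y').
  { intros x x' [A f] [B g] Hx [H1 H2] [a Ha].
    destruct (H1 a) as [b Hb]; exists b.
    rewrite <- Hx, Ha; exact Hb. }
  intros x x' Hx y y' Hy; split; apply H; auto; now symmetry.
Qed.

Lemma mem_sup A (f : A -> V) z : z ∈ sup A f <-> exists a, z ≡ f a.
Proof. reflexivity. Qed.

Lemma eqV_ext x y : (forall z, z ∈ x <-> z ∈ y) -> x ≡ y.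
Proof.
  destruct x as [A f], y as [B g]; intros H; simpl; split.
  - intros a; apply (proj1 (H (f a))). exists a; reflexivity.
  - intros b. destruct (proj2 (H (g b))) as [a Ha].
    + exists b; reflexivity.
    + exists a; symmetry; exact Ha.
Qed.

(** The induction runs on the tree, but a member is only bisimilar to a subtree; hence the
    strengthening to all [y ≡ x]. *)
Lemma mem_ind (P : V -> Prop) :
  (forall x, (forall y, y ∈ x -> P y) -> P x) -> forall x, P x.
Proof.
  intros H x. assert (Q : forall y, y ≡ x -> P y).
  { induction x as [A f IH]; intros y Hy. apply H; intros z Hz.
    rewrite Hy in Hz. destruct Hz as [a Ha]. exact (IH a z Ha). }
  apply Q; reflexivity.
Qed.

Lemma mem_irrefl x : ~ x ∈ x.
Proof.
  induction x as [x IH] using mem_ind. intros H; exact (IH x H H).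
Qed.

Lemma mem_upair z x y : z ∈ upair x y <-> z ≡ x \/ z ≡ y.
Proof.
  unfold upair; rewrite mem_sup; split.
  - intros [[|] H]; auto.
  - intros [H|H]; [exists true | exists false]; auto.
Qed.

Lemma mem_empty z : ~ z ∈ empty.
Proof. intros [[] _]. Qed.

Lemma mem_adjoin z x y : z ∈ adjoin x y <-> z ∈ x \/ z ≡ y.
Proof.
  destruct x as [A f]; simpl; split.
  - intros [[a|] H]; eauto.
  - intros [[a H]|H]; [exists (Some a) | exists None]; auto.
Qed.

#[export] Instance upair_proper : Proper (eqV ==> eqV ==> eqV) upair.
Proof.
  intros x x' Hx y y' Hy; apply eqV_ext; intros z. now rewrite !mem_upair, Hx, Hy.
Qed.

#[export] Instance opair_proper : Proper (eqV ==> eqV ==> eqV) opair.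
Proof. intros x x' Hx y y' Hy; unfold opair. now rewrite Hx, Hy. Qed.

#[export] Instance adjoin_proper : Proper (eqV ==> eqV ==> eqV) adjoin.
Proof.
  intros x x' Hx y y' Hy; apply eqV_ext; intros z. now rewrite !mem_adjoin, Hx, Hy.
Qed.

Lemma upair_diag x y z : upair x y ≡ upair z z -> x ≡ z /\ y ≡ z.
Proof.
  intros H. assert (Hx : x ∈ upair z z) by (rewrite <- H, mem_upair; left; reflexivity).
  assert (Hy : y ∈ upair z z) by (rewrite <- H, mem_upair; right; reflexivity).
  rewrite mem_upair in Hx, Hy; tauto.
Qed.

Lemma upair_inj_r x y y' : upair x y ≡ upair x y' -> y ≡ y'.
Proof.
  intros H. assert (Hy : y ∈ upair x y') by (rewrite <- H, mem_upair; right; reflexivity).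
  assert (Hy' : y' ∈ upair x y) by (rewrite H, mem_upair; right; reflexivity).
  rewrite mem_upair in Hy, Hy'. destruct Hy as [Hy|Hy]; auto.
  destruct Hy' as [Hy'|Hy']; [|now symmetry]. now rewrite Hy, Hy'.
Qed.

Lemma opair_inj x y x' y' : opair x y ≡ opair x' y' -> x ≡ x' /\ y ≡ y'.
Proof.
  unfold opair; intros H.
  assert (Hx : x ≡ x').
  { assert (H1 : upair x x ∈ upair (upair x' x') (upair x' y'))
      by (rewrite <- H, mem_upair; left; reflexivity).
    rewrite mem_upair in H1; destruct H1 as [H1|H1].
    - now apply upair_diag in H1.
    - symmetry in H1; apply upair_diag in H1. symmetry; tauto. }
  split; [exact Hx|]. rewrite <- Hx in H.
  apply upair_inj_r in H. now apply upair_inj_r in H.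
Qed.

Lemma mem_numeral z n : z ∈ numeral n <-> exists k, k < n /\ z ≡ numeral k.
Proof.
  induction n as [|n IH]; cbn [numeral].
  - split; [intros H; now apply mem_empty in H | intros [k [Hk _]]; lia].
  - rewrite mem_adjoin, IH; split.
    + intros [[k [Hk H]]|H]; [exists k | exists n]; split; auto; lia.
    + intros [k [Hk H]]. destruct (Nat.eq_dec k n) as [->|]; auto.
      left; exists k; split; auto; lia.
Qed.

Lemma numeral_inj m n : numeral m ≡ numeral n <-> m = n.
Proof.
  split; [|intros ->; reflexivity]. intros H.
  destruct (Nat.lt_trichotomy m n) as [L|[L|L]]; auto; exfalso.
  - apply (mem_irrefl (numeral m)). rewrite H at 2. apply mem_numeral; exists m; split; auto; reflexivity.
  - apply (mem_irrefl (numeral n)). rewrite <- H at 2. apply mem_numeral; exists n; split; auto; reflexivity.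
Qed.

Lemma numeral_mem m n : numeral m ∈ numeral n <-> m < n.
Proof.
  rewrite mem_numeral; split.
  - intros [k [Hk H]]. apply numeral_inj in H; subst; auto.
  - intros H; exists m; split; auto; reflexivity.
Qed.

Lemma mem_real z f : z ∈ real f <-> exists n, z ≡ opair (numeral n) (numeral (f n)).
Proof. reflexivity. Qed.

Lemma opair_mem_real a b f : opair (numeral a) (numeral b) ∈ real f <-> f a = b.
Proof.
  rewrite mem_real; split.
  - intros [n H]. apply opair_inj in H as [H1 H2].
    apply numeral_inj in H1, H2; subst; auto.
  - intros <-; exists a; reflexivity.
Qed.

Lemma real_eq f g : real f ≡ real g <-> forall n, f n = g n.
Proof.
  split.
  - intros H n. symmetry; apply opair_mem_real. rewrite <- H. now apply opair_mem_real.
  - intros H; apply eqV_ext; intros z; rewrite !mem_real.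
    split; intros [n Hn]; exists n; [rewrite <- H | rewrite H]; exact Hn.
Qed.

(** * Environments and renaming of variables *)

Definition full : V -> Prop := fun _ => True.

Lemma scons_eqV x y e e' :
  x ≡ y -> (forall i, e i ≡ e' i) -> forall i, scons x e i ≡ scons y e' i.
Proof. intros H1 H2 [|i]; simpl; auto. Qed.

Lemma sat_ext N p : forall e e', (forall i, e i ≡ e' i) -> sat N e p <-> sat N e' p.
Proof.
  induction p as [i j|i j|p IH|p IHp q IHq|p IHp q IHq|p IHp q IHq|p IH|p IH]; intros e e' H; simpl.
  - now rewrite (H i), (H j).
  - now rewrite (H i), (H j).
  - now rewrite (IH e e').
  - now rewrite (IHp e e'), (IHq e e').
  - now rewrite (IHp e e'), (IHq e e').
  - now rewrite (IHp e e'), (IHq e e').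
  - split; intros K x Hx; (eapply IH; [|apply (K x Hx)]);
      intros i; apply scons_eqV; auto; try reflexivity; intros; now symmetry.
  - split; intros [x [Hx K]]; exists x; (split; [exact Hx|]); (eapply IH; [|apply K]);
      intros i; apply scons_eqV; auto; try reflexivity; intros; now symmetry.
Qed.

Definition upr (f : nat -> nat) (i : nat) : nat :=
  match i with 0 => 0 | S j => S (f j) end.

Fixpoint ren (f : nat -> nat) (p : form) : form :=
  match p with
  | fmem i j => fmem (f i) (f j)
  | feq i j => feq (f i) (f j)
  | fneg p => fneg (ren f p)
  | fand p q => fand (ren f p) (ren f q)
  | for_ p q => for_ (ren f p) (ren f q)
  | fimp p q => fimp (ren f p) (ren f q)
  | fall p => fall (ren (upr f) p)
  | fex p => fex (ren (upr f) p)
  end.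

Lemma sat_ren N p : forall f e e',
  (forall i, e (f i) ≡ e' i) -> sat N e (ren f p) <-> sat N e' p.
Proof.
  induction p as [i j|i j|p IH|p IHp q IHq|p IHp q IHq|p IHp q IHq|p IH|p IH]; intros f e e' H; simpl.
  - now rewrite (H i), (H j).
  - now rewrite (H i), (H j).
  - now rewrite (IH f e e').
  - now rewrite (IHp f e e'), (IHq f e e').
  - now rewrite (IHp f e e'), (IHq f e e').
  - now rewrite (IHp f e e'), (IHq f e e').
  - split; intros K x Hx; specialize (K x Hx); revert K; apply IH;
      intros [|i]; simpl; auto; reflexivity.
  - split; intros [x [Hx K]]; exists x; (split; [exact Hx|]); revert K; apply IH;
      intros [|i]; simpl; auto; reflexivity.
Qed.

Lemma Delta0_ren p : Delta0 p -> forall f, Delta0 (ren f p).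
Proof.
  induction 1; intros f; simpl; try (constructor; auto).
Qed.

#[global] Opaque eqV.

(** * Absoluteness of the basic notions for transitive classes *)

Section TransitiveClass.
Variable N : V -> Prop.
Hypothesis Ncl : is_class N.
Hypothesis Ntr : transitive_class N.
Hypothesis Npair : forall x y, N x -> N y -> N (upair x y).

Ltac Ntrans := (eapply Ntr; [|eassumption]; assumption).

Lemma N_opair x y : N x -> N y -> N (opair x y).
Proof. unfold opair; auto. Qed.

Lemma N_opair_inv x y : N (opair x y) -> N x /\ N y.
Proof.
  intros H. assert (K : N (upair x y)).
  { apply (Ntr _ _ H). apply mem_upair; right; reflexivity. }
  split; apply (Ntr _ _ K); apply mem_upair; [left|right]; reflexivity.
Qed.

Lemma empty_in_iff x : N x -> empty_in N x <-> x ≡ empty.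
Proof using Ntr.
  intros Hx; split.
  - intros H; apply eqV_ext; intros z; split; intros Hz.
    + destruct (H z); auto; Ntrans.
    + now apply mem_empty in Hz.
  - intros H z _; rewrite H; apply mem_empty.
Qed.

Lemma succ_in_iff y x : N y -> N x -> succ_in N y x <-> y ≡ adjoin x x.
Proof using Ncl Ntr.
  intros Hy Hx; split.
  - intros H; apply eqV_ext; intros z; rewrite mem_adjoin; split; intros Hz.
    + apply H; auto; Ntrans.
    + apply H; auto. destruct Hz as [Hz|Hz]; [Ntrans | eapply Ncl; [symmetry|]; eauto].
  - intros H z _; rewrite H; apply mem_adjoin.
Qed.

Lemma upair_in_iff p x y : N p -> N x -> N y -> upair_in N p x y <-> p ≡ upair x y.
Proof using Ncl Ntr.
  intros Hp Hx Hy; split.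
  - intros H; apply eqV_ext; intros z; rewrite mem_upair; split; intros Hz.
    + apply H; auto; Ntrans.
    + apply H; auto. destruct Hz as [Hz|Hz]; (eapply Ncl; [symmetry|]; eauto).
  - intros H z _; rewrite H; apply mem_upair.
Qed.

Lemma opair_in_iff p x y : N p -> N x -> N y -> opair_in N p x y <-> p ≡ opair x y.
Proof.
  intros Hp Hx Hy; split.
  - intros [u [Hu [v [Hv [H1 [H2 H3]]]]]].
    apply upair_in_iff in H1; auto. apply upair_in_iff in H2; auto.
    apply upair_in_iff in H3; auto. unfold opair. rewrite H3, H1, H2; reflexivity.
  - intros H. exists (upair x x); split; auto. exists (upair x y); split; auto.
    split; [|split]; (apply upair_in_iff; [auto using N_opair..|first [reflexivity | exact H]]).
Qed.

Lemma related_in_iff r x y : N x -> N y -> related_in N r x y <-> opair x y ∈ r.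
Proof.
  intros Hx Hy; split.
  - intros [p [Hp [H1 H2]]]. rewrite opair_in_iff in H1 by auto. now rewrite <- H1.
  - intros H. exists (opair x y); split; [now apply N_opair|].
    rewrite opair_in_iff by auto using N_opair. split; auto; reflexivity.
Qed.

Lemma inductive_in_iff w : N w ->
  inductive_in N w <-> empty ∈ w /\ forall x, x ∈ w -> adjoin x x ∈ w.
Proof using Ncl Ntr.
  intros Hw; split.
  - intros [[o [Ho [H1 H2]]] H3]; split.
    + rewrite empty_in_iff in H1 by auto. now rewrite <- H1.
    + intros x Hx. assert (Nx : N x) by (Ntrans).
      destruct (H3 x Nx Hx) as [y [Hy [H4 H5]]].
      rewrite succ_in_iff in H4 by auto. now rewrite <- H4.
  - intros [H1 H2]; split.
    + exists empty; split; [Ntrans|]. split; auto. intros z _; apply mem_empty.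
    + intros x Nx Hx; exists (adjoin x x). specialize (H2 x Hx).
      split; [Ntrans|]. split; auto. apply succ_in_iff; auto; [Ntrans|reflexivity].
Qed.

End TransitiveClass.

(** ** The universe satisfies ZF + DC *)

Definition sepV (x : V) (P : V -> Prop) : V :=
  match x with sup A f => sup {a : A | P (f a)} (fun a => f (proj1_sig a)) end.

Lemma mem_sepV x (P : V -> Prop) z :
  (forall u v, u ≡ v -> P u -> P v) -> z ∈ sepV x P <-> z ∈ x /\ P z.
Proof.
  intros HP; destruct x as [A f]; simpl; split.
  - intros [[a Ha] H]; simpl in H; split; [eauto|]. apply (HP (f a)); auto; now symmetry.
  - intros [[a Ha] H]. assert (K : P (f a)) by (eapply HP; eauto). exists (exist _ a K); auto.
Qed.

Definition powV (x : V) : V :=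
  match x with sup A f =>
    sup (A -> Prop) (fun S => sup {a : A | S a} (fun a => f (proj1_sig a))) end.

Lemma mem_powV x z : z ∈ powV x <-> subset z x.
Proof.
  destruct x as [A f]; simpl; split.
  - intros [S HS] u Hu. rewrite HS in Hu. destruct Hu as [[a Ha] K]; exists a; auto.
  - intros H. exists (fun a => f a ∈ z). apply eqV_ext; intros u; split.
    + intros Hu. destruct (H u Hu) as [a Ha]. assert (K : f a ∈ z) by now rewrite <- Ha.
      exists (exist _ a K); auto.
    + intros [[a Ha] K]; simpl in K; now rewrite K.
Qed.

Definition idx (x : V) : Type := match x with sup A _ => A end.
Definition elt (x : V) : idx x -> V := match x with sup _ f => f end.

Definition unionV (x : V) : V :=
  sup {a : idx x & idx (elt x a)} (fun s => elt (elt x (projT1 s)) (projT2 s)).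

Lemma mem_elt x z : z ∈ x <-> exists a, z ≡ elt x a.
Proof. destruct x; reflexivity. Qed.

Lemma mem_unionV x z : z ∈ unionV x <-> exists y, y ∈ x /\ z ∈ y.
Proof.
  unfold unionV; rewrite mem_sup; split.
  - intros [[a b] H]; simpl in H. exists (elt x a); split; apply mem_elt; eauto.
    exists a; reflexivity.
  - intros [y [H1 H2]]. apply mem_elt in H1 as [a Ha]. rewrite Ha in H2.
    apply mem_elt in H2 as [b Hb]. exists (existT _ a b); auto.
Qed.

Definition omegaV : V := sup nat numeral.

Lemma full_inductive w :
  inductive_in full w <-> empty ∈ w /\ forall x, x ∈ w -> adjoin x x ∈ w.
Proof. apply inductive_in_iff; easy. Qed.

Lemma full_related r x y : related_in full r x y <-> opair x y ∈ r.
Proof. apply related_in_iff; easy. Qed.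

Lemma full_omega : omega_in full omegaV.
Proof.
  split.
  - apply full_inductive; split; [exists 0; reflexivity|].
    intros x [n Hn]; exists (S n). cbn [numeral]. now rewrite Hn.
  - intros u _ Hu. apply full_inductive in Hu as [H1 H2]. intros z _ [n Hn]. rewrite Hn.
    clear Hn; induction n; cbn [numeral]; auto.
Qed.

(** Choice in the metatheory turns totality of [r] into a step function on the members of [a], which
    is iterated from [x0]. *)
Lemma full_dc : DependentChoice full.
Proof.
  intros a _ r _ [x0 [_ Hx0]] Htot.
  assert (step : forall x : {x | x ∈ a}, {y : {y | y ∈ a} | opair (proj1_sig x) (proj1_sig y) ∈ r}).
  { intros [x Hx]. apply constructive_indefinite_description.
    destruct (Htot x I Hx) as [y [_ [Hy K]]]. exists (exist _ y Hy).
    simpl. now apply full_related. }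
  set (f := nat_rect (fun _ => {x | x ∈ a}) (exist _ x0 Hx0) (fun _ x => proj1_sig (step x))).
  set (g := fun n => proj1_sig (f n)).
  assert (Hg : forall n, opair (g n) (g (S n)) ∈ r).
  { intros n. unfold g; simpl. exact (proj2_sig (step (f n))). }
  assert (Ha : forall n, g n ∈ a) by (intros n; exact (proj2_sig (f n))).
  clearbody g; clear f step.
  exists omegaV; split; [easy|]. exists (sup nat (fun n => opair (numeral n) (g n))); split; [easy|].
  split; [exact full_omega|]. split; [split|].
  - intros p _ [n Hn]. exists (numeral n); split; [easy|]. exists (g n); split; [easy|].
    split; [exists n; reflexivity|]. split; auto.
    apply opair_in_iff; easy.
  - intros x _ [n Hn]. exists (g n); split; [easy|]. split.
    + rewrite full_related. exists n. now rewrite Hn.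
    + intros y' _; rewrite full_related. intros [m Hm]. apply opair_inj in Hm as [H1 H2].
      rewrite Hn in H1. apply numeral_inj in H1; subst; auto.
  - intros m _ k _ x _ y _ Hm Hk. rewrite !full_related.
    apply succ_in_iff in Hk; [|easy..].
    intros [i Hi] [j Hj]. apply opair_inj in Hi as [Hi1 Hi2]. apply opair_inj in Hj as [Hj1 Hj2].
    rewrite Hi2, Hj2. rewrite Hk, Hi1 in Hj1. change (numeral (S i) ≡ numeral j) in Hj1.
    apply numeral_inj in Hj1; subst; auto.
Qed.

(** ** The axioms as formulas *)

Definition fiff (p q : form) : form := fand (fimp p q) (fimp q p).
Definition upair_f (p x y : nat) : form :=
  fall (fiff (fmem 0 (S p)) (for_ (feq 0 (S x)) (feq 0 (S y)))).
Definition empty_f (x : nat) : form := fall (fneg (fmem 0 (S x))).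
Definition succ_f (y x : nat) : form :=
  fall (fiff (fmem 0 (S y)) (for_ (fmem 0 (S x)) (feq 0 (S x)))).
Definition opair_f (p x y : nat) : form :=
  fex (fex (fand (upair_f 1 (S (S x)) (S (S x)))
           (fand (upair_f 0 (S (S x)) (S (S y))) (upair_f (S (S p)) 1 0)))).
Definition related_f (r x y : nat) : form :=
  fex (fand (opair_f 0 (S x) (S y)) (fmem 0 (S r))).
Definition subset_f (x y : nat) : form := fall (fimp (fmem 0 (S x)) (fmem 0 (S y))).
Definition inductive_f (w : nat) : form :=
  fand (fex (fand (empty_f 0) (fmem 0 (S w))))
       (fall (fimp (fmem 0 (S w)) (fex (fand (succ_f 0 1) (fmem 0 (S (S w))))))).
Definition omega_f (w : nat) : form :=
  fand (inductive_f w) (fall (fimp (inductive_f 0) (subset_f (S w) 0))).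
Definition function_f (f a b : nat) : form :=
  fand (fall (fimp (fmem 0 (S f))
         (fex (fex (fand (fmem 1 (S (S (S a)))) (fand (fmem 0 (S (S (S b)))) (opair_f 2 1 0)))))))
       (fall (fimp (fmem 0 (S a))
         (fex (fand (related_f (S (S f)) 1 0)
                    (fall (fimp (related_f (S (S (S f))) 2 0) (feq 0 1))))))).

(** The closed axioms are arranged so that [sat] of each is convertible with the relativised axiom;
    only the two schemata need a translation lemma. *)
Definition pairing_f : form := fall (fall (fex (upair_f 0 2 1))).
Definition union_f : form :=
  fall (fex (fall (fiff (fmem 0 1) (fex (fand (fmem 0 3) (fmem 1 0)))))).
Definition powerset_f : form := fall (fex (fall (fiff (fmem 0 1) (subset_f 0 2)))).
Definition infinity_f : form := fex (inductive_f 0).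
Definition dc_f : form :=
  fall (fall (fimp (fex (fmem 0 2))
    (fimp (fall (fimp (fmem 0 2) (fex (fand (fmem 0 3) (related_f 2 1 0)))))
      (fex (fex (fand (omega_f 1) (fand (function_f 0 1 3)
        (fall (fall (fall (fall
          (fimp (fmem 3 5) (fimp (succ_f 2 3) (fimp (related_f 4 3 1) (fimp (related_f 4 2 0)
             (related_f 6 1 0)))))))))))))))).

(** Under the quantifiers for [a] and [b] the parameters of [p] have moved up by two, while [upr]
    fixes the variable for [x]. *)
Definition separation_f (p : form) : form :=
  fall (fex (fall (fiff (fmem 0 1) (fand (fmem 0 2) (ren (upr (fun i => S (S i))) p))))).

(** The three renamings skip the variables bound in between; the last one also exchanges the two
    leading variables, since there [y] is bound before [x]. *)
Definition replacement_f (p : form) : form :=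
  fall (fimp
    (fall (fimp (fmem 0 1)
      (fex (fand (ren (upr (upr S)) p)
         (fall (fimp (ren (upr (fun i => match i with 0 => 1 | S j => S (S (S j)) end)) p) (feq 0 1)))))))
    (fex (fall (fiff (fmem 0 1)
       (fex (fand (fmem 0 3)
          (ren (fun i => match i with 0 => 1 | 1 => 0 | S (S j) => S (S (S (S j))) end) p))))))).
Lemma sat_separation N e p : sat N e (separation_f p) <->
  ∀[N] a, ∃[N] b, ∀[N] x, x ∈ b <-> x ∈ a /\ sat N (scons x e) p.
Proof.
  assert (R : forall a b x, sat N (scons x (scons b (scons a e))) (ren (upr (fun i => S (S i))) p)
    <-> sat N (scons x e) p).
  { intros; apply sat_ren. intros [|i]; reflexivity. }
  split; intros H a Ha; destruct (H a Ha) as [b [Hb K]]; exists b; (split; [exact Hb|]);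
    intros x Hx; specialize (K x Hx); simpl in *; specialize (R a b x); tauto.
Qed.

Lemma sat_replacement N e p : sat N e (replacement_f p) <->
  ∀[N] a,
    (∀[N] x, x ∈ a ->
       ∃[N] y, sat N (scons y (scons x e)) p /\
               ∀[N] y', sat N (scons y' (scons x e)) p -> y' ≡ y) ->
    ∃[N] b, ∀[N] y, y ∈ b <-> ∃[N] x, x ∈ a /\ sat N (scons y (scons x e)) p.
Proof.
  unfold replacement_f; simpl.
  assert (R1 : forall a x y, sat N (scons y (scons x (scons a e))) (ren (upr (upr S)) p)
    <-> sat N (scons y (scons x e)) p).
  { intros; apply sat_ren. intros [|[|i]]; reflexivity. }
  assert (R2 : forall a x y y', sat N (scons y' (scons y (scons x (scons a e))))
     (ren (upr (fun i => match i with 0 => 1 | S j => S (S (S j)) end)) p)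
    <-> sat N (scons y' (scons x e)) p).
  { intros; apply sat_ren. intros [|[|i]]; reflexivity. }
  assert (R3 : forall a b y x, sat N (scons x (scons y (scons b (scons a e))))
     (ren (fun i => match i with 0 => 1 | 1 => 0 | S (S j) => S (S (S (S j))) end) p)
    <-> sat N (scons y (scons x e)) p).
  { intros; apply sat_ren. intros [|[|i]]; reflexivity. }
  unfold rall, rex.
  setoid_rewrite R1; setoid_rewrite R2; setoid_rewrite R3. simpl.
  split; intros H; exact H.
Qed.

Lemma full_separation e p : sat full e (separation_f p).
Proof.
  apply sat_separation. intros a _. exists (sepV a (fun x => sat full (scons x e) p)).
  split; [easy|]. intros x _. apply mem_sepV. intros u v H; apply sat_ext.
  intros i; apply scons_eqV; [now symmetry|reflexivity].
Qed.

Lemma full_replacement e p : sat full e (replacement_f p).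
Proof.
  apply sat_replacement. intros [A f] _ H.
  assert (F : forall a : A, {y | sat full (scons y (scons (f a) e)) p /\
     forall y', sat full (scons y' (scons (f a) e)) p -> y' ≡ y}).
  { intros a. apply constructive_indefinite_description.
    destruct (H (f a) I) as [y [_ [H1 H2]]]; [exists a; reflexivity|].
    exists y; split; auto. intros y'; exact (H2 y' I). }
  exists (sup A (fun a => proj1_sig (F a))). split; [easy|]. intros y _; split.
  - intros [a Ha]. exists (f a); split; [easy|]. split; [exists a; reflexivity|].
    destruct (F a) as [z [K1 K2]]; simpl in Ha. revert K1; apply sat_ext.
    intros i; apply scons_eqV; [now symmetry|reflexivity].
  - intros [x [_ [[a Ha] K]]]. exists a. destruct (F a) as [z [K1 K2]]; simpl. apply K2.
    revert K; apply sat_ext. intros [|i]; [reflexivity|]. simpl.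
    apply scons_eqV; [now symmetry|reflexivity].
Qed.

Lemma full_pairing e : sat full e pairing_f.
Proof. intros x _ y _. exists (upair x y); split; [easy|]. intros z _; apply mem_upair. Qed.

Lemma full_union e : sat full e union_f.
Proof.
  intros a _. exists (unionV a); split; [easy|]. intros x _; simpl. split.
  - intros H; apply mem_unionV in H as [y H]. exists y; split; [easy|auto].
  - intros [y [_ H]]. apply mem_unionV; eauto.
Qed.

Lemma full_powerset e : sat full e powerset_f.
Proof.
  intros a _. exists (powV a); split; [easy|]. intros x _; simpl. split.
  - intros H z _; exact (proj1 (mem_powV a x) H z).
  - intros H; apply mem_powV. intros z; exact (H z I).
Qed.

Lemma full_infinity e : sat full e infinity_f.
Proof. exists omegaV; split; [easy|]. exact (proj1 full_omega). Qed.

Lemma full_dc_f e : sat full e dc_f.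
Proof. exact full_dc. Qed.

(** ** A countable elementary class *)

Definition countable_pred {T : Type} (S : T -> Prop) : Prop :=
  exists e : nat -> T, forall t, S t -> exists n, e n = t.

Lemma countable_sub {T} (S S' : T -> Prop) :
  (forall t, S t -> S' t) -> countable_pred S' -> countable_pred S.
Proof. intros H [e He]; exists e; auto. Qed.

Lemma countable_image2 {A B T} (f : A -> B -> T) (S : A -> Prop) (S' : B -> Prop) :
  countable_pred S -> countable_pred S' ->
  countable_pred (fun t => exists a b, S a /\ S' b /\ t = f a b).
Proof.
  intros [e He] [e' He']. exists (fun n => f (e (fst (of_nat n))) (e' (snd (of_nat n)))).
  intros t [a [b [Ha [Hb ->]]]]. destruct (He a Ha) as [i Hi], (He' b Hb) as [j Hj].
  exists (to_nat (i, j)). rewrite cancel_of_to; simpl. now rewrite Hi, Hj.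
Qed.

Lemma countable_union {T} (S : nat -> T -> Prop) :
  (forall i, countable_pred (S i)) -> countable_pred (fun t => exists i, S i t).
Proof.
  intros H. apply choice in H as [e He].
  exists (fun n => e (fst (of_nat n)) (snd (of_nat n))).
  intros t [i Hi]. destruct (He i t Hi) as [j Hj].
  exists (to_nat (i, j)). now rewrite cancel_of_to.
Qed.

Lemma countable_or {T} (S S' : T -> Prop) :
  countable_pred S -> countable_pred S' -> countable_pred (fun t => S t \/ S' t).
Proof.
  intros H H'. apply (countable_sub _ (fun t => exists i : nat, (match i with 0 => S | _ => S' end) t)).
  - intros t [K|K]; [exists 0 | exists 1]; auto.
  - apply countable_union; intros [|i]; auto.
Qed.

Lemma countable_nat : countable_pred (fun _ : nat => True).
Proof. exists (fun n => n); eauto. Qed.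

Lemma countable_eq {T} (t : T) : countable_pred (eq t).
Proof. exists (fun _ => t); intros u <-; exists 0; auto. Qed.

Lemma countable_list {T} (S : T -> Prop) : countable_pred S -> countable_pred (Forall S).
Proof.
  intros H. apply (countable_sub _ (fun l => exists i, Forall S l /\ length l = i)).
  - intros l Hl; exists (length l); auto.
  - apply countable_union; intros i. induction i as [|i IH].
    + eapply countable_sub; [|apply (countable_eq nil)]. intros [|a l] [_ K]; [auto|discriminate].
    + eapply countable_sub; [|apply (countable_image2 cons S _ H IH)].
      intros [|a l] [K1 K2]; [discriminate|]. inversion K1; subst. exists a, l; auto.
Qed.

Fixpoint fdepth (p : form) : nat :=
  match p with
  | fmem _ _ | feq _ _ => 0
  | fneg p | fall p | fex p => S (fdepth p)
  | fand p q | for_ p q | fimp p q => S (Nat.max (fdepth p) (fdepth q))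
  end.

Lemma countable_form : countable_pred (fun _ : form => True).
Proof.
  apply (countable_sub _ (fun p => exists i, fdepth p <= i)); [eauto|].
  apply countable_union; intros i.
  assert (A : countable_pred (fun p => fdepth p = 0)).
  { eapply countable_sub; [|apply countable_or;
      [apply (countable_image2 fmem _ _ countable_nat countable_nat)
      |apply (countable_image2 feq _ _ countable_nat countable_nat)]].
    intros [j k|j k| | | | | |]; simpl; try discriminate; intros _; [left|right]; exists j, k; auto. }
  induction i as [|i IH].
  - eapply countable_sub; [|exact A]. simpl; intros; lia.
  - set (B := fun p => fdepth p <= i) in *.
    (* Unary connectives go through [countable_image2] as well, with a dummy second argument. *)
    assert (U : forall f : form -> form, countable_pred (fun t => exists a b, B a /\ B b /\ t = f a)).
    { intros f; apply (countable_image2 (fun a _ => f a) _ _ IH IH). }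
    eapply countable_sub; [|
      apply countable_or; [exact A|];
      apply countable_or; [exact (U fneg)|];
      apply countable_or; [exact (U fall)|];
      apply countable_or; [exact (U fex)|];
      apply countable_or; [exact (countable_image2 fand _ _ IH IH)|];
      apply countable_or; [exact (countable_image2 for_ _ _ IH IH)|];
      exact (countable_image2 fimp _ _ IH IH)].
    unfold B; intros [j k|j k|p|p q|p q|p q|p|p] H; simpl in H.
    + left; auto.
    + left; auto.
    + right; left; exists p, p; repeat split; auto; lia.
    + do 4 right; left; exists p, q; repeat split; auto; lia.
    + do 5 right; left; exists p, q; repeat split; auto; lia.
    + do 6 right; exists p, q; repeat split; auto; lia.
    + do 2 right; left; exists p, p; repeat split; auto; lia.
    + do 3 right; left; exists p, p; repeat split; auto; lia.
Qed.

Definition env (l : list V) (i : nat) : V := nth i l empty.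

(** A choice of a witness for [fex p]; where none exists the value is arbitrary, which merely adds a
    set to the hull. *)
Definition skolem (p : form) (l : list V) : V :=
  epsilon (inhabits empty) (fun x => sat full (scons x (env l)) p).

(** The conjunct [True] makes the clause an instance of [countable_image2] over the set of all
    formulas. *)
Fixpoint stage (k : nat) (x : V) : Prop :=
  match k with
  | 0 => False
  | S k => stage k x \/ exists p l, True /\ Forall (stage k) l /\ x = skolem p l
  end.

(** Closing under [≡] yields a class, while countability is proved for the representatives, where
    Leibniz equality can be used. *)
Definition hull (x : V) : Prop := exists h, x ≡ h /\ exists k, stage k h.

Lemma stage_le k k' x : k <= k' -> stage k x -> stage k' x.
Proof. induction 1; simpl; auto. Qed.

Lemma countable_stage k : countable_pred (stage k).
Proof.
  induction k as [|k IH]; simpl.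
  - exists (fun _ => empty); tauto.
  - apply countable_or; auto. apply countable_image2; [exact countable_form|].
    now apply countable_list.
Qed.

Lemma stage_list l : Forall (fun x => exists k, stage k x) l -> exists k, Forall (stage k) l.
Proof.
  induction 1 as [|x l [k Hk] _ [k' IH]]; [exists 0; auto|].
  exists (Nat.max k k'). constructor; [revert Hk; apply stage_le; lia|].
  revert IH; apply Forall_impl; intros y; apply stage_le; lia.
Qed.

Fixpoint fbound (p : form) : nat :=
  match p with
  | fmem i j | feq i j => S (Nat.max i j)
  | fneg p => fbound p
  | fand p q | for_ p q | fimp p q => Nat.max (fbound p) (fbound q)
  | fall p | fex p => Nat.pred (fbound p)
  end.

(** Truth depends on finitely many variables, so a Skolem witness needs only a finite list of
    parameters; this keeps the hull countable. *)
Lemma sat_bound N p : forall e e', (forall i, i < fbound p -> e i ≡ e' i) ->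
  sat N e p <-> sat N e' p.
Proof.
  induction p as [i j|i j|p IH|p IHp q IHq|p IHp q IHq|p IHp q IHq|p IH|p IH]; intros e e' H; simpl in *.
  - rewrite (H i), (H j) by lia; reflexivity.
  - rewrite (H i), (H j) by lia; reflexivity.
  - now rewrite (IH e e').
  - rewrite (IHp e e'), (IHq e e'); [reflexivity|intros; apply H; lia..].
  - rewrite (IHp e e'), (IHq e e'); [reflexivity|intros; apply H; lia..].
  - rewrite (IHp e e'), (IHq e e'); [reflexivity|intros; apply H; lia..].
  - assert (K : forall x, sat N (scons x e) p <-> sat N (scons x e') p).
    { intros x; apply IH; intros [|i] Hi; simpl; [reflexivity|apply H; lia]. }
    split; intros L x Hx; apply K; auto.
  - assert (K : forall x, sat N (scons x e) p <-> sat N (scons x e') p).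
    { intros x; apply IH; intros [|i] Hi; simpl; [reflexivity|apply H; lia]. }
    split; intros [x [Hx L]]; exists x; (split; [exact Hx|]); apply K; auto.
Qed.

Lemma hull_class : is_class hull.
Proof. intros x y H [h [H1 H2]]; exists h; split; auto. now rewrite <- H. Qed.

Lemma hull_witness p e : (forall i, hull (e i)) ->
  (exists x, sat full (scons x e) p) -> exists x, hull x /\ sat full (scons x e) p.
Proof.
  intros He [x Hx].
  assert (Hc : forall i, exists h, e i ≡ h /\ exists k, stage k h) by exact He.
  apply choice in Hc as [h Hh].
  set (l := map h (seq 0 (fbound p))).
  assert (El : forall x, sat full (scons x e) p <-> sat full (scons x (env l)) p).
  { intros y; apply sat_bound. intros [|i] Hi; simpl; [reflexivity|].
    unfold env, l. rewrite nth_indep with (d' := h 0) by (rewrite length_map, length_seq; lia).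
    rewrite map_nth, seq_nth by lia. apply Hh. }
  assert (Hl : exists k, Forall (stage k) l).
  { apply stage_list. apply Forall_forall. intros y Hy. apply in_map_iff in Hy as [i [<- _]]. apply Hh. }
  destruct Hl as [k Hk]. exists (skolem p l); split.
  - exists (skolem p l); split; [reflexivity|]. exists (S k); simpl. right; exists p, l; auto.
  - apply El. unfold skolem. apply epsilon_spec. exists x. now apply El.
Qed.

(** The Tarski-Vaught test: [hull_witness] settles the existential quantifier, and the universal one
    through its negation. *)
Lemma hull_elementary p : forall e, (forall i, hull (e i)) -> sat hull e p <-> sat full e p.
Proof.
  assert (Hs : forall x e, hull x -> (forall i, hull (e i)) -> forall i, hull (scons x e i)).
  { intros x e Hx He [|i]; simpl; auto. }
  induction p as [i j|i j|p IH|p IHp q IHq|p IHp q IHq|p IHp q IHq|p IH|p IH]; intros e He; simpl.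
  - reflexivity.
  - reflexivity.
  - now rewrite IH.
  - now rewrite IHp, IHq.
  - now rewrite IHp, IHq.
  - now rewrite IHp, IHq.
  - split; intros H.
    + apply NNPP; intros C. apply not_all_ex_not in C as [x Hx].
      assert (D : exists x, sat full (scons x e) (fneg p)) by (exists x; simpl; tauto).
      apply hull_witness in D as [y [Hy Ky]]; auto. apply Ky. apply IH; auto.
    + intros x Hx. apply IH; auto. apply H; easy.
  - split.
    + intros [x [Hx K]]; exists x; split; [easy|]. apply IH; auto.
    + intros [x [_ K]]. destruct (hull_witness p e He) as [y [Hy Ky]]; [eauto|].
      exists y; split; auto. apply IH; auto.
Qed.

(** * The transitive collapse of the hull *)

Fixpoint collapse (x : V) : V :=
  match x with
  | sup A f => sup {a : A | hull (f a)} (fun s => collapse (f (proj1_sig s)))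
  end.

Lemma mem_collapse_elt z x :
  z ∈ collapse x <-> exists a, hull (elt x a) /\ z ≡ collapse (elt x a).
Proof.
  destruct x as [A f]; simpl; split.
  - intros [[a Ha] H]; eauto.
  - intros [a [Ha H]]; exists (exist _ a Ha); auto.
Qed.

Lemma collapse_eqV x : forall y, x ≡ y -> collapse x ≡ collapse y.
Proof.
  induction x as [A f IH]; intros y Hy. apply eqV_ext; intros z.
  rewrite !mem_collapse_elt; split.
  - intros [a [Ha Hz]]. simpl in a, Ha, Hz.
    assert (K : f a ∈ y) by (rewrite <- Hy; exists a; reflexivity).
    apply mem_elt in K as [b Hb]. exists b; split.
    + exact (hull_class _ _ Hb Ha).
    + rewrite Hz. now apply IH.
  - intros [b [Hb Hz]].
    assert (K : elt y b ∈ sup A f) by (rewrite Hy; apply mem_elt; exists b; reflexivity).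
    destruct K as [a Ha]. exists a; simpl; split.
    + exact (hull_class _ _ Ha Hb).
    + rewrite Hz. symmetry; apply IH. now symmetry.
Qed.

#[export] Instance collapse_proper : Proper (eqV ==> eqV) collapse.
Proof. intros x y; apply collapse_eqV. Qed.

Lemma mem_collapse z x : z ∈ collapse x <-> exists y, hull y /\ y ∈ x /\ z ≡ collapse y.
Proof.
  rewrite mem_collapse_elt; split.
  - intros [a [Ha Hz]]; exists (elt x a). split; [exact Ha|]. split; [|exact Hz].
    apply mem_elt; exists a; reflexivity.
  - intros [y [Hy [Hm Hz]]]. apply mem_elt in Hm as [a Ha]. exists a; split.
    + exact (hull_class _ _ Ha Hy).
    + now rewrite Hz, Ha.
Qed.

(** Elementarity transfers extensionality to the hull, although the hull need not be transitive. *)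
Lemma hull_ext x y : hull x -> hull y -> (forall z, hull z -> z ∈ x <-> z ∈ y) -> x ≡ y.
Proof.
  intros Hx Hy H.
  assert (E : sat hull (scons x (fun _ => y)) (fall (fiff (fmem 0 1) (fmem 0 2)))).
  { intros z Hz; exact (H z Hz). }
  apply hull_elementary in E; [|intros [|i]; auto].
  apply eqV_ext; intros z; exact (E z I).
Qed.

Lemma collapse_inj x : forall y, hull x -> hull y -> collapse x ≡ collapse y -> x ≡ y.
Proof.
  induction x as [x IH] using mem_ind. intros y Hx Hy H. apply hull_ext; auto.
  intros z Hz; split; intros K.
  - assert (L : collapse z ∈ collapse y).
    { rewrite <- H; apply mem_collapse; exists z; repeat (split; auto); reflexivity. }
    apply mem_collapse in L as [z' [Hz' [K' E]]].
    now rewrite (IH z K z' Hz Hz' E).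
  - assert (L : collapse z ∈ collapse x).
    { rewrite H; apply mem_collapse; exists z; repeat (split; auto); reflexivity. }
    apply mem_collapse in L as [z' [Hz' [K' E]]].
    symmetry in E. now rewrite <- (IH z' K' z Hz' Hz E).
Qed.

Definition countable_model (x : V) : Prop := exists y, hull y /\ x ≡ collapse y.

(** [collapse] is an isomorphism of the hull onto [countable_model]: it preserves membership by
    construction and reflects it by injectivity. *)
Lemma sat_collapse p : forall e, (forall i, hull (e i)) ->
  sat hull e p <-> sat countable_model (fun i => collapse (e i)) p.
Proof.
  assert (Hs : forall x e, hull x -> (forall i, hull (e i)) -> forall i, hull (scons x e i)).
  { intros x e Hx He [|i]; simpl; auto. }
  assert (Hq : forall x y e p, y ≡ collapse x ->
    sat countable_model (scons y (fun i => collapse (e i))) p <->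
    sat countable_model (fun i => collapse (scons x e i)) p).
  { intros x y e q H; apply sat_ext; intros [|i]; simpl; auto; reflexivity. }
  induction p as [i j|i j|p IH|p IHp q IHq|p IHp q IHq|p IHp q IHq|p IH|p IH]; intros e He; simpl.
  - split; intros H.
    + apply mem_collapse; exists (e i); repeat (split; auto); reflexivity.
    + apply mem_collapse in H as [y [Hy [K E]]]. now rewrite (collapse_inj _ _ (He i) Hy E).
  - split; intros H; [now rewrite H | now apply collapse_inj].
  - now rewrite IH.
  - now rewrite IHp, IHq.
  - now rewrite IHp, IHq.
  - now rewrite IHp, IHq.
  - split; intros H.
    + intros y [x [Hx E]]. apply (Hq x y e p E). apply IH; auto.
    + intros x Hx. apply IH; auto. apply (Hq x (collapse x) e p); [reflexivity|].
      apply H. exists x; split; auto; reflexivity.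
  - split.
    + intros [x [Hx K]]. exists (collapse x); split; [exists x; split; auto; reflexivity|].
      apply (Hq x (collapse x) e p); [reflexivity|]. apply IH; auto.
    + intros [y [[x [Hx E]] K]]. exists x; split; auto. apply IH; auto.
      now apply (Hq x y e p E).
Qed.

Lemma countable_model_transfer p : (forall e, sat full e p) ->
  forall e, (forall i, countable_model (e i)) -> sat countable_model e p.
Proof.
  intros H e He.
  apply choice in He as [e' He'].
  apply (sat_ext _ p e (fun i => collapse (e' i))); [intros i; apply He'|].
  apply sat_collapse; [intros i; apply He'|]. apply hull_elementary; [intros i; apply He'|]. apply H.
Qed.

Lemma countable_model_class : is_class countable_model.
Proof. intros x y E [z [Hz K]]; exists z; split; auto. now rewrite <- E. Qed.

Lemma countable_model_transitive : transitive_class countable_model.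
Proof.
  intros x y [z [Hz E]] Hy. rewrite E in Hy. apply mem_collapse in Hy as [u [Hu [_ K]]]. exists u; auto.
Qed.

Lemma countable_model_inhabited : exists x, countable_model x.
Proof.
  exists (collapse (skolem (feq 0 0) nil)), (skolem (feq 0 0) nil); split; [|reflexivity].
  exists (skolem (feq 0 0) nil); split; [reflexivity|]. exists 1; simpl. right; exists (feq 0 0), nil; auto.
Qed.

Lemma countable_model_countable : countable_class countable_model.
Proof.
  assert (H : countable_pred (fun x => exists k, stage k x)) by apply countable_union, countable_stage.
  destruct H as [e He]. exists (fun n => collapse (e n)).
  intros x [y [[h [E Hh]] Ex]]. destruct (He h Hh) as [n Hn]. exists n. now rewrite Hn, <- E.
Qed.

Lemma trans_extensionality N : transitive_class N -> Extensionality N.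
Proof.
  intros Ht x Hx y Hy H. apply eqV_ext; intros z; split; intros Hz; apply H; auto;
    [exact (Ht x z Hx Hz)|exact (Ht y z Hy Hz)].
Qed.

Lemma trans_foundation N : transitive_class N -> Foundation N.
Proof.
  intros Ht a Ha [x [Hx K]]. clear Hx. revert K. induction x as [x IH] using mem_ind; intros K.
  destruct (classic (exists y, y ∈ x /\ y ∈ a)) as [[y [H1 H2]]|C]; eauto.
  exists x; split; [exact (Ht a x Ha K)|]. split; auto. intros y _ H1 H2; apply C; eauto.
Qed.

Lemma countable_model_model n : model n countable_model.
Proof.
  destruct countable_model_inhabited as [x0 Hx0].
  assert (T : forall p, (forall e, sat full e p) -> sat countable_model (fun _ => x0) p).
  { intros p H; apply countable_model_transfer; auto. }
  split.
  - exact countable_model_class.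
  - exact countable_model_transitive.
  - exact (trans_extensionality _ countable_model_transitive).
  - exact (trans_foundation _ countable_model_transitive).
  - exact (T _ full_pairing).
  - exact (T _ full_union).
  - exact (T _ full_powerset).
  - exact (T _ full_infinity).
  - intros p _ e He. apply sat_separation, countable_model_transfer; auto.
    intros e'; apply full_separation.
  - intros p _ e He. apply sat_replacement, countable_model_transfer; auto.
    intros e'; apply full_replacement.
  - exact (T _ full_dc_f).
Qed.

Definition update (f : nat -> nat) (a b k : nat) : nat := if k =? a then b else f k.

Definition splice (c : nat -> nat) (L : nat) (g : nat -> nat) (l : nat) : nat :=
  if l <? L then c l else g (l - L).

(** ** The binary tree *)

(** Nodes are the positive integers, the children of [s] are [2s] and [2s + 1], and the level
    of [s] is [log2 s]. *)
Definition branch (b : nat -> nat) : Prop :=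
  b 0 = 1 /\ forall l, b (S l) = 2 * b l \/ b (S l) = S (2 * b l).

Definition row (i : nat) : nat := fst (of_nat i).

Lemma row_le i : row i <= i.
Proof.
  unfold row. pose proof (to_nat_non_decreasing (fst (of_nat i)) (snd (of_nat i))) as H.
  rewrite <- surjective_pairing, cancel_to_of in H. lia.
Qed.

Lemma row_infinite l N : exists i, N <= i /\ row i = l.
Proof.
  exists (to_nat (l, N)). split.
  - pose proof (to_nat_non_decreasing l N); lia.
  - unfold row. now rewrite cancel_of_to.
Qed.

Lemma branch_bounds b l : branch b -> 2 ^ l <= b l < 2 ^ S l.
Proof.
  intros [H0 HS]; induction l as [|l IH]; [rewrite H0; simpl; lia|].
  rewrite !Nat.pow_succ_r' in *. destruct (HS l) as [-> | ->]; lia.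
Qed.

Lemma branch_log2 b l : branch b -> Nat.log2 (b l) = l.
Proof. intros H. apply Nat.log2_unique; [lia|]. now apply branch_bounds. Qed.

Lemma branch_agree b c L : branch b -> branch c -> b L = c L -> forall l, l <= L -> b l = c l.
Proof.
  intros [_ Hb] [_ Hc]. induction L as [|L IH]; intros H l Hl.
  - now replace l with 0 by lia.
  - destruct (Nat.eq_dec l (S L)) as [->|]; auto. apply IH; [|lia].
    destruct (Hb L), (Hc L); lia.
Qed.

Lemma branch_splice c L g : branch c -> g 0 = c L ->
  (forall k, g (S k) = 2 * g k \/ g (S k) = S (2 * g k)) -> branch (splice c L g).
Proof.
  intros [H0 HS] Hg HgS. unfold splice; split.
  - destruct (Nat.ltb_spec 0 L); auto. replace L with 0 in * by lia. simpl. congruence.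
  - intros l. destruct (Nat.ltb_spec (S l) L), (Nat.ltb_spec l L); try lia; auto.
    + replace (S l - L) with 0 by lia. rewrite Hg. replace L with (S l) by lia. auto.
    + replace (S l - L) with (S (l - L)) by lia. auto.
Qed.

Lemma splice_below c L g l : g 0 = c L -> l <= L -> splice c L g l = c l.
Proof.
  intros Hg Hl; unfold splice. destruct (Nat.ltb_spec l L); auto.
  replace l with L by lia. now rewrite Nat.sub_diag.
Qed.

(** ** Conditions *)

(** A real [p] codes a finite sequence of length [slen p], with entries [entry p], and finitely
    many reals [forb p j], [j < fcnt p], which further entries have to avoid. *)
Definition slen (p : nat -> nat) : nat := p 0.
Definition fcnt (p : nat -> nat) : nat := p 1.
Definition entry (p : nat -> nat) (i : nat) : nat := p (S (S (to_nat (0, i)))).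
Definition forb (p : nat -> nat) (j i : nat) : nat := p (S (S (to_nat (S j, i)))).

Definition forbidden (p : nat -> nat) (i s : nat) : Prop :=
  exists j, j < fcnt p /\ forb p j i = s.

(** [blocked p s]: at almost every position whose row is the level of [s] the value [s] is
    forbidden. *)
Definition blocked (p : nat -> nat) (s : nat) : Prop :=
  exists N, forall i, N <= i -> row i = Nat.log2 s -> forbidden p i s.

Definition uncatchable (p b : nat -> nat) : Prop :=
  exists l0, forall l, l0 <= l -> blocked p (b l).

Definition catches (p' p c : nat -> nat) : Prop :=
  exists i, slen p <= i /\ i < slen p' /\ entry p' i = c (row i).

(** Only the finite sequence grows. As the forbidden reals stay fixed, no branch becomes newly
    uncatchable, so this is always an extension in the sense of [extends]. *)
Definition lengthens (p' p : nat -> nat) : Prop :=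
  slen p <= slen p' /\ fcnt p' = fcnt p /\
  (forall i, i < slen p -> entry p' i = entry p i) /\
  (forall j i, forb p' j i = forb p j i) /\
  (forall i, slen p <= i -> i < slen p' -> ~ forbidden p i (entry p' i)).

Lemma blocked_ext p p' s : (forall i, forbidden p i s -> forbidden p' i s) ->
  blocked p s -> blocked p' s.
Proof. intros H [N K]; exists N; auto. Qed.

Lemma uncatchable_ext p p' b : (forall i s, forbidden p i s -> forbidden p' i s) ->
  uncatchable p b -> uncatchable p' b.
Proof. intros H [l0 K]; exists l0; intros l Hl. apply (blocked_ext p); auto. Qed.

Lemma forbidden_lengthens p' p i s : lengthens p' p -> forbidden p' i s <-> forbidden p i s.
Proof.
  intros [_ [H1 [_ [H2 _]]]]. unfold forbidden; rewrite H1.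
  split; intros [j Hj]; exists j; [rewrite <- H2|rewrite H2]; auto.
Qed.

Lemma lengthens_refl p : lengthens p p.
Proof. unfold lengthens. repeat split; auto; intros; lia. Qed.

Lemma lengthens_trans p q t : lengthens p q -> lengthens q t -> lengthens p t.
Proof.
  intros Hpq Hqt. pose proof Hpq as [H1 [H2 [H3 [H4 H5]]]].
  pose proof Hqt as [K1 [K2 [K3 [K4 K5]]]].
  split; [lia|]. split; [congruence|]. split; [|split].
  - intros i Hi. rewrite H3 by lia. auto.
  - intros j i. now rewrite H4.
  - intros i Hi Hi'. destruct (Nat.lt_ge_cases i (slen q)).
    + rewrite H3 by auto. auto.
    + rewrite <- (forbidden_lengthens q t) by auto. auto.
Qed.

Lemma to_nat_pair_inj a b a' b' : to_nat (a, b) = to_nat (a', b') -> a = a' /\ b = b'.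
Proof. intros H. apply to_nat_inj in H. injection H; auto. Qed.

Lemma fresh_value p i : exists s, ~ forbidden p i s.
Proof.
  assert (H : forall k, exists B, forall j, j < k -> forb p j i < B).
  { induction k as [|k [B IH]]; [exists 0; lia|]. exists (S (Nat.max B (forb p k i))).
    intros j Hj. destruct (Nat.eq_dec j k) as [->|]; [lia|]. specialize (IH j). lia. }
  destruct (H (fcnt p)) as [B HB]. exists B. intros [j [Hj E]]. specialize (HB j Hj). lia.
Qed.

(** A set [W] of positions with values covers both uses: catching a branch, and realising a given
    node in the row of its level. *)
Definition meets (p' p : nat -> nat) (W : nat -> nat -> Prop) : Prop :=
  exists i, slen p <= i /\ i < slen p' /\ W i (entry p' i).

Definition demand (p : nat -> nat) (W : nat -> nat -> Prop) : Prop :=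
  forall N, exists i s, N <= i /\ W i s /\ ~ forbidden p i s.

Lemma meets_mono p q t W : lengthens p q -> lengthens q t -> meets q t W -> meets p t W.
Proof.
  intros [H1 [_ [H2 _]]] _ [i [Hi [Hi' K]]]. exists i; split; auto. split; [lia|]. rewrite H2; auto.
Qed.

(** ** Only finitely many branches are uncatchable *)

Lemma uncatchable_pairwise p bs : (forall b, In b bs -> branch b /\ uncatchable p b) ->
  ForallOrdPairs (fun b c : nat -> nat => exists l, b l <> c l) bs -> length bs <= fcnt p.
Proof.
  intros Hb Hd.
  assert (H1 : exists L, forall l, L <= l -> NoDup (map (fun b => b l) bs)).
  { induction Hd as [|b bs Hd1 _ IH]; [exists 0; intros; constructor|].
    destruct IH as [L HL]; [intros; apply Hb; now right|].
    assert (H : exists L', forall c, In c bs -> exists l, l <= L' /\ b l <> c l).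
    { clear - Hd1. induction bs as [|c bs IH]; [exists 0; intros ? []|].
      inversion Hd1 as [|? ? [l Hl] Hd2]; subst. destruct (IH Hd2) as [L' HL'].
      exists (Nat.max l L'). intros c' [<-|Hc']; [exists l; split; auto; lia|].
      destruct (HL' c' Hc') as [l' [K1 K2]]; exists l'; split; auto; lia. }
    destruct H as [L' HL']. exists (Nat.max L L'). intros l Hl. simpl. constructor; [|apply HL; lia].
    intros K. apply in_map_iff in K as [c [E Hc]]. destruct (HL' c Hc) as [m [Hm D]]. apply D.
    symmetry. apply (branch_agree c b l); auto; try lia; apply Hb; [now right|now left]. }
  assert (H2 : exists L, forall b l, In b bs -> L <= l -> blocked p (b l)).
  { clear Hd H1. induction bs as [|b bs IH]; [exists 0; intros ? ? []|].
    destruct IH as [L HL]; [intros; apply Hb; now right|].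
    destruct (proj2 (Hb b (or_introl eq_refl))) as [L' HL']. exists (Nat.max L L').
    intros c l [<-|Hc] Hl; [apply HL'; lia|apply HL; auto; lia]. }
  (* Pigeonhole on one level past both thresholds, at one position of its row past [N]: the distinct
     values [b l] are all among the [fcnt p] forbidden ones. *)
  destruct H1 as [L1 H1], H2 as [L2 H2]. set (l := Nat.max L1 L2).
  assert (H3 : exists N, forall b i, In b bs -> N <= i -> row i = l -> forbidden p i (b l)).
  { assert (K : forall b, In b bs -> blocked p (b l)) by (intros; apply H2; auto; lia).
    clear - Hb K. induction bs as [|b bs IH]; [exists 0; intros ? ? []|].
    destruct IH as [N HN]; [intros; apply Hb; now right|intros; apply K; now right|].
    destruct (K b (or_introl eq_refl)) as [N' HN']. exists (Nat.max N N').
    intros c i [<-|Hc] Hi Hr; [|apply HN; auto; lia]. apply HN'; [lia|].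
    rewrite branch_log2; auto. now apply Hb; left. }
  destruct H3 as [N HN]. destruct (row_infinite l N) as [i [Hi Hr]].
  assert (NoDup (map (fun b => b l) bs)) by (apply H1; lia).
  rewrite <- (length_map (fun b => b l) bs).
  rewrite <- (length_seq (fcnt p) 0), <- (length_map (fun j => forb p j i) (seq 0 (fcnt p))).
  apply NoDup_incl_length; auto. intros s Hs. apply in_map_iff in Hs as [b [<- Hbs]].
  destruct (HN b i Hbs Hi Hr) as [j [Hj E]]. apply in_map_iff. exists j; split; auto.
  apply in_seq; lia.
Qed.

(** If no finite list represented [Q], pairwise different members could be added one at a time until
    the bound [fcnt p] is exceeded. *)
Lemma uncatchable_finite p (Q : (nat -> nat) -> Prop) :
  (forall b, Q b -> branch b /\ uncatchable p b) ->
  exists bs, (forall b, In b bs -> Q b) /\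
    forall b, Q b -> exists b', In b' bs /\ forall l, b l = b' l.
Proof.
  intros HQ. apply NNPP; intros C.
  assert (H : forall k, exists bs, length bs = k /\ (forall b, In b bs -> Q b) /\
    ForallOrdPairs (fun b c : nat -> nat => exists l, b l <> c l) bs).
  { induction k as [|k [bs [H1 [H2 H3]]]].
    - exists nil; split; auto. split; [intros ? []|constructor].
    - apply NNPP; intros D. apply C. exists bs; split; auto. intros b Hb. apply NNPP; intros E.
      apply D. exists (b :: bs). split; [simpl; lia|]. split; [intros c [<-|Hc]; auto|].
      constructor; auto. apply Forall_forall. intros c Hc. apply NNPP; intros F. apply E.
      exists c; split; auto. intros l. apply NNPP; intros G; eauto. }
  destruct (H (S (fcnt p))) as [bs [H1 [H2 H3]]].
  apply uncatchable_pairwise with (p := p) in H3; [lia|]. auto.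
Qed.

Lemma not_blocked_demand p t : ~ blocked p t ->
  demand p (fun i s => s = t /\ row i = Nat.log2 t).
Proof.
  intros H N. apply NNPP; intros C. apply H. exists N. intros i Hi Hr.
  apply NNPP; intros D. apply C. exists i, t; auto.
Qed.

(** Column [0] of the pairing holds the entries and column [S j] the forbidden real with index [j];
    the new index is [p 1], so column [S (p 1)] is overwritten. *)
Definition add_forbidden (p y : nat -> nat) (k : nat) : nat :=
  match k with
  | 0 => p 0
  | 1 => S (p 1)
  | S (S i) => if fst (of_nat i) =? S (p 1) then y (snd (of_nat i)) else p k
  end.

Lemma add_forbidden_spec p y :
  slen (add_forbidden p y) = slen p /\ fcnt (add_forbidden p y) = S (fcnt p) /\
  (forall i, entry (add_forbidden p y) i = entry p i) /\
  (forall j i, j < fcnt p -> forb (add_forbidden p y) j i = forb p j i) /\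
  (forall i, forb (add_forbidden p y) (fcnt p) i = y i).
Proof.
  split; [reflexivity|]. split; [reflexivity|]. split; [|split].
  - intros i. unfold entry. cbn [add_forbidden]. now rewrite cancel_of_to.
  - intros j i Hj. unfold forb. cbn [add_forbidden]. rewrite cancel_of_to. cbn [fst snd].
    destruct (Nat.eqb_spec (S j) (S (p 1))); auto. unfold fcnt in Hj; lia.
  - intros i. unfold forb. cbn [add_forbidden]. rewrite cancel_of_to. cbn [fst snd].
    unfold fcnt. now rewrite Nat.eqb_refl.
Qed.

Lemma add_forbidden_forbidden p y i s :
  forbidden (add_forbidden p y) i s <-> forbidden p i s \/ y i = s.
Proof.
  destruct (add_forbidden_spec p y) as [_ [H1 [_ [H2 H3]]]]. unfold forbidden. rewrite H1. split.
  - intros [j [Hj E]]. destruct (Nat.eq_dec j (fcnt p)) as [->|].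
    + right. now rewrite <- H3.
    + left. exists j; split; [lia|]. rewrite <- H2; auto; lia.
  - intros [[j [Hj E]]|E].
    + exists j; split; [lia|]. rewrite H2; auto.
    + exists (fcnt p); split; [lia|]. now rewrite H3.
Qed.

(** * Coding a real by a branch *)

(** Turn number [l] records whether the pair with code [l] belongs to the graph of [c], so [c] can
    be recovered from the branch. *)
Fixpoint graph_branch (c : nat -> nat) (l : nat) : nat :=
  match l with
  | 0 => 1
  | S l => if c (fst (of_nat l)) =? snd (of_nat l)
           then S (2 * graph_branch c l) else 2 * graph_branch c l
  end.

Lemma branch_graph_branch c : branch (graph_branch c).
Proof.
  split; [reflexivity|]. intros l. cbn [graph_branch].
  destruct (c (fst (of_nat l)) =? snd (of_nat l)); auto.
Qed.

Lemma graph_branch_spec c a b :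
  graph_branch c (S (to_nat (a, b))) = S (2 * graph_branch c (to_nat (a, b))) <-> b = c a.
Proof.
  cbn [graph_branch]. rewrite cancel_of_to. cbn [fst snd].
  destruct (Nat.eqb_spec (c a) b); split; intros; auto; try congruence; lia.
Qed.

(** The pair inspected at a turn has first coordinate at most the number of the turn. A Cohen
    condition of length [k] therefore decides the branch up to level [k]. *)
Lemma graph_branch_local c c' l : (forall i, i < l -> c i = c' i) ->
  graph_branch c l = graph_branch c' l.
Proof.
  induction l as [|l IH]; intros H; [reflexivity|]. cbn [graph_branch].
  pose proof (row_le l) as R; unfold row in R.
  rewrite IH, (H (fst (of_nat l))) by (intros; try apply H; lia). reflexivity.
Qed.

(** * Bounded formulas for pairs *)

(** Bounded counterpart of [upair_f], whose quantifier ranges over the whole class; definability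
    below is restricted to Δ0 formulas. *)
Definition upair_d (w a b : nat) : form :=
  fand (fall (fimp (fmem 0 (S w)) (for_ (feq 0 (S a)) (feq 0 (S b))))) (fand (fmem a w) (fmem b w)).
Definition opair_d (x a b : nat) : form :=
  fand (fall (fimp (fmem 0 (S x)) (for_ (upair_d 0 (S a) (S a)) (upair_d 0 (S a) (S b)))))
    (fand (fex (fand (fmem 0 (S x)) (upair_d 0 (S a) (S a))))
          (fex (fand (fmem 0 (S x)) (upair_d 0 (S a) (S b))))).

Lemma opair_d_Delta0 x a b : Delta0 (opair_d x a b).
Proof. unfold opair_d, upair_d; repeat constructor. Qed.

Lemma Delta0_hierarchy p : Delta0 p -> forall n, Sigma n p /\ Pi n p.
Proof.
  intros H; induction n as [|n [IH1 IH2]]; split.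
  - now apply Sigma_0.
  - now apply Pi_0.
  - now apply Sigma_Pi.
  - now apply Pi_Sigma.
Qed.

Definition cons {T : Type} (x : T) (e : nat -> T) (i : nat) : T :=
  match i with 0 => x | S j => e j end.

Definition powM (M : V -> Prop) (a : V) : V := sepV (powV a) M.

Definition reals (M : V -> Prop) : V :=
  sup {f : nat -> nat | M (real f)} (fun s => real (proj1_sig s)).

Lemma mem_reals M x : x ∈ reals M <-> exists f, M (real f) /\ x ≡ real f.
Proof.
  unfold reals; rewrite mem_sup; split.
  - intros [[f Hf] H]; eauto.
  - intros [f [Hf H]]; exists (exist _ f Hf); auto.
Qed.

(** * Closure properties of a model *)

Section Model.
Variables (n : nat) (M : V -> Prop).
Hypothesis Hn : 1 <= n.
Hypothesis HM : model n M.

Let Mcl : is_class M := model_class n M HM.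
Let Mtr : transitive_class M := model_transitive n M HM.

Lemma M_upair x y : M x -> M y -> M (upair x y).
Proof.
  intros Hx Hy. destruct (model_pairing n M HM x Hx y Hy) as [p [Hp K]].
  apply (upair_in_iff M Mcl Mtr) in K; auto. exact (Mcl _ _ K Hp).
Qed.

Lemma M_opair x y : M x -> M y -> M (opair x y).
Proof. unfold opair; auto using M_upair. Qed.

Lemma M_opair_inv x y : M (opair x y) -> M x /\ M y.
Proof. apply N_opair_inv; auto. Qed.

Lemma M_binary_union x y : M x -> M y ->
  exists u, M u /\ forall z, z ∈ u <-> z ∈ x \/ z ∈ y.
Proof.
  intros Hx Hy. destruct (model_union n M HM (upair x y)) as [u [Hu K]]; [now apply M_upair|].
  exists u; split; auto. intros z; split.
  - intros Hz. assert (Mz := Mtr _ _ Hu Hz). apply K in Hz as [w [_ [Hw Hz]]]; auto.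
    apply mem_upair in Hw as [Hw|Hw]; rewrite Hw in Hz; auto.
  - intros [Hz|Hz]; (apply K; [first [exact (Mtr _ _ Hx Hz)|exact (Mtr _ _ Hy Hz)]|]).
    + exists x; repeat split; auto. apply mem_upair; left; reflexivity.
    + exists y; repeat split; auto. apply mem_upair; right; reflexivity.
Qed.

Lemma M_adjoin x y : M x -> M y -> M (adjoin x y).
Proof.
  intros Hx Hy. destruct (M_binary_union x (upair y y)) as [u [Hu K]]; auto using M_upair.
  apply (Mcl u); auto. apply eqV_ext; intros z. rewrite K, mem_adjoin, mem_upair. tauto.
Qed.

Lemma mem_powM a z : z ∈ powM M a <-> subset z a /\ M z.
Proof. unfold powM. rewrite mem_sepV by (intros; eapply Mcl; eauto). now rewrite mem_powV. Qed.

Lemma M_powM a : M a -> M (powM M a).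
Proof.
  intros Ha. destruct (model_powerset n M HM a Ha) as [b [Hb K]].
  apply (Mcl b); auto. apply eqV_ext; intros z. rewrite mem_powM; split.
  - intros Hz. assert (Mz : M z) by exact (Mtr _ _ Hb Hz).
    split; auto. apply K in Hz; auto. intros u Hu. apply Hz; auto. exact (Mtr _ _ Mz Hu).
  - intros [H1 H2]. apply K; auto. intros u _; apply H1.
Qed.

Lemma M_separation_raw p e a : Delta0 p -> (forall i, M (e i)) -> M a ->
  exists b, M b /\ forall x, x ∈ b <-> x ∈ a /\ sat M (scons x e) p.
Proof.
  intros Hp He Ha.
  destruct (model_separation n M HM p (proj1 (Delta0_hierarchy p Hp n)) e He a Ha) as [b [Hb K]].
  exists b; split; auto. intros x; split.
  - intros Hx; apply K; auto. exact (Mtr _ _ Hb Hx).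
  - intros Hx; apply K; auto. exact (Mtr _ _ Ha (proj1 Hx)).
Qed.

Lemma M_empty : M empty.
Proof.
  destruct (model_infinity n M HM) as [w [Hw K]].
  apply (inductive_in_iff M Mcl Mtr) in K as [K _]; auto. exact (Mtr _ _ Hw K).
Qed.

Lemma M_numeral k : M (numeral k).
Proof. induction k; cbn [numeral]; auto using M_empty, M_adjoin. Qed.

(** [Infinity] gives just some inductive set, whereas [DependentChoice] asserts a least one inside
    [M]. Any instance will do; here it is the trivial relation on the singleton of [empty]. *)
Lemma M_omega : M omegaV.
Proof.
  set (a := upair empty empty).
  assert (Ha : M a) by (apply M_upair; apply M_empty).
  set (r := upair (opair empty empty) (opair empty empty)).
  assert (Hr : M r) by (apply M_upair; apply M_opair; apply M_empty).
  destruct (model_dc n M HM a Ha r Hr) as [w [Hw [f [_ [[Hi Hmin] _]]]]].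
  - exists empty; split; [apply M_empty|]. apply mem_upair; left; reflexivity.
  - intros x Mx Hx. assert (E : x ≡ empty) by (apply mem_upair in Hx; tauto).
    exists empty; split; [apply M_empty|]. split; [apply mem_upair; left; reflexivity|].
    apply (related_in_iff M Mcl Mtr M_upair); auto using M_empty.
    apply mem_upair; left. now rewrite E.
  - pose proof Hi as Hi'. apply (inductive_in_iff M Mcl Mtr) in Hi' as [H0 HS]; auto.
    apply (Mcl w); auto. apply eqV_ext; intros z. split.
    2:{ intros [k Hk]; rewrite Hk; clear Hk; induction k; cbn [numeral]; auto. }
    (* An ∈-minimal element of [w] that is not a numeral could be removed from the least
       inductive set [w]. *)
    intros Hz. apply NNPP; intros C.
    assert (D : exists x, x ∈ w /\ ~ x ∈ omegaV /\ forall y, y ∈ x -> y ∈ w -> y ∈ omegaV).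
    { revert Hz C. induction z as [z IH] using mem_ind; intros Hz C.
      destruct (classic (exists y, y ∈ z /\ y ∈ w /\ ~ y ∈ omegaV)) as [[y [H1 [H2 H3]]]|H].
      - exact (IH y H1 H2 H3).
      - exists z; repeat split; auto. intros y H1 H2. apply NNPP; intros H3; apply H; eauto. }
    destruct D as [x [Hx [Cx Hmx]]].
    destruct (M_separation_raw (fneg (feq 0 1)) (fun _ => x) w) as [u [Hu Ku]];
      [repeat constructor|intros; exact (Mtr _ _ Hw Hx)|exact Hw|]. simpl in Ku.
    assert (U : subset_in M w u).
    { apply Hmin; auto. apply (inductive_in_iff M Mcl Mtr); auto. split.
      - apply Ku; split; auto. intros E; apply Cx. rewrite <- E. exists 0; reflexivity.
      - intros y Hy; apply Ku in Hy as [Hy1 Hy2]. apply Ku; split; auto.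
        intros E. apply Cx. assert (Hyo : y ∈ omegaV).
        { apply Hmx; auto. rewrite <- E. apply mem_adjoin; right; reflexivity. }
        destruct Hyo as [k Hk]. exists (S k). cbn [numeral]. now rewrite <- E, Hk. }
    assert (Hxu : x ∈ u) by (apply U; auto; exact (Mtr _ _ Hw Hx)).
    apply Ku in Hxu as [_ Hxu]. apply Hxu; reflexivity.
Qed.

Lemma sat_opair_d e x a b : M (e x) ->
  sat M e (opair_d x a b) <-> e x ≡ opair (e a) (e b).
Proof.
  intros Hx. simpl.
  assert (U : forall w a b, M w ->
    ((∀[M] z, z ∈ w -> z ≡ a \/ z ≡ b) /\ a ∈ w /\ b ∈ w) <-> w ≡ upair a b).
  { intros w c d Hw; split.
    - intros [H1 [H2 H3]]. apply eqV_ext; intros z; rewrite mem_upair; split.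
      + intros Hz; apply H1; auto. exact (Mtr _ _ Hw Hz).
      + intros [H|H]; now rewrite H.
    - intros H; split; [|rewrite H, !mem_upair; split; [left|right]; reflexivity].
      intros z _. now rewrite H, mem_upair. }
  split.
  - intros [H1 [[u [Hu [H2 H3]]] [u' [Hu' [H4 H5]]]]].
    apply U in H3; auto. apply U in H5; auto. apply eqV_ext; intros z; unfold opair; rewrite mem_upair.
    split.
    + intros Hz. assert (Mz : M z) by exact (Mtr _ _ Hx Hz).
      destruct (H1 z Mz Hz) as [K|K]; apply U in K; auto.
    + intros [K|K]; rewrite K; [now rewrite <- H3|now rewrite <- H5].
  - intros H. assert (P1 : upair (e a) (e a) ∈ e x) by (rewrite H; apply mem_upair; left; reflexivity).
    assert (P2 : upair (e a) (e b) ∈ e x) by (rewrite H; apply mem_upair; right; reflexivity).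
    split; [|split].
    + intros z Mz Hz. rewrite H in Hz. apply mem_upair in Hz as [K|K]; [left|right]; apply U; auto.
    + exists (upair (e a) (e a)). assert (Q := Mtr _ _ Hx P1). split; auto. split; auto.
      apply U; auto; reflexivity.
    + exists (upair (e a) (e b)). assert (Q := Mtr _ _ Hx P2). split; auto. split; auto.
      apply U; auto; reflexivity.
Qed.

(** A first real of [M], built directly by replacement: the definability calculus only speaks about
    environments whose reals lie in [M], so it needs one to start from. *)
Lemma M_real_zero : M (real (fun _ => 0)).
Proof.
  destruct (model_replacement n M HM (opair_d 0 1 2)
    (proj1 (Delta0_hierarchy _ (opair_d_Delta0 _ _ _) n)) (fun _ => empty)
    (fun _ => M_empty) omegaV M_omega) as [b [Hb K]].
  - intros x Mx _. exists (opair x empty). assert (Mp : M (opair x empty)) by auto using M_opair, M_empty.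
    split; auto. split; [apply sat_opair_d; auto; reflexivity|].
    intros y' My' H. apply sat_opair_d in H; auto.
  - apply (Mcl b); auto. apply eqV_ext; intros z. split.
    + intros Hz. assert (Mz := Mtr _ _ Hb Hz). apply K in Hz as [x [Mx [[k Hk] H]]]; auto.
      apply sat_opair_d in H; auto. simpl in H.
      exists k. now rewrite H, Hk.
    + intros [k Hk]. assert (Mz : M z).
      { eapply Mcl; [symmetry; exact Hk|]. apply M_opair; apply M_numeral. }
      apply K; auto. exists (numeral k); split; [apply M_numeral|].
      split; [exists k; reflexivity|]. apply sat_opair_d; auto.
Qed.

(** ** Definability by Δ0 formulas with parameters *)

(** A predicate in three kinds of variables: natural numbers, reals and sets. *)
Definition predicate : Type := (nat -> nat) -> (nat -> nat -> nat) -> (nat -> V) -> Prop.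

Inductive slot : Type :=
| SNum (i : nat) | SReal (i : nat) | SSet (i : nat) | SPar (x : V).

Definition slot_ok (l : slot) : Prop := match l with SPar x => M x | _ => True end.

Definition sval (v : nat -> nat) (r : nat -> nat -> nat) (s : nat -> V) (l : slot) : V :=
  match l with
  | SNum i => numeral (v i)
  | SReal i => real (r i)
  | SSet i => s i
  | SPar x => x
  end.

(** The map [w] says what each variable of the formula denotes, so parameters from [M] and variables
    of the three kinds may be mixed in any order. *)
Definition definable (P : predicate) : Prop :=
  exists p w, Delta0 p /\ (forall j, slot_ok (w j)) /\
  forall v r s, (forall i, M (real (r i))) -> (forall i, M (s i)) ->
    P v r s <-> sat M (fun j => sval v r s (w j)) p.

Definition setterm (T : (nat -> nat) -> (nat -> nat -> nat) -> (nat -> V) -> V) : Prop :=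
  exists l, slot_ok l /\ forall v r s, T v r s = sval v r s l.

Lemma sval_M v r s l : slot_ok l -> (forall i, M (real (r i))) -> (forall i, M (s i)) ->
  M (sval v r s l).
Proof. destruct l; simpl; auto using M_numeral. Qed.

Lemma definable_ext (P Q : predicate) :
  (forall v r s, (forall i, M (real (r i))) -> (forall i, M (s i)) -> P v r s <-> Q v r s) ->
  definable P -> definable Q.
Proof.
  intros H [p [w [H1 [H2 H3]]]]. exists p, w. split; auto. split; auto.
  intros v r s Hr Hs. rewrite <- H by auto. now apply H3.
Qed.

Lemma definable_rename (P : predicate) f g h : definable P ->
  definable (fun v r s => P (fun i => v (f i)) (fun i => r (g i)) (fun i => s (h i))).
Proof.
  intros [p [w [H1 [H2 H3]]]].
  exists p, (fun j => match w j with SNum i => SNum (f i) | SReal i => SReal (g i)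
                             | SSet i => SSet (h i) | SPar x => SPar x end).
  split; auto. split.
  - intros j; specialize (H2 j); destruct (w j); auto.
  - intros v r s Hr Hs. rewrite H3 by auto. apply sat_ext.
    intros j; destruct (w j); reflexivity.
Qed.

Lemma setterm_num i : setterm (fun v r s => numeral (v i)).
Proof. exists (SNum i); split; simpl; auto. Qed.
Lemma setterm_real i : setterm (fun v r s => real (r i)).
Proof. exists (SReal i); split; simpl; auto. Qed.
Lemma setterm_set i : setterm (fun v r s => s i).
Proof. exists (SSet i); split; simpl; auto. Qed.
Lemma setterm_par x : M x -> setterm (fun v r s => x).
Proof. exists (SPar x); split; simpl; auto. Qed.

Definition slot3 (a b c : slot) (j : nat) : slot := match j with 0 => a | 1 => b | _ => c end.

Lemma definable_mem T T' : setterm T -> setterm T' ->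
  definable (fun v r s => T v r s ∈ T' v r s).
Proof.
  intros [l [Hl H]] [l' [Hl' H']]. exists (fmem 0 1), (slot3 l l' l'). split; [constructor|].
  split; [intros [|[|]]; auto|]. intros; simpl. now rewrite H, H'.
Qed.

Lemma definable_eqV T T' : setterm T -> setterm T' ->
  definable (fun v r s => T v r s ≡ T' v r s).
Proof.
  intros [l [Hl H]] [l' [Hl' H']]. exists (feq 0 1), (slot3 l l' l'). split; [constructor|].
  split; [intros [|[|]]; auto|]. intros; simpl. now rewrite H, H'.
Qed.

Lemma definable_opair T T' T'' : setterm T -> setterm T' -> setterm T'' ->
  definable (fun v r s => T v r s ≡ opair (T' v r s) (T'' v r s)).
Proof.
  intros [l [Hl H]] [l' [Hl' H']] [l'' [Hl'' H'']].
  exists (opair_d 0 1 2), (slot3 l l' l''). split; [apply opair_d_Delta0|].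
  split; [intros [|[|]]; auto|]. intros. rewrite sat_opair_d by (apply sval_M; auto).
  simpl. now rewrite H, H', H''.
Qed.

Lemma definable_not P : definable P -> definable (fun v r s => ~ P v r s).
Proof.
  intros [p [w [H1 [H2 H3]]]]. exists (fneg p), w. split; [now constructor|]. split; auto.
  intros; simpl. now rewrite H3.
Qed.

(** Even and odd variables keep the slots of two formulas apart, so that formulas combine without
    comparing their parameters. *)
Definition merge (w1 w2 : nat -> slot) (j : nat) : slot :=
  if Nat.even j then w1 (Nat.div2 j) else w2 (Nat.div2 j).

Lemma merge_even w1 w2 i : merge w1 w2 (2 * i) = w1 i.
Proof. unfold merge. now rewrite Nat.even_even, Nat.div2_double. Qed.
Lemma merge_odd w1 w2 i : merge w1 w2 (S (2 * i)) = w2 i.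
Proof.
  unfold merge. rewrite Nat.div2_succ_double.
  replace (Nat.even (S (2 * i))) with false; auto. now rewrite <- Nat.add_1_r, Nat.even_odd.
Qed.

Lemma definable_binary op (c : Prop -> Prop -> Prop) P Q :
  (forall p q, Delta0 p -> Delta0 q -> Delta0 (op p q)) ->
  (forall e p q, sat M e (op p q) <-> c (sat M e p) (sat M e q)) ->
  (forall A A' B B', (A <-> A') -> (B <-> B') -> c A B <-> c A' B') ->
  definable P -> definable Q -> definable (fun v r s => c (P v r s) (Q v r s)).
Proof.
  intros Hop Hs Hc [p [w [H1 [H2 H3]]]] [q [w' [H1' [H2' H3']]]].
  exists (op (ren (fun i => 2 * i) p) (ren (fun i => S (2 * i)) q)), (merge w w').
  split; [apply Hop; now apply Delta0_ren|]. split.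
  - intros j; unfold merge; destruct (Nat.even j); auto.
  - intros v r s Hr Hs'. rewrite Hs. apply Hc; [rewrite H3 by auto|rewrite H3' by auto];
      symmetry; apply sat_ren; intros i; [rewrite merge_even|rewrite merge_odd]; reflexivity.
Qed.

Lemma definable_and P Q : definable P -> definable Q -> definable (fun v r s => P v r s /\ Q v r s).
Proof.
  apply (definable_binary fand and); [now constructor|reflexivity|tauto].
Qed.
Lemma definable_or P Q : definable P -> definable Q -> definable (fun v r s => P v r s \/ Q v r s).
Proof. apply (definable_binary for_ or); [now constructor|reflexivity|tauto]. Qed.
Lemma definable_imp P Q : definable P -> definable Q -> definable (fun v r s => P v r s -> Q v r s).
Proof.
  apply (definable_binary fimp (fun A B => A -> B)); [now constructor|reflexivity|tauto].
Qed.
Lemma definable_iff P Q : definable P -> definable Q -> definable (fun v r s => P v r s <-> Q v r s).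
Proof. intros; unfold iff; auto using definable_and, definable_imp. Qed.

(** The three kinds of quantifiers are all bounded: by [omegaV], by [reals M], by a term. *)
Lemma definable_ex_generic (R P : predicate) (l : slot) (f : slot -> slot) (z : slot -> bool) :
  slot_ok l -> definable R ->
  (forall k, slot_ok k -> slot_ok (f k)) ->
  (forall v r s, (forall i, M (real (r i))) -> (forall i, M (s i)) ->
    exists D : V -> (nat -> nat) -> (nat -> nat -> nat) -> (nat -> V) -> Prop,
      (P v r s <-> exists x v' r' s', D x v' r' s' /\ R v' r' s') /\
      (forall x v' r' s', D x v' r' s' ->
         (forall i, M (real (r' i))) /\ (forall i, M (s' i)) /\ x ∈ sval v r s l /\
         forall k, sval v' r' s' k ≡ if z k then x else sval v r s (f k)) /\
      (forall x, x ∈ sval v r s l -> exists v' r' s', D x v' r' s')) ->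
  definable P.
Proof.
  intros Hl [p [w [H1 [H2 H3]]]] Hf HD.
  (* Variable [0] is the witness, [1] its bound, and [S (S j)] stands for the former variable
     [j]. *)
  set (g := fun j => if z (w j) then 0 else S (S j)).
  exists (fex (fand (fmem 0 1) (ren g p))),
    (fun j => match j with 0 => l | S j => f (w j) end).
  split; [constructor; now apply Delta0_ren|]. split; [intros [|j]; auto|].
  intros v r s Hr Hs. destruct (HD v r s Hr Hs) as [D [HP [HD1 HD2]]]. rewrite HP. simpl.
  assert (E : forall x v' r' s', D x v' r' s' -> R v' r' s' <->
    sat M (scons x (fun j => sval v r s match j with 0 => l | S j => f (w j) end)) (ren g p)).
  { intros x v' r' s' HDx. destruct (HD1 _ _ _ _ HDx) as [K1 [K2 [K3 K4]]].
    rewrite H3 by auto. symmetry. apply sat_ren. intros j; unfold g.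
    rewrite K4. destruct (z (w j)); reflexivity. }
  split.
  - intros [x [v' [r' [s' [HDx HR]]]]]. destruct (HD1 _ _ _ _ HDx) as [K1 [K2 [K3 K4]]].
    exists x; split; [exact (Mtr _ _ (sval_M v r s l Hl Hr Hs) K3)|]. split; auto.
    now apply (E _ _ _ _ HDx).
  - intros [x [Mx [Hx K]]]. destruct (HD2 x Hx) as [v' [r' [s' HDx]]].
    exists x, v', r', s'; split; auto. now apply (E _ _ _ _ HDx).
Qed.

(** The boolean function marks the slot of the quantified variable, which is redirected to the
    witness; [SPar empty] is a placeholder there. *)
Lemma definable_ex_in T (R : V -> predicate) : setterm T ->
  definable (fun v r s => R (s 0) v r (fun i => s (S i))) ->
  definable (fun v r s => exists x, x ∈ T v r s /\ R x v r s).
Proof.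
  intros [l [Hl HT]] HR.
  apply (definable_ex_generic _ _ l
    (fun k => match k with SSet 0 => SPar empty | SSet (S i) => SSet i | k => k end)
    (fun k => match k with SSet 0 => true | _ => false end) Hl HR).
  - intros [i|i|[|i]|x]; simpl; auto using M_empty.
  - intros v r s Hr Hs.
    exists (fun x v' r' s' => x ∈ T v r s /\ v' = v /\ r' = r /\ s' = cons x s). split; [|split].
    + split.
      * intros [x [H1 H2]]; exists x, v, r, (cons x s); auto.
      * intros [x [v' [r' [s' [[H1 [-> [-> ->]]] H2]]]]]; exists x; auto.
    + intros x v' r' s' [H1 [-> [-> ->]]]. rewrite HT in H1.
      split; auto. split; [|split; auto].
      * intros [|i]; simpl; auto. exact (Mtr _ _ (sval_M v r s l Hl Hr Hs) H1).
      * intros [i|i|[|i]|y]; simpl; reflexivity.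
    + intros x Hx. exists v, r, (cons x s). now rewrite HT.
Qed.

Lemma definable_ex_nat (R : nat -> predicate) :
  definable (fun v r s => R (v 0) (fun i => v (S i)) r s) ->
  definable (fun v r s => exists k, R k v r s).
Proof.
  intros HR.
  apply (definable_ex_generic _ _ (SPar omegaV)
    (fun k => match k with SNum 0 => SPar empty | SNum (S i) => SNum i | k => k end)
    (fun k => match k with SNum 0 => true | _ => false end) M_omega HR).
  - intros [[|i]|i|i|x]; simpl; auto using M_empty.
  - intros v r s Hr Hs.
    exists (fun x v' r' s' => exists k, x ≡ numeral k /\ v' = cons k v /\ r' = r /\ s' = s). split; [|split].
    + split.
      * intros [k H]; exists (numeral k), (cons k v), r, s; split; auto. exists k; split; auto; reflexivity.
      * intros [x [v' [r' [s' [[k [H1 [-> [-> ->]]]] H2]]]]]; exists k; auto.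
    + intros x v' r' s' [k [H1 [-> [-> ->]]]].
      split; auto. split; auto. split; [exists k; auto|].
      intros [[|i]|i|i|y]; simpl; try reflexivity. now symmetry.
    + intros x [k Hk]. exists (cons k v), r, s, k; auto.
Qed.

Lemma definable_all_nat (R : nat -> predicate) :
  definable (fun v r s => R (v 0) (fun i => v (S i)) r s) ->
  definable (fun v r s => forall k, R k v r s).
Proof.
  intros H. apply (definable_ext (fun v r s => ~ exists k, ~ R k v r s)).
  - intros v r s _ _; split.
    + intros K k; apply NNPP; intros C; eauto.
    + intros K [k C]; auto.
  - apply definable_not, definable_ex_nat. now apply definable_not.
Qed.

Lemma definable_all_in T (R : V -> predicate) : setterm T ->
  definable (fun v r s => R (s 0) v r (fun i => s (S i))) ->
  definable (fun v r s => forall x, x ∈ T v r s -> R x v r s).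
Proof.
  intros HT H. apply (definable_ext (fun v r s => ~ exists x, x ∈ T v r s /\ ~ R x v r s)).
  - intros v r s _ _; split.
    + intros K x Hx; apply NNPP; intros C; eauto.
    + intros K [x [C1 C2]]; auto.
  - apply definable_not, definable_ex_in; auto. now apply definable_not.
Qed.

Lemma definable_separation P a : definable (fun v r s => P (s 0)) -> M a ->
  exists b, M b /\ forall x, x ∈ b <-> x ∈ a /\ P x.
Proof.
  intros [p [w [H1 [H2 H3]]]] Ha.
  set (v0 := fun _ : nat => 0). set (r0 := fun _ _ : nat => 0). set (s0 := fun _ : nat => empty).
  assert (Hr : forall i, M (real (r0 i))) by (intros; apply M_real_zero).
  assert (Hs : forall i, M (s0 i)) by (intros; apply M_empty).
  destruct (M_separation_raw
    (ren (fun j => match w j with SSet 0 => 0 | _ => S j end) p)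
    (fun j => sval v0 r0 s0 (w j)) a) as [b [Hb K]]; auto using Delta0_ren, sval_M.
  exists b; split; auto. intros x. rewrite K. split; intros [Hx Hp]; split; auto.
  - apply (H3 v0 r0 (cons x s0)); auto.
    { intros [|i]; simpl; auto. exact (Mtr _ _ Ha Hx). }
    revert Hp. apply sat_ren. intros j. destruct (w j) as [i|i|[|i]|y] eqn:E; simpl; rewrite ?E; reflexivity.
  - apply (H3 v0 r0 (cons x s0)) in Hp; auto.
    2:{ intros [|i]; simpl; auto. exact (Mtr _ _ Ha Hx). }
    revert Hp. apply sat_ren. intros j. destruct (w j) as [i|i|[|i]|y] eqn:E; simpl; rewrite ?E; reflexivity.
Qed.

(** * Definable numerical terms and quantifiers over reals *)

Definition natterm (t : (nat -> nat) -> (nat -> nat -> nat) -> (nat -> V) -> nat) : Prop :=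
  definable (fun v r s => v 0 = t (fun i => v (S i)) r s).

Lemma definable_eq_var i j : definable (fun v r s => v i = v j).
Proof.
  apply (definable_ext (fun v r s => numeral (v i) ≡ numeral (v j))).
  - intros; apply numeral_inj.
  - apply definable_eqV; apply setterm_num.
Qed.

Lemma definable_lt_var i j : definable (fun v r s => v i < v j).
Proof.
  apply (definable_ext (fun v r s => numeral (v i) ∈ numeral (v j))).
  - intros; apply numeral_mem.
  - apply definable_mem; apply setterm_num.
Qed.

(** Terms are handled through their graphs: substitution quantifies over the value of [t]. *)
Lemma definable_subst t (R : nat -> predicate) : natterm t ->
  definable (fun v r s => R (v 0) (fun i => v (S i)) r s) ->
  definable (fun v r s => R (t v r s) v r s).
Proof.
  intros Ht HR. apply (definable_ext (fun v r s => exists k, k = t v r s /\ R k v r s)).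
  - intros v r s _ _; split; [intros [k [-> H]]; auto|eauto].
  - apply definable_ex_nat. now apply definable_and.
Qed.

Lemma natterm_shift t : natterm t -> natterm (fun v r s => t (fun i => v (S i)) r s).
Proof.
  intros H. exact (definable_rename _ (fun i => match i with 0 => 0 | S j => S (S j) end)
    (fun i => i) (fun i => i) H).
Qed.

Lemma natterm_var i : natterm (fun v r s => v i).
Proof. apply definable_eq_var. Qed.

Lemma definable_rel1 (R : nat -> Prop) t : definable (fun v r s => R (v 0)) ->
  natterm t -> definable (fun v r s => R (t v r s)).
Proof. intros HR Ht. exact (definable_subst t (fun k _ _ _ => R k) Ht HR). Qed.

Lemma definable_rel2 (R : nat -> nat -> Prop) t t' :
  definable (fun v r s => R (v 0) (v 1)) ->
  natterm t -> natterm t' -> definable (fun v r s => R (t v r s) (t' v r s)).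
Proof.
  intros HR Ht Ht'. apply (definable_subst t (fun k v r s => R k (t' v r s))); auto.
  apply (definable_subst (fun v r s => t' (fun i => v (S i)) r s)
    (fun k v r s => R (v 0) k)); [now apply natterm_shift|].
  exact (definable_rename _ (fun i => match i with 0 => 1 | _ => 0 end) (fun i => i) (fun i => i) HR).
Qed.

Lemma definable_rel3 (R : nat -> nat -> nat -> Prop) t t' t'' :
  definable (fun v r s => R (v 0) (v 1) (v 2)) ->
  natterm t -> natterm t' -> natterm t'' ->
  definable (fun v r s => R (t v r s) (t' v r s) (t'' v r s)).
Proof.
  intros HR Ht Ht' Ht''.
  apply (definable_subst t (fun k v r s => R k (t' v r s) (t'' v r s))); auto.
  apply (definable_subst (fun v r s => t' (fun i => v (S i)) r s)
    (fun k v r s => R (v 0) k (t'' (fun i => v (S i)) r s))); [now apply natterm_shift|].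
  apply (definable_subst (fun v r s => t'' (fun i => v (S (S i))) r s)
    (fun k v r s => R (v 1) (v 0) k)); [exact (natterm_shift _ (natterm_shift _ Ht''))|].
  exact (definable_rename _ (fun i => match i with 0 => 2 | 1 => 1 | _ => 0 end)
    (fun i => i) (fun i => i) HR).
Qed.

Lemma definable_eq t t' : natterm t -> natterm t' -> definable (fun v r s => t v r s = t' v r s).
Proof. apply definable_rel2, definable_eq_var. Qed.

Lemma definable_lt t t' : natterm t -> natterm t' -> definable (fun v r s => t v r s < t' v r s).
Proof. apply (definable_rel2 lt), definable_lt_var. Qed.

Lemma definable_le t t' : natterm t -> natterm t' -> definable (fun v r s => t v r s <= t' v r s).
Proof.
  intros H H'. apply (definable_ext (fun v r s => ~ t' v r s < t v r s)); [intros; lia|].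
  now apply definable_not, definable_lt.
Qed.

Lemma natterm_fun1 (f : nat -> nat) t : definable (fun v r s => v 0 = f (v 1)) ->
  natterm t -> natterm (fun v r s => f (t v r s)).
Proof.
  intros Hf Ht. unfold natterm.
  apply (definable_rel2 (fun a b => a = f b) _ _ Hf); [apply natterm_var|now apply natterm_shift].
Qed.

Lemma natterm_fun2 (f : nat -> nat -> nat) t t' : definable (fun v r s => v 0 = f (v 1) (v 2)) ->
  natterm t -> natterm t' -> natterm (fun v r s => f (t v r s) (t' v r s)).
Proof.
  intros Hf Ht Ht'. unfold natterm.
  apply (definable_rel3 (fun a b c => a = f b c) _ _ _ Hf);
    [apply natterm_var|now apply natterm_shift..].
Qed.

Lemma natterm_const c : natterm (fun v r s => c).
Proof.
  apply (definable_ext (fun v r s => numeral (v 0) ≡ numeral c)); [intros; apply numeral_inj|].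
  apply definable_eqV; [apply setterm_num|apply setterm_par, M_numeral].
Qed.

(** Numerals directly offer only order and equality, so the successor is described as the least
    larger number. *)
Lemma natterm_S t : natterm t -> natterm (fun v r s => S (t v r s)).
Proof.
  apply natterm_fun1.
  apply (definable_ext (fun v r s => v 1 < v 0 /\ forall c, c < v 0 -> c < v 1 \/ c = v 1)).
  - intros v r s _ _; split; [|intros ->; split; [lia|intros; lia]].
    intros [H1 H2]. specialize (H2 (pred (v 0))). lia.
  - apply definable_and; [apply definable_lt_var|]. apply definable_all_nat.
    apply definable_imp; [apply definable_lt_var|].
    apply definable_or; [apply definable_lt_var|apply definable_eq_var].
Qed.

Lemma definable_app_real (T : (nat -> nat) -> (nat -> nat -> nat) -> (nat -> V) -> nat -> nat) :
  setterm (fun v r s => real (T v r s)) -> definable (fun v r s => v 0 = T v r s (v 1)).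
Proof.
  intros HT.
  apply (definable_ext (fun v r s => exists z, z ∈ real (T v r s) /\ z ≡ opair (numeral (v 1)) (numeral (v 0)))).
  - intros v r s _ _; split.
    + intros [z [H1 H2]]. rewrite H2 in H1. symmetry; now apply opair_mem_real.
    + intros H. eexists; split; [|reflexivity]. now apply opair_mem_real.
  - apply definable_ex_in; auto. apply definable_opair; [apply setterm_set|apply setterm_num..].
Qed.

Lemma natterm_app (f : nat -> nat) t : M (real f) -> natterm t -> natterm (fun v r s => f (t v r s)).
Proof.
  intros Hf. apply natterm_fun1. apply (definable_app_real (fun _ _ _ => f)). now apply setterm_par.
Qed.

Lemma natterm_app_var i t : natterm t -> natterm (fun v r s => r i (t v r s)).
Proof.
  intros Ht. unfold natterm.
  apply (definable_subst (fun v r s => t (fun j => v (S j)) r s)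
    (fun k v r s => v 0 = r i k)); [now apply natterm_shift|].
  pose proof (definable_app_real (fun _ r _ => r i) (setterm_real i)) as H.
  exact (definable_rename _ (fun i => match i with 0 => 1 | _ => 0 end) (fun i => i) (fun i => i) H).
Qed.

Lemma M_subset_omega2 z : (exists a b : nat, z ≡ opair (numeral a) (numeral b)) ->
  z ∈ powM M (powM M omegaV).
Proof.
  intros [a [b H]]. rewrite H.
  assert (P : forall a b, upair (numeral a) (numeral b) ∈ powM M omegaV).
  { intros c d. apply mem_powM; split; [|apply M_upair; apply M_numeral].
    intros u Hu. apply mem_upair in Hu as [Hu|Hu]; rewrite Hu; eexists; reflexivity. }
  apply mem_powM; split; [|apply M_opair; apply M_numeral].
  intros u Hu. unfold opair in Hu. apply mem_upair in Hu as [Hu|Hu]; rewrite Hu; apply P.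
Qed.

(** Makes a quantifier over all reals of [M] a bounded one with a parameter, so that statements
    about all branches of the model remain Δ0. *)
Lemma M_reals : M (reals M).
Proof.
  destruct (definable_separation (fun x =>
    (forall p, p ∈ x -> exists a b : nat, p ≡ opair (numeral a) (numeral b)) /\
    forall a : nat, exists b : nat, (exists p, p ∈ x /\ p ≡ opair (numeral a) (numeral b)) /\
      forall b' : nat, (exists p, p ∈ x /\ p ≡ opair (numeral a) (numeral b')) -> b' = b)
    (powM M (powM M (powM M omegaV)))) as [R [HR K]].
  - apply definable_and.
    + apply definable_all_in; [apply setterm_set|]. do 2 apply definable_ex_nat.
      apply definable_opair; [apply setterm_set|apply setterm_num..].
    + apply definable_all_nat, definable_ex_nat, definable_and.
      * apply definable_ex_in; [apply setterm_set|].
        apply definable_opair; [apply setterm_set|apply setterm_num..].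
      * apply definable_all_nat, definable_imp; [|apply definable_eq_var].
        apply definable_ex_in; [apply setterm_set|].
        apply definable_opair; [apply setterm_set|apply setterm_num..].
  - do 3 apply M_powM; apply M_omega.
  - apply (Mcl R); auto. apply eqV_ext; intros x. rewrite K, mem_reals, mem_powM. split.
    + intros [[_ Mx] [H1 H2]].
      assert (F : exists f : nat -> nat, forall a,
        (exists p, p ∈ x /\ p ≡ opair (numeral a) (numeral (f a))) /\
        forall b' : nat, (exists p, p ∈ x /\ p ≡ opair (numeral a) (numeral b')) -> b' = f a)
        by exact (choice _ H2).
      destruct F as [f Hf].
      assert (E : x ≡ real f).
      { apply eqV_ext; intros z; split.
        - intros Hz. destruct (H1 z Hz) as [a [b Hab]]. exists a.
          assert (b = f a) by (apply Hf; eauto). now subst.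
        - intros [a Ha]. destruct (Hf a) as [[p [Hp E]] _]. now rewrite Ha, <- E. }
      exists f; split; auto. exact (Mcl _ _ E Mx).
    + intros [f [Hf E]]. split; [split|].
      * intros z Hz. rewrite E in Hz. apply M_subset_omega2. destruct Hz as [a Ha]; eauto.
      * eapply Mcl; [symmetry; exact E|auto].
      * split.
        { intros p Hp. rewrite E in Hp. destruct Hp as [a Ha]; eauto. }
        intros a; exists (f a); split.
        { eexists; split; [|reflexivity]. rewrite E. now apply opair_mem_real. }
        intros b' [p [Hp Ep]]. rewrite E, Ep in Hp. symmetry; now apply opair_mem_real.
Qed.

Lemma definable_ex_real (R : (nat -> nat) -> predicate) :
  definable (fun v r s => R (r 0) v (fun i => r (S i)) s) ->
  definable (fun v r s => exists f, M (real f) /\ R f v r s).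
Proof.
  intros HR.
  apply (definable_ex_generic _ _ (SPar (reals M))
    (fun k => match k with SReal 0 => SPar empty | SReal (S i) => SReal i | k => k end)
    (fun k => match k with SReal 0 => true | _ => false end) M_reals HR).
  - intros [i|[|i]|i|x]; simpl; auto using M_empty.
  - intros v r s Hr Hs.
    exists (fun x v' r' s' => exists f, M (real f) /\ x ≡ real f /\ v' = v /\ r' = cons f r /\ s' = s).
    split; [|split].
    + split.
      * intros [f [Hf H]]; exists (real f), v, (cons f r), s; split; auto.
        exists f; split; [|split]; auto; reflexivity.
      * intros [x [v' [r' [s' [[f [H0 [H1 [-> [-> ->]]]]] H2]]]]]; exists f; auto.
    + intros x v' r' s' [f [H0 [H1 [-> [-> ->]]]]].
      split; [intros [|i]; simpl; auto|]. split; auto. split; [apply mem_reals; eauto|].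
      intros [i|[|i]|i|y]; simpl; try reflexivity. now symmetry.
    + intros x Hx. apply mem_reals in Hx as [f [Hf E]].
      exists v, (cons f r), s, f; auto.
Qed.

Lemma definable_all_real (R : (nat -> nat) -> predicate) :
  definable (fun v r s => R (r 0) v (fun i => r (S i)) s) ->
  definable (fun v r s => forall f, M (real f) -> R f v r s).
Proof.
  intros H. apply (definable_ext (fun v r s => ~ exists f, M (real f) /\ ~ R f v r s)).
  - intros v r s _ _; split.
    + intros K f Hf; apply NNPP; intros C; eauto.
    + intros K [f [C1 C2]]; auto.
  - apply definable_not, definable_ex_real. now apply definable_not.
Qed.

Lemma M_real_of_natterm f : natterm (fun v r s => f (v 0)) -> M (real f).
Proof.
  intros Hf. destruct (definable_separation
    (fun z => exists a b : nat, b = f a /\ z ≡ opair (numeral a) (numeral b))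
    (powM M (powM M omegaV))) as [x [Hx K]].
  - do 2 apply definable_ex_nat. apply definable_and; [exact Hf|].
    apply definable_opair; [apply setterm_set|apply setterm_num..].
  - do 2 apply M_powM; apply M_omega.
  - apply (Mcl x); auto. apply eqV_ext; intros z. rewrite K, mem_real. split.
    + intros [_ [a [b [-> H]]]]; eauto.
    + intros [a H]; split; eauto. apply M_subset_omega2; eauto.
Qed.

Ltac natt :=
  cbn beta; solve [repeat first
    [ assumption | apply natterm_var | apply natterm_const | apply natterm_S
    | apply natterm_app_var | apply natterm_app; [assumption|] ]].

Ltac defn_core nt :=
  cbn beta;
  first
    [ assumption
    | apply definable_not; defn_core nt
    | apply definable_iff; defn_core nt
    | apply definable_and; defn_core nt
    | apply definable_or; defn_core nt
    | apply definable_all_in; [|defn_core nt]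
    | apply definable_all_real; defn_core nt
    | apply definable_all_nat; defn_core nt
    | apply definable_imp; defn_core nt
    | apply definable_ex_in; [|defn_core nt]
    | apply definable_ex_real; defn_core nt
    | apply definable_ex_nat; defn_core nt
    | apply definable_opair
    | apply definable_eqV
    | apply definable_mem
    | apply definable_eq; [nt|nt]
    | apply definable_le; [nt|nt]
    | apply definable_lt; [nt|nt] ];
  try solve [cbn beta; first [apply setterm_set | apply setterm_num | apply setterm_real
    | apply setterm_par; auto using M_omega, M_reals, M_empty, M_numeral]].
Ltac defn := defn_core natt.

(** [R] is any Rocq relation; on [M] it inherits invariance under [≡] from the formula that defines
    it. *)
Lemma definable_invariant (R : nat -> V -> V -> Prop) :
  definable (fun v r s => R (v 0) (s 0) (s 1)) ->
  forall k x x' y y', M x -> M x' -> M y -> M y' -> x ≡ x' -> y ≡ y' -> R k x y -> R k x' y'.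
Proof.
  intros [p [w [_ [_ H]]]] k x x' y y' Mx Mx' My My' Ex Ey K.
  assert (E : forall x y, M x -> M y -> R k x y <->
    sat M (fun j => sval (cons k (fun _ => 0)) (fun _ _ => 0) (cons x (fun _ => y)) (w j)) p).
  { intros z z' Mz Mz'. apply (H (cons k (fun _ => 0)) (fun _ _ => 0) (cons z (fun _ => z'))).
    - intros; apply M_real_zero.
    - intros [|i]; simpl; auto. }
  apply E; auto. apply E in K; auto. revert K; apply sat_ext.
  intros j; destruct (w j) as [i|i|[|i]|u]; simpl; auto; try reflexivity; now symmetry.
Qed.

Lemma definable_formula (P : V -> V -> V -> Prop) : definable (fun v r s => P (s 0) (s 1) (s 2)) ->
  exists p e, Delta0 p /\ (forall i, M (e i)) /\
    forall x y z, M x -> M y -> M z -> P x y z <-> sat M (scons x (scons y (scons z e))) p.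
Proof.
  intros [p [w [H1 [H2 H3]]]].
  exists (ren (fun j => match w j with SSet 0 => 0 | SSet 1 => 1 | SSet _ => 2 | _ => S (S (S j)) end) p),
    (fun j => sval (fun _ => 0) (fun _ _ => 0) (fun _ => empty) (w j)).
  split; [now apply Delta0_ren|]. split.
  { intros i; apply sval_M; auto using M_real_zero, M_empty. }
  intros x y z Mx My Mz.
  rewrite (H3 (fun _ => 0) (fun _ _ => 0) (cons x (cons y (fun _ => z)))).
  - symmetry; apply sat_ren. intros j.
    destruct (w j) as [i|i|[|[|i]]|u] eqn:E; simpl; rewrite ?E; reflexivity.
  - intros; apply M_real_zero.
  - intros [|[|i]]; simpl; auto.
Qed.

(** ** Recursion on ω inside the model *)

(** Values are certified by approximations in [M]: every approximation agrees with [f], and the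
    finite ones [gn] exist, so Σ1 replacement yields the graph. *)
Lemma M_recursion (f : nat -> V) (R : nat -> V -> V -> Prop) :
  (forall k, M (f k)) ->
  definable (fun v r s => R (v 0) (s 0) (s 1)) ->
  (forall k y, M y -> R k (f k) y <-> y ≡ f (S k)) ->
  M (sup nat (fun k => opair (numeral k) (f k))).
Proof.
  intros Mf HR Hstep.
  (* The components [x] and [y] are reached through members of the pairs, which bounds their
     quantifiers and keeps [App] Δ0. *)
  set (App := fun g => forall z, z ∈ g -> z ≡ opair empty (f 0) \/
    exists i j : nat, j = S i /\ exists w, w ∈ g /\ exists u, u ∈ w /\ exists x, x ∈ u /\
      exists u', u' ∈ z /\ exists y, y ∈ u' /\
      w ≡ opair (numeral i) x /\ z ≡ opair (numeral j) y /\ R i x y).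
  assert (DR : forall i j k : nat, definable (fun v r s => R (v i) (s j) (s k))).
  { intros i j k.
    exact (definable_rename _ (fun _ => i) (fun i => i) (fun m => match m with 0 => j | _ => k end) HR). }
  assert (DApp : definable (fun v r s => App (s 0))).
  { unfold App. apply definable_all_in; [apply setterm_set|]. apply definable_or.
    - apply definable_opair; [apply setterm_set|apply setterm_par..]; auto using M_empty.
    - do 2 apply definable_ex_nat. apply definable_and; [defn|].
      do 5 (apply definable_ex_in; [apply setterm_set|]).
      do 2 (apply definable_and; [defn|]). exact (DR 1 2 0). }
  assert (App_inv : forall g, M g -> App g -> forall i x, opair (numeral i) x ∈ g -> x ≡ f i).
  { intros g Mg Hg. induction i as [|i IH]; intros x Hx.
    - destruct (Hg _ Hx) as [H|[i [j [-> [w [_ [u [_ [y [_ [u' [_ [y' [_ [_ [H _]]]]]]]]]]]]]]]];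
        apply opair_inj in H as [H1 H2]; auto.
      change (numeral 0 ≡ numeral (S i)) in H1. apply numeral_inj in H1; discriminate.
    - destruct (Hg _ Hx) as [H|[k [j [-> [w [Hw [u [_ [y [_ [u' [_ [y' [_ [Hwy [H HRy]]]]]]]]]]]]]]]];
        apply opair_inj in H as [H1 H2].
      + change (numeral (S i) ≡ numeral 0) in H1. apply numeral_inj in H1; discriminate.
      + apply numeral_inj in H1. injection H1 as <-.
        rewrite Hwy in Hw. assert (Ey : y ≡ f i) by now apply IH.
        assert (Mx : M x) by exact (proj2 (M_opair_inv _ _ (Mtr _ _ Mg Hx))).
        assert (My : M y) by exact (proj2 (M_opair_inv _ _ (Mtr _ _ Mg Hw))).
        assert (My' : M y') by exact (Mcl _ _ H2 Mx).
        apply Hstep; auto.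
        apply (definable_invariant R HR i y (f i) y' x); auto. now symmetry. }
  set (gn := fix gn m := match m with 0 => upair (opair empty (f 0)) (opair empty (f 0))
                         | S m => adjoin (gn m) (opair (numeral (S m)) (f (S m))) end).
  assert (Mgn : forall m, M (gn m)).
  { induction m; cbn [gn]; [apply M_upair|apply M_adjoin]; auto; apply M_opair; auto using M_empty, M_numeral. }
  assert (gn_mem : forall m i, i <= m -> opair (numeral i) (f i) ∈ gn m).
  { induction m as [|m IH]; intros i Hi; cbn [gn].
    - replace i with 0 by lia. apply mem_upair; left; reflexivity.
    - apply mem_adjoin. destruct (Nat.eq_dec i (S m)) as [->|]; [right; reflexivity|].
      left; apply IH; lia. }
  assert (gn_App : forall m, App (gn m)).
  { assert (L : forall m z, z ∈ gn m -> z ≡ opair empty (f 0) \/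
      exists i, i < m /\ z ≡ opair (numeral (S i)) (f (S i))).
    { induction m as [|m IH]; intros z Hz; cbn [gn] in Hz.
      - apply mem_upair in Hz; tauto.
      - apply mem_adjoin in Hz as [Hz|Hz].
        + destruct (IH z Hz) as [H|[i [H1 H2]]]; auto. right; exists i; split; auto; lia.
        + right; exists m; auto. }
    intros m z Hz. destruct (L m z Hz) as [H|[i [Hi H]]]; auto. right.
    exists i, (S i); split; auto. exists (opair (numeral i) (f i)). split; [apply gn_mem; lia|].
    exists (upair (numeral i) (f i)). split; [apply mem_upair; right; reflexivity|].
    exists (f i); split; [apply mem_upair; right; reflexivity|].
    exists (upair (numeral (S i)) (f (S i))). split; [rewrite H; apply mem_upair; right; reflexivity|].
    exists (f (S i)); split; [apply mem_upair; right; reflexivity|].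
    split; [reflexivity|]. split; auto. apply Hstep; auto; reflexivity. }
  set (P := fun g y k => App g /\ y ∈ g /\ exists u, u ∈ y /\ exists x, x ∈ u /\ y ≡ opair k x).
  assert (DP : definable (fun v r s => P (s 0) (s 1) (s 2))).
  { unfold P. apply definable_and; [exact DApp|defn]. }
  destruct (definable_formula P DP) as [p [e [H1 [H2 H3]]]].
  (* The existence of an approximation is the one unbounded quantifier, and [1 <= n] admits it in
     the replacement schema. *)
  assert (S1 : Sigma n (fex p)).
  { destruct n as [|m]; [lia|]. apply Sigma_ex. now apply Delta0_hierarchy. }
  assert (Main : forall k y, M y -> (exists i, k ≡ numeral i /\ y ≡ opair k (f i)) <->
     k ∈ omegaV /\ sat M (scons y (scons k e)) (fex p)).
  { intros k y My; split.
    - intros [i [Hk Hy]]. split; [exists i; auto|].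
      assert (Mk : M k) by (apply (Mcl (numeral i)); [now symmetry|apply M_numeral]).
      exists (gn i); split; auto. apply H3; auto. split; auto. split.
      + rewrite Hy, Hk. now apply gn_mem.
      + exists (upair k (f i)); split; [rewrite Hy; apply mem_upair; right; reflexivity|].
        exists (f i); split; auto. apply mem_upair; right; reflexivity.
    - intros [[i Hk] [g [Mg K]]]. exists i; split; auto.
      assert (Mk : M k) by (apply (Mcl (numeral i)); [now symmetry|apply M_numeral]).
      apply H3 in K; auto. destruct K as [K1 [K2 [u [_ [x [_ Hx]]]]]].
      assert (E : x ≡ f i) by (apply (App_inv g Mg K1); now rewrite <- Hk, <- Hx).
      now rewrite Hx, E. }
  destruct (model_replacement n M HM (fex p) S1 e H2 omegaV M_omega) as [b [Hb K]].
  - intros k Mk Hk. destruct Hk as [i Hi]. exists (opair k (f i)). split; [now apply M_opair|].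
    split.
    + apply Main; [now apply M_opair|]. exists i; split; auto; reflexivity.
    + intros y My Hy. destruct (proj2 (Main k y My)) as [j [Hj Ey]].
      * split; auto. exists i; auto.
      * rewrite Hi in Hj. apply numeral_inj in Hj; subst. exact Ey.
  - apply (Mcl b); auto. apply eqV_ext; intros z. split.
    + intros Hz. assert (Mz := Mtr _ _ Hb Hz). apply K in Hz as [k [Mk Hk]]; auto.
      apply Main in Hk as [i [Hi Ez]]; auto. exists i. now rewrite Ez, Hi.
    + intros [i Hi]. assert (Mz : M z).
      { apply (Mcl (opair (numeral i) (f i))); [now symmetry|]. apply M_opair; auto using M_numeral. }
      apply K; auto. exists (numeral i); split; [apply M_numeral|].
      apply Main; auto. exists i; split; auto; reflexivity.
Qed.

Lemma M_real_rec (f : nat -> nat) (H : nat -> nat -> nat) :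
  definable (fun v r s => v 0 = H (v 1) (v 2)) ->
  (forall k, f (S k) = H k (f k)) -> M (real f).
Proof.
  intros HH Hf. apply (M_recursion (fun k => numeral (f k))
    (fun k x y => exists a b : nat, x ≡ numeral a /\ y ≡ numeral b /\ b = H k a)).
  - intros; apply M_numeral.
  - do 2 apply definable_ex_nat. do 2 (apply definable_and; [defn|]).
    exact (definable_rename _ (fun i => match i with 1 => 2 | 2 => 1 | _ => 0 end)
      (fun i => i) (fun i => i) HH).
  - intros k y My; split.
    + intros [a [b [H1 [H2 ->]]]]. apply numeral_inj in H1; subst. now rewrite Hf.
    + intros Hy. exists (f k), (f (S k)). split; [reflexivity|]. split; auto.
Qed.

(** * Arithmetic inside the model *)

(** The sequence of sums is a real of [M] by [M_real_rec], so a bounded quantifier over reals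
    satisfying the recursion defines addition. Multiplication follows the same pattern. *)
Lemma definable_add : definable (fun v r s => v 0 = v 1 + v 2).
Proof.
  apply (definable_ext (fun v r s => exists f, M (real f) /\
    (f 0 = v 1 /\ (forall k, f (S k) = S (f k)) /\ v 0 = f (v 2)))); [|defn].
  intros v r s _ _; split.
  - intros [f [_ [H0 [HS ->]]]]. rewrite <- H0. generalize (v 2).
    intros m; induction m as [|m IH]; [lia|]. rewrite HS, IH; lia.
  - intros ->. exists (fun k => v 1 + k). split; [|split; [lia|split; [lia|auto]]].
    apply (M_real_rec _ (fun _ x => S x)); [defn|intros; lia].
Qed.

Lemma natterm_add t t' : natterm t -> natterm t' -> natterm (fun v r s => t v r s + t' v r s).
Proof. apply (natterm_fun2 Nat.add), definable_add. Qed.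

Lemma definable_mul : definable (fun v r s => v 0 = v 1 * v 2).
Proof.
  apply (definable_ext (fun v r s => exists f, M (real f) /\
    (f 0 = 0 /\ (forall k, f (S k) = f k + v 1) /\ v 0 = f (v 2)))).
  2:{ apply definable_ex_real, definable_and; [defn|]. apply definable_and; [|defn].
      apply definable_all_nat, definable_eq; [natt|]. apply natterm_add; natt. }
  intros v r s _ _; split.
  - intros [f [_ [H0 [HS ->]]]]. generalize (v 2).
    intros m; induction m as [|m IH]; [lia|]. rewrite HS, IH; lia.
  - intros ->. exists (fun k => v 1 * k). split; [|split; [lia|split; [lia|auto]]].
    apply (M_real_rec _ (fun _ x => x + v 1)); [|intros; lia].
    apply definable_eq; [natt|]. apply natterm_add; natt.
Qed.

Lemma natterm_mul t t' : natterm t -> natterm t' -> natterm (fun v r s => t v r s * t' v r s).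
Proof. apply (natterm_fun2 Nat.mul), definable_mul. Qed.

Lemma natterm_pair t t' : natterm t -> natterm t' ->
  natterm (fun v r s => to_nat (t v r s, t' v r s)).
Proof.
  apply (natterm_fun2 (fun a b => to_nat (a, b))).
  (* Cantor's pairing formula, doubled to avoid a division. *)
  apply (definable_ext (fun v r s => v 0 * 2 = v 2 * 2 + (v 2 + v 1) * S (v 2 + v 1))).
  - intros v r s _ _. rewrite <- to_nat_spec. lia.
  - apply definable_eq; repeat first [apply natterm_add | apply natterm_mul | apply natterm_S | natt].
Qed.

Lemma natterm_fst t : natterm t -> natterm (fun v r s => fst (of_nat (t v r s))).
Proof.
  apply (natterm_fun1 (fun k => fst (of_nat k))).
  apply (definable_ext (fun v r s => exists b, to_nat (v 0, b) = v 1)).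
  - intros v r s _ _; split.
    + intros [b <-]. now rewrite cancel_of_to.
    + intros ->. exists (snd (of_nat (v 1))). rewrite <- surjective_pairing. apply cancel_to_of.
  - apply definable_ex_nat, definable_eq; [apply natterm_pair|]; natt.
Qed.

Lemma natterm_snd t : natterm t -> natterm (fun v r s => snd (of_nat (t v r s))).
Proof.
  apply (natterm_fun1 (fun k => snd (of_nat k))).
  apply (definable_ext (fun v r s => exists a, to_nat (a, v 0) = v 1)).
  - intros v r s _ _; split.
    + intros [b <-]. now rewrite cancel_of_to.
    + intros ->. exists (fst (of_nat (v 1))). rewrite <- surjective_pairing. apply cancel_to_of.
  - apply definable_ex_nat, definable_eq; [apply natterm_pair|]; natt.
Qed.

Lemma M_real_pow : M (real (Nat.pow 2)).
Proof.
  apply (M_real_rec _ (fun _ x => x + x)).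
  - apply definable_eq; [natt|]. apply natterm_add; natt.
  - intros k; simpl; lia.
Qed.

Lemma natterm_log2 t : natterm t -> natterm (fun v r s => Nat.log2 (t v r s)).
Proof.
  apply (natterm_fun1 Nat.log2). pose proof M_real_pow as Mp.
  apply (definable_ext (fun v r s => (v 1 = 0 /\ v 0 = 0) \/
    (2 ^ v 0 <= v 1 /\ v 1 < 2 ^ S (v 0)))).
  - intros v r s _ _; split.
    + intros [[H1 H2]|H]; [now rewrite H1, H2|]. symmetry; apply Nat.log2_unique; [lia|exact H].
    + intros E. destruct (Nat.eq_dec (v 1) 0) as [H|H].
      * rewrite H in *; auto.
      * right. rewrite E. apply Nat.log2_spec. lia.
  - apply definable_or; [defn|]. apply definable_and; [apply definable_le|apply definable_lt];
      try natt; apply (natterm_app (Nat.pow 2)); auto; natt.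
Qed.

Ltac natt ::=
  cbn beta; solve [repeat first
    [ assumption | apply natterm_var | apply natterm_const | apply natterm_S
    | apply natterm_pair | apply natterm_fst | apply natterm_snd | apply natterm_log2
    | apply natterm_add | apply natterm_mul
    | apply natterm_app_var | apply natterm_app; [assumption|] ]].

Lemma M_real_ext f g : (forall k, f k = g k) -> M (real f) -> M (real g).
Proof. intros H. apply Mcl. now apply real_eq. Qed.

Lemma M_update f a b : M (real f) -> M (real (update f a b)).
Proof.
  intros Hf. apply M_real_of_natterm. unfold natterm.
  apply (definable_ext (fun v r s => (v 1 = a /\ v 0 = b) \/ (~ v 1 = a /\ v 0 = f (v 1)))).
  - intros v r s _ _. unfold update. destruct (Nat.eqb_spec (v 1) a); intuition lia.
  - defn.
Qed.

(** [c] may lie outside [M]: only finitely many of its values enter, and they are patched in one at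
    a time. *)
Lemma M_splice c L g : M (real g) -> M (real (splice c L g)).
Proof.
  intros Hg.
  assert (H0 : M (real (fun l => g (l - L)))).
  { apply M_real_of_natterm. unfold natterm.
    apply (definable_ext (fun v r s => (v 1 < L /\ v 0 = g 0) \/
       exists k, v 1 = k + L /\ v 0 = g k)); [|defn].
    intros v r s _ _; split.
    - intros [[H ->]|[k [-> ->]]]; f_equal; lia.
    - intros ->. destruct (Nat.lt_ge_cases (v 1) L).
      + left; split; auto. f_equal; lia.
      + right; exists (v 1 - L); split; auto; lia. }
  assert (K : forall m, m <= L -> M (real (fun l => if l <? m then c l else g (l - L)))).
  { induction m as [|m IH]; intros Hm.
    - revert H0; apply M_real_ext. intros k. reflexivity.
    - assert (Hm' : m <= L) by lia. apply (M_update _ m (c m)) in IH; auto. revert IH; apply M_real_ext.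
      intros k; unfold update. destruct (Nat.eqb_spec k m) as [->|Hk].
      + now destruct (Nat.ltb_spec m (S m)); [|lia].
      + destruct (Nat.ltb_spec k m), (Nat.ltb_spec k (S m)); auto; lia. }
  apply K; auto.
Qed.

(** * The order on conditions *)

(** New entries avoid the reals already forbidden by [p]. The last clause is confined to branches of
    [M], which makes the order definable in [M]; this suffices because the branches that [catch_all]
    supplies lie in [M]. *)
Definition extends (p' p : nat -> nat) : Prop :=
  slen p <= slen p' /\ fcnt p <= fcnt p' /\
  (forall i, i < slen p -> entry p' i = entry p i) /\
  (forall j i, j < fcnt p -> forb p' j i = forb p j i) /\
  (forall i, slen p <= i -> i < slen p' -> ~ forbidden p i (entry p' i)) /\
  (forall b, M (real b) -> branch b -> uncatchable p' b -> uncatchable p b \/ catches p' p b).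

Lemma lengthens_extends p' p : lengthens p' p -> extends p' p.
Proof.
  intros H. pose proof H as [H1 [H2 [H3 [H4 H5]]]].
  split; auto. split; [lia|]. do 3 (split; auto). intros b _ _ Hb; left. revert Hb.
  apply uncatchable_ext. intros i s; apply (forbidden_lengthens p' p i s H).
Qed.

Lemma catches_mono p q t c : extends p q -> slen t <= slen q -> catches q t c -> catches p t c.
Proof.
  intros [H1 [_ [H2 _]]] Hl [i [Hi [Hi' E]]]. exists i. split; auto. split; [lia|]. rewrite H2; auto.
Qed.

Lemma extends_refl p : extends p p.
Proof. apply lengthens_extends, lengthens_refl. Qed.

Lemma extends_trans p q t : extends p q -> extends q t -> extends p t.
Proof.
  intros Hpq Hqt. pose proof Hpq as [H1 [H2 [H3 [H4 [H5 H6]]]]].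
  pose proof Hqt as [K1 [K2 [K3 [K4 [K5 K6]]]]].
  split; [lia|]. split; [lia|]. split; [|split; [|split]].
  - intros i Hi. rewrite H3 by lia. auto.
  - intros j i Hj. rewrite H4 by lia. auto.
  - intros i Hi Hi'. destruct (Nat.lt_ge_cases i (slen q)).
    + rewrite H3 by auto. auto.
    + intros [j [Hj E]]. apply (H5 i); auto. exists j; split; [lia|]. rewrite K4; auto.
  - intros b Mb Bb Hb. destruct (H6 b Mb Bb Hb) as [H|[i [Hi [Hi' E]]]].
    + destruct (K6 b Mb Bb H) as [K|K]; auto. right. now apply (catches_mono p q).
    + right. exists i. split; [lia|]. auto.
Qed.

Lemma lengthen_one p s : M (real p) -> ~ forbidden p (slen p) s ->
  exists p', M (real p') /\ lengthens p' p /\ slen p' = S (slen p) /\ entry p' (slen p) = s.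
Proof.
  intros Mp Hs.
  set (a := S (S (to_nat (0, slen p)))).
  set (p' := update (update p a s) 0 (S (slen p))).
  assert (E : forall i, entry p' i = if i =? slen p then s else entry p i).
  { intros i. unfold p', entry, update. simpl (_ =? 0).
    destruct (Nat.eqb_spec (S (S (to_nat (0, i)))) a) as [Ha|Ha], (Nat.eqb_spec i (slen p)) as [Hi|Hi]; auto.
    - unfold a in Ha. injection Ha as Ha. apply to_nat_pair_inj in Ha. lia.
    - subst; contradiction. }
  exists p'. split; [now do 2 apply M_update|]. split; [|split].
  - split; [unfold p', slen, update; simpl; lia|]. split; [reflexivity|]. split; [|split].
    + intros i Hi. rewrite E. destruct (Nat.eqb_spec i (slen p)); auto; lia.
    + intros j i. unfold p', forb, update. simpl (_ =? 0).
      destruct (Nat.eqb_spec (S (S (to_nat (S j, i)))) a) as [Ha|Ha]; auto.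
      unfold a in Ha. injection Ha as Ha. apply to_nat_pair_inj in Ha. lia.
    + intros i Hi Hi'. assert (i = slen p) by (unfold p', slen, update in *; simpl in *; lia). subst i.
      rewrite E, Nat.eqb_refl. auto.
  - reflexivity.
  - rewrite E, Nat.eqb_refl. auto.
Qed.

Lemma lengthen_by p k : M (real p) ->
  exists p', M (real p') /\ lengthens p' p /\ slen p' = k + slen p.
Proof.
  intros Mp; induction k as [|k [q [Mq [Hq Lq]]]].
  - exists p; auto using lengthens_refl.
  - destruct (fresh_value q (slen q)) as [s Hs].
    destruct (lengthen_one q s Mq Hs) as [p' [Mp' [H1 [H2 _]]]].
    exists p'; split; auto. split; [eapply lengthens_trans; eauto|]. lia.
Qed.

Lemma lengthen_meet p W : M (real p) -> demand p W ->
  exists p', M (real p') /\ lengthens p' p /\ meets p' p W.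
Proof.
  intros Mp HW. destruct (HW (slen p)) as [i [s [Hi [HWs Hs]]]].
  destruct (lengthen_by p (i - slen p) Mp) as [q [Mq [Hq Lq]]].
  assert (Lq' : slen q = i) by lia. rewrite <- (forbidden_lengthens q p) in Hs by auto.
  rewrite <- Lq' in Hs. destruct (lengthen_one q s Mq Hs) as [p' [Mp' [H1 [H2 H3]]]].
  exists p'; split; auto. split; [eapply lengthens_trans; eauto|].
  exists i. split; auto. split; [lia|]. rewrite <- Lq', H3. now rewrite Lq'.
Qed.

(** Demands are met one after another: lengthening leaves the forbidden values alone, so it spoils
    neither an outstanding demand nor a meeting already achieved. *)
Lemma lengthen_meet_all p Ws : M (real p) -> Forall (demand p) Ws ->
  exists p', M (real p') /\ lengthens p' p /\ Forall (meets p' p) Ws.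
Proof.
  intros Mp; induction 1 as [|W Ws HW _ [q [Mq [Hq HWs]]]].
  - exists p; auto using lengthens_refl.
  - destruct (lengthen_meet q W Mq) as [p' [Mp' [H1 [i [Hi [Hi' K]]]]]].
    { intros N. destruct (HW N) as [i [s [Hi [HWi Hs]]]]. exists i, s.
      now rewrite (forbidden_lengthens q p). }
    exists p'; split; auto. split; [eapply lengthens_trans; eauto|]. constructor.
    + exists i. split; auto. destruct Hq. lia.
    + revert HWs. apply Forall_impl. intros W'. now apply meets_mono.
Qed.

(** ** Dead nodes *)

(** Reals [c] of the model suffice in the definition of [dead], since only an initial segment
    of [c] matters; this makes [dead] definable in the model. *)
Definition dead (p : nat -> nat) (s : nat) : Prop :=
  exists L : nat, forall c, M (real c) -> branch c /\ c (Nat.log2 s) = s ->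
    exists l, Nat.log2 s <= l /\ l < L /\ ~ blocked p (c l).

Lemma dead_spec p s : dead p s ->
  exists L, forall c, branch c -> c (Nat.log2 s) = s ->
    exists l, Nat.log2 s <= l /\ l < L /\ ~ blocked p (c l).
Proof.
  intros [L0 H0].
  (* The maximum ensures that the spliced branch below still passes through [s]. *)
  set (L := Nat.max L0 (Nat.log2 s)).
  exists L. intros c Hc Hs.
  (* Above level [L] the branch is replaced by its leftmost continuation; this brings it into [M]
     without changing the levels that matter. *)
  set (g := fun k => 2 ^ k * c L).
  assert (Mg : M (real g)).
  { pose proof M_real_pow. apply M_real_of_natterm. unfold g. apply natterm_mul; [|natt].
    apply (natterm_app (Nat.pow 2)); auto; natt. }
  assert (Hg : g 0 = c L) by (unfold g; simpl; lia).
  destruct (H0 (splice c L g)) as [l [H1 [H2 H3]]].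
  - now apply M_splice.
  - split.
    + apply branch_splice; auto. intros k; left. unfold g. rewrite Nat.pow_succ_r'. lia.
    + rewrite splice_below; auto. lia.
  - exists l. split; auto. split; [lia|]. rewrite splice_below in H3; auto. lia.
Qed.

(** The step of König's lemma, used in contrapositive form: a node that is not dead has a child that
    is not dead. *)
Lemma dead_children p s : 0 < s -> dead p (2 * s) -> dead p (S (2 * s)) -> dead p s.
Proof.
  intros Hs [L1 H1] [L2 H2]. exists (Nat.max L1 L2). intros c Mc [Hc E].
  assert (E1 : Nat.log2 (2 * s) = S (Nat.log2 s)) by now apply Nat.log2_double.
  assert (E2 : Nat.log2 (S (2 * s)) = S (Nat.log2 s))
    by (rewrite <- Nat.add_1_r; now apply Nat.log2_succ_double).
  destruct (proj2 Hc (Nat.log2 s)) as [K|K]; rewrite E in K.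
  - destruct (H1 c Mc) as [l [D1 [D2 D3]]]; [rewrite E1; auto|].
    exists l; split; [lia|]. split; auto; lia.
  - destruct (H2 c Mc) as [l [D1 [D2 D3]]]; [rewrite E2; auto|].
    exists l; split; [lia|]. split; auto; lia.
Qed.

Lemma dead_of_not_blocked p s : ~ blocked p s -> dead p s.
Proof.
  intros H. exists (S (Nat.log2 s)). intros c _ [_ E]. exists (Nat.log2 s). rewrite E. split; auto.
Qed.

Lemma definable_forbidden p t t' : M (real p) -> natterm t -> natterm t' ->
  definable (fun v r s => forbidden p (t v r s) (t' v r s)).
Proof.
  intros Mp. apply definable_rel2. unfold forbidden, fcnt, forb. defn.
Qed.

Lemma definable_blocked p t : M (real p) -> natterm t -> definable (fun v r s => blocked p (t v r s)).
Proof.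
  intros Mp. apply (definable_rel1 (blocked p)). unfold blocked, row.
  apply definable_ex_nat, definable_all_nat, definable_imp; [defn|].
  apply definable_imp; [defn|]. apply definable_forbidden; auto; natt.
Qed.

Lemma definable_dead p t : M (real p) -> natterm t -> definable (fun v r s => dead p (t v r s)).
Proof.
  intros Mp. apply (definable_rel1 (dead p)). unfold dead, branch.
  apply definable_ex_nat, definable_all_real, definable_imp; [defn|].
  apply definable_ex_nat. do 2 (apply definable_and; [defn|]).
  apply definable_not, definable_blocked; auto; natt.
Qed.

(** Above a node that is not dead, the leftmost path through nodes that are not dead is an
    uncatchable branch of the model. *)
Lemma alive_branch p c L : M (real p) -> branch c -> ~ dead p (c L) ->
  exists b, M (real b) /\ branch b /\ uncatchable p b /\ b L = c L.
Proof.
  intros Mp Hc Hs.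
  set (ch := fun x => if excluded_middle_informative (dead p (2 * x)) then S (2 * x) else 2 * x).
  set (g := fun k => Nat.iter k ch (c L)).
  assert (Hg : forall k, 0 < g k /\ ~ dead p (g k)).
  { induction k as [|k [IH1 IH2]].
    - split; auto. pose proof (branch_bounds c L Hc). pose proof (Nat.pow_nonzero 2 L). simpl; lia.
    - change (g (S k)) with (ch (g k)). unfold ch.
      destruct (excluded_middle_informative (dead p (2 * g k))) as [D|D]; split; auto; try lia.
      intros D'. apply IH2. now apply dead_children. }
  (* The choice of the child is definable because [dead] is, so recursion inside [M] produces the
     path. *)
  assert (Mg : M (real g)).
  { apply (M_real_rec _ (fun _ x => ch x)); [|reflexivity].
    apply (definable_ext (fun v r s => (dead p (2 * v 2) /\ v 0 = S (2 * v 2)) \/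
      (~ dead p (2 * v 2) /\ v 0 = 2 * v 2))).
    - intros v r s _ _. unfold ch. destruct (excluded_middle_informative (dead p (2 * v 2))); tauto.
    - apply definable_or; (apply definable_and; [|defn]); try apply definable_not;
        apply definable_dead; auto; natt. }
  assert (Hb : branch (splice c L g)).
  { apply branch_splice; auto. intros k. change (g (S k)) with (ch (g k)). unfold ch.
    destruct (excluded_middle_informative (dead p (2 * g k))); auto. }
  exists (splice c L g). split; [now apply M_splice|]. split; auto. split.
  - exists L. intros l Hl. unfold splice. destruct (Nat.ltb_spec l L); [lia|].
    apply NNPP; intros D. now apply dead_of_not_blocked, Hg in D.
  - now apply splice_below.
Qed.

(** Compactness: finitely many nodes that are not blocked bar all branches that do not start
    like an uncatchable branch of the model. *)
Lemma catch_all p L : M (real p) ->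
  exists p', M (real p') /\ lengthens p' p /\ forall c, branch c -> catches p' p c \/
    exists b, M (real b) /\ branch b /\ uncatchable p b /\ b L = c L.
Proof.
  intros Mp.
  (* A common bound for all dead nodes below [N]; taking [2 ^ S L] for [N] covers the whole level
     [L]. *)
  assert (H : forall N, exists L2, forall s, s < N -> dead p s ->
    forall c, branch c -> c (Nat.log2 s) = s -> exists l, Nat.log2 s <= l /\ l < L2 /\ ~ blocked p (c l)).
  { induction N as [|N [L2 IH]]; [exists 0; lia|].
    destruct (classic (dead p N)) as [D|D].
    - destruct (dead_spec p N D) as [L3 H3]. exists (Nat.max L2 L3). intros s Hs Ds c Hc E.
      destruct (Nat.eq_dec s N) as [->|].
      + destruct (H3 c Hc E) as [l [K1 [K2 K3]]]. exists l; split; auto; split; auto; lia.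
      + destruct (IH s ltac:(lia) Ds c Hc E) as [l [K1 [K2 K3]]]. exists l; split; auto; split; auto; lia.
    - exists L2. intros s Hs Ds. apply IH; auto. destruct (Nat.eq_dec s N) as [->|]; [contradiction|lia]. }
  destruct (H (2 ^ S L)) as [L2 HL2].
  (* Every node below level [L2] that is not blocked gets realised in its row, and a branch through
     a dead node of level [L] passes through one of these. *)
  destruct (lengthen_meet_all p (map (fun t i s => s = t /\ row i = Nat.log2 t)
    (filter (fun t => if excluded_middle_informative (blocked p t) then false else true) (seq 0 (2 ^ L2)))) Mp)
    as [p' [Mp' [Hp' K]]].
  { apply Forall_map, Forall_forall. intros t Ht. apply filter_In in Ht as [_ Ht].
    apply not_blocked_demand. now destruct (excluded_middle_informative (blocked p t)). }
  exists p'; split; auto. split; auto. intros c Hc.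
  destruct (classic (dead p (c L))) as [D|D].
  - left. destruct (HL2 (c L)) with (c := c) as [l [E1 [E2 E3]]]; auto.
    { now apply branch_bounds. } { now rewrite branch_log2. }
    rewrite Forall_map, Forall_forall in K. destruct (K (c l)) as [i [Hi [Hi' [E4 E5]]]].
    + apply filter_In; split.
      * apply in_seq. pose proof (branch_bounds c l Hc).
        assert (2 ^ S l <= 2 ^ L2) by (apply Nat.pow_le_mono_r; lia). lia.
      * now destruct (excluded_middle_informative (blocked p (c l))).
    + exists i. split; auto. split; auto. rewrite E4. rewrite branch_log2 in E5; congruence.
  - right. now apply alive_branch.
Qed.

(** * Enlarging the set of forbidden reals *)

Lemma M_add_forbidden p y : M (real p) -> M (real y) -> M (real (add_forbidden p y)).
Proof.
  intros Mp My. apply M_real_of_natterm. unfold natterm.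
  apply (definable_ext (fun v r s => (v 1 = 0 /\ v 0 = p 0) \/ (v 1 = 1 /\ v 0 = S (p 1)) \/
    exists i, v 1 = S (S i) /\ ((fst (of_nat i) = S (p 1) /\ v 0 = y (snd (of_nat i))) \/
      (~ fst (of_nat i) = S (p 1) /\ v 0 = p (v 1))))); [|defn].
  intros v r s _ _. destruct (v 1) as [|[|i]]; simpl.
  - split; [intros [[_ H]|[[H _]|[i [H _]]]]; auto; discriminate|auto].
  - split; [intros [[H _]|[[_ H]|[i [H _]]]]; auto; discriminate|auto].
  - destruct (Nat.eqb_spec (fst (of_nat i)) (S (p 1))) as [E|E]; split.
    + intros [[H _]|[[H _]|[j [H K]]]]; try discriminate. injection H as <-. tauto.
    + intros H; right; right; exists i; auto.
    + intros [[H _]|[[H _]|[j [H K]]]]; try discriminate. injection H as <-. tauto.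
    + intros H; right; right; exists i; auto.
Qed.

(** The branches that [y] would make uncatchable are caught while this is still possible, and [y] is
    added afterwards; finitely many representatives suffice by [uncatchable_finite]. *)
Lemma extend_forbid p y : M (real p) -> M (real y) ->
  exists p', M (real p') /\ extends p' p /\ exists j, j < fcnt p' /\ forall i, forb p' j i = y i.
Proof.
  intros Mp My.
  destruct (uncatchable_finite (add_forbidden p y)
    (fun b => (M (real b) /\ branch b) /\ uncatchable (add_forbidden p y) b)) as [bs [Hbs Cbs]]; [tauto|].
  destruct (lengthen_meet_all p (map (fun b i s => s = b (row i))
    (filter (fun b => if excluded_middle_informative (uncatchable p b) then false else true) bs)) Mp)
    as [q [Mq [Hq K]]].
  (* A branch that could not be met beyond some position would have all its nodes blocked, hence be
     uncatchable for [p]. *)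
  { apply Forall_map, Forall_forall. intros b Hb. apply filter_In in Hb as [Hb Ub].
    destruct (excluded_middle_informative (uncatchable p b)) as [|Ub']; [discriminate|]. clear Ub.
    apply Hbs in Hb as [[_ Bb] _]. intros N. apply NNPP; intros C. apply Ub'.
    exists 0. intros l _. apply NNPP; intros D.
    destruct (not_blocked_demand p (b l) D N) as [i [s [Hi [[-> Hr] Hs]]]].
    apply C. exists i, (b l). rewrite branch_log2 in Hr by auto. rewrite Hr. auto. }
  destruct (add_forbidden_spec q y) as [S1 [S2 [S3 [S4 S5]]]].
  exists (add_forbidden q y). split; [now apply M_add_forbidden|]. split.
  - pose proof Hq as [Q1 [Q2 [Q3 [Q4 Q5]]]].
    split; [lia|]. split; [lia|]. split; [|split; [|split]].
    + intros i Hi. rewrite S3; auto.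
    + intros j i Hj. rewrite S4, Q4; auto; lia.
    + intros i Hi Hi'. rewrite S3. apply Q5; auto; lia.
    + intros b Mb Bb Ub. destruct (classic (uncatchable p b)) as [H|H]; auto. right.
      destruct (Cbs b) as [b' [Hb' E]].
      { split; auto. revert Ub; apply uncatchable_ext. intros i s.
        rewrite !add_forbidden_forbidden, (forbidden_lengthens q p) by auto. auto. }
      rewrite Forall_map, Forall_forall in K. destruct (K b') as [i [Hi [Hi' Ei]]].
      * apply filter_In; split; auto.
        destruct (excluded_middle_informative (uncatchable p b')) as [U|]; auto.
        destruct H. destruct U as [l0 Hl]. exists l0. intros l Hll. rewrite E; auto.
      * exists i. split; auto. split; [lia|]. rewrite S3, E; auto.
  - exists (fcnt q); split; [lia|auto].
Qed.

(** ** A generic sequence of conditions *)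

(** Here [q] is the state just before the final lengthening by [catch_all]. Since [row k <= k], the
    bound [slen q <= L] makes agreement up to level [L] cover the rows of all positions filled by
    [q]. *)
Definition good_step (D : (nat -> nat) -> Prop) (y : nat -> nat) (i : nat) (p p' : nat -> nat) : Prop :=
  extends p' p /\ i < slen p' /\
  (exists q, M (real q) /\ D q /\ extends p' q) /\
  (exists j, j < fcnt p' /\ forall k, forb p' j k = y k) /\
  exists q L, extends q p /\ lengthens p' q /\ i <= L /\ slen q <= L /\
    forall c, branch c -> catches p' q c \/
      exists b, M (real b) /\ branch b /\ uncatchable q b /\ b L = c L.

Lemma good_step_exists (D : (nat -> nat) -> Prop) y i p :
  (forall p, M (real p) -> exists q, M (real q) /\ extends q p /\ D q) ->
  M (real y) -> M (real p) -> exists p', M (real p') /\ good_step D y i p p'.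
Proof.
  intros HD My Mp. destruct (HD p Mp) as [q0 [Mq0 [E0 D0]]].
  destruct (extend_forbid q0 y Mq0 My) as [q1 [Mq1 [E1 [j [Hj Ej]]]]].
  destruct (lengthen_by q1 (S i) Mq1) as [q2 [Mq2 [L2 S2]]].
  destruct (catch_all q2 (Nat.max i (slen q2)) Mq2) as [p' [Mp' [L3 K]]].
  assert (E2 := lengthens_extends _ _ L2). assert (E3 := lengthens_extends _ _ L3).
  assert (E31 : extends p' q1) by (eapply extends_trans; eauto).
  assert (E30 : extends p' q0) by (eapply extends_trans; eauto).
  exists p'; split; auto. split; [eapply extends_trans; eauto|].
  split; [destruct L3; lia|]. split; [exists q0; auto|]. split.
  - exists j. pose proof E31 as [_ [F [_ [B _]]]]. split; [lia|]. intros k. rewrite B; auto.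
  - exists q2, (Nat.max i (slen q2)). split; [|split; [auto|split; [lia|split; [lia|auto]]]].
    eapply extends_trans; [eauto|]. eapply extends_trans; eauto.
Qed.

(** The enumeration of [M] lists other sets too; an index whose set is not a real of [M] receives
    the zero real. *)
Lemma reals_enumeration : countable_class M -> exists ys : nat -> nat -> nat,
  (forall i, M (real (ys i))) /\ forall f, M (real f) -> exists i, forall k, f k = ys i k.
Proof.
  intros [e He].
  assert (H : forall i, exists f, M (real f) /\ forall g, M (real g) -> real g ≡ e i -> forall k, g k = f k).
  { intros i. destruct (classic (exists f, M (real f) /\ real f ≡ e i)) as [[f [H1 H2]]|H].
    - exists f; split; auto. intros g _ Hg. apply real_eq. now rewrite Hg, H2.
    - exists (fun _ => 0); split; [apply M_real_zero|]. intros g Mg Hg; exfalso; eauto. }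
  apply choice in H as [ys Hys]. exists ys; split; [intros i; apply Hys|].
  intros f Mf. destruct (He _ Mf) as [i Hi]. exists i. now apply Hys.
Qed.

(** Members of the finite list that differ from [c] all do so below a common level, so agreement
    beyond it singles out a member equal to [c]. *)
Lemma agree_limit (bs : list (nat -> nat)) (c : nat -> nat) i0 :
  (forall i, i0 <= i -> exists b, In b bs /\ forall l, l <= i -> b l = c l) ->
  exists b, In b bs /\ forall l, b l = c l.
Proof.
  intros H. apply NNPP; intros C.
  assert (K : exists N, forall b, In b bs -> exists l, l <= N /\ b l <> c l).
  { clear H. induction bs as [|b bs IH]; [exists 0; intros ? []|].
    destruct IH as [N HN]; [intros [b' [Hb' E]]; apply C; exists b'; split; auto; now right|].
    assert (D : exists l, b l <> c l).
    { apply NNPP; intros D; apply C; exists b; split; [now left|].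
      intros l; apply NNPP; intros E; apply D; eauto. }
    destruct D as [l Hl]. exists (Nat.max N l). intros b' [<-|Hb'].
    - exists l; split; auto; lia.
    - destruct (HN b' Hb') as [l' [K1 K2]]. exists l'; split; auto; lia. }
  destruct K as [N HN]. destruct (H (Nat.max i0 N)) as [b [Hb E]]; [lia|].
  destruct (HN b Hb) as [l [Hl D]]. apply D, E. lia.
Qed.

Lemma generic_sequence (D : nat -> (nat -> nat) -> Prop) : countable_class M ->
  (forall i p, M (real p) -> exists q, M (real q) /\ extends q p /\ D i q) ->
  exists ps d, (forall i, M (real (ps i))) /\ (forall i j, i <= j -> extends (ps j) (ps i)) /\
    (forall i, exists q, M (real q) /\ D i q /\ extends (ps (S i)) q) /\
    (forall i, i < slen (ps (S i))) /\
    (forall i k, k < slen (ps i) -> entry (ps i) k = d k) /\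
    eventually_different_over M d /\
    forall c, branch c -> ~ M (real c) -> forall m, exists k, m <= k /\ d k = c (row k).
Proof.
  intros HC HD. destruct (reals_enumeration HC) as [ys [Mys Hys]].
  assert (next : forall i (p : {p | M (real p)}), {p' : {p | M (real p)} |
     good_step (D i) (ys i) i (proj1_sig p) (proj1_sig p')}).
  { intros i [p Mp]. apply constructive_indefinite_description.
    destruct (good_step_exists (D i) (ys i) i p) as [p' [Mp' H]]; auto.
    exists (exist _ p' Mp'); auto. }
  set (qs := nat_rect (fun _ => {p | M (real p)}) (exist _ (fun _ => 0) M_real_zero)
     (fun i p => proj1_sig (next i p))).
  set (ps := fun i => proj1_sig (qs i)).
  assert (Mps : forall i, M (real (ps i))) by (intros i; exact (proj2_sig (qs i))).
  assert (Hps : forall i, good_step (D i) (ys i) i (ps i) (ps (S i))).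
  { intros i. exact (proj2_sig (next i (qs i))). }
  clearbody ps. clear qs next.
  assert (Hext : forall i j, i <= j -> extends (ps j) (ps i)).
  { induction 1; [apply extends_refl|]. eapply extends_trans; [apply Hps|auto]. }
  assert (Hlen : forall i, i < slen (ps (S i))) by (intros; apply Hps).
  set (d := fun k => entry (ps (S k)) k).
  assert (Hd : forall i k, k < slen (ps i) -> entry (ps i) k = d k).
  { intros i k Hk. unfold d. destruct (Nat.le_ge_cases i (S k)) as [H|H].
    - symmetry. now apply (Hext i (S k) H).
    - apply (Hext (S k) i H). apply Hlen. }
  clearbody d.
  exists ps, d. do 2 (split; auto). split; [intros i; apply Hps|]. do 2 (split; auto). split.
  - intros y My. destruct (Hys y My) as [i Hi].
    exists (slen (ps (S i))). intros k Hk E.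
    destruct (Hps i) as [_ [_ [_ [[j [Hj Ej]] _]]]].
    (* A stage late enough to have filled position [k], which therefore avoids the real forbidden at
       stage [S i]. *)
    assert (K : extends (ps (S i + S k)) (ps (S i))) by (apply Hext; lia).
    assert (Lk : k < slen (ps (S i + S k))).
    { specialize (Hlen (S i + k)). rewrite Nat.add_succ_r. lia. }
    destruct K as [_ [_ [_ [_ [K _]]]]]. apply (K k); auto. rewrite Hd by auto.
    exists j; split; auto. now rewrite Ej, <- Hi.
  - intros c Bc Nc m. apply NNPP; intros C.
    assert (Hm : forall k, m <= k -> d k <> c (row k)) by (intros k Hk E; apply C; eauto).
    destruct (uncatchable_finite (ps (S m)) (fun b => M (real b) /\ branch b /\ uncatchable (ps (S m)) b))
      as [bs [Hbs Cbs]]; [tauto|].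
    destruct (agree_limit bs c (S m)) as [b [Hb Eb]].
    2:{ apply Nc. apply (M_real_ext b); auto. now apply Hbs. }
    (* A late stage either catches [c] or supplies a branch [b] of [M] agreeing with [c] up to level
       [L]. It remains to see that [b] was uncatchable already at stage [S m]. *)
    intros i Hi. destruct (Hps i) as [_ [_ [_ [_ [q [L [E1 [E2 [L1 [L2 K]]]]]]]]]].
    assert (Em : extends q (ps (S m))) by (eapply extends_trans; [exact E1|now apply Hext]).
    pose proof (Hlen m) as Sm.
    destruct (K c Bc) as [[k [H1 [H2 H3]]]|[b [Mb [Bb [Ub Eb]]]]].
    { exfalso. apply (Hm k); [destruct Em; lia|]. rewrite <- H3. symmetry; now apply Hd. }
    assert (Ag := branch_agree b c L Bb Bc Eb).
    pose proof Em as [_ [_ [_ [_ [_ Cm]]]]].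
    destruct (Cm b Mb Bb Ub) as [U|[k [H1 [H2 H3]]]].
    + destruct (Cbs b) as [b' [Hb' E']]; auto. exists b'; split; auto.
      intros l Hl. rewrite <- E'. apply Ag; lia.
    (* A catch of [b] before the end of [q] happens in a row of level at most [L], where [b] and [c]
       agree, so [c] is caught as well. *)
    + exfalso. apply (Hm k); [lia|]. rewrite <- Ag by (pose proof (row_le k); lia).
      rewrite <- H3. pose proof E2 as [Q1 [_ [Q3 _]]]. rewrite <- Q3 by auto.
      symmetry; apply Hd. lia.
Qed.

(** * Passing between a real, its branch and the real of the branch *)

Lemma M_graph_branch c : M (real c) -> M (real (graph_branch c)).
Proof.
  intros Mc. apply (M_real_rec _ (fun l x => if c (fst (of_nat l)) =? snd (of_nat l)
           then S (2 * x) else 2 * x)); [|reflexivity].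
  apply (definable_ext (fun v r s =>
    (c (fst (of_nat (v 1))) = snd (of_nat (v 1)) /\ v 0 = S (2 * v 2)) \/
    (~ c (fst (of_nat (v 1))) = snd (of_nat (v 1)) /\ v 0 = 2 * v 2))); [|defn].
  intros v r s _ _. destruct (Nat.eqb_spec (c (fst (of_nat (v 1)))) (snd (of_nat (v 1)))); tauto.
Qed.

Lemma M_graph_branch_inv c : M (real (graph_branch c)) -> M (real c).
Proof.
  intros Mg. apply M_real_of_natterm. unfold natterm.
  apply (definable_ext (fun v r s =>
    graph_branch c (S (to_nat (v 1, v 0))) = S (2 * graph_branch c (to_nat (v 1, v 0))))); [|defn].
  intros; apply graph_branch_spec.
Qed.

Lemma M_row_branch b : M (real b) -> M (real (fun k => b (row k))).
Proof. intros Mb. apply M_real_of_natterm. unfold row. natt. Qed.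

(** ** Sets of reals and pairs of reals *)

Lemma M_unionV x : M x -> M (unionV x).
Proof.
  intros Hx. destruct (model_union n M HM x Hx) as [u [Hu K]].
  apply (Mcl u); auto. apply eqV_ext; intros z. rewrite mem_unionV. split.
  - intros Hz. assert (Mz := Mtr _ _ Hu Hz). apply K in Hz as [y [_ H]]; eauto.
  - intros [y [H1 H2]]. assert (My := Mtr _ _ Hx H1). apply K; [exact (Mtr _ _ My H2)|].
    exists y; auto.
Qed.

Lemma opair_powM A x y : M A -> x ∈ A -> y ∈ A -> opair x y ∈ powM M (powM M A).
Proof.
  intros MA Hx Hy. assert (Mx := Mtr _ _ MA Hx). assert (My := Mtr _ _ MA Hy).
  assert (P : forall a b, a ∈ A -> b ∈ A -> M a -> M b -> upair a b ∈ powM M A).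
  { intros a b Ha Hb Ma Mb. apply mem_powM; split; [|now apply M_upair].
    intros u Hu. apply mem_upair in Hu as [Hu|Hu]; now rewrite Hu. }
  apply mem_powM; split; [|now apply M_opair].
  intros u Hu. unfold opair in Hu. apply mem_upair in Hu as [Hu|Hu]; rewrite Hu; auto.
Qed.

Lemma mem_reals_intro f : M (real f) -> real f ∈ reals M.
Proof. intros H; apply mem_reals; exists f; split; auto; reflexivity. Qed.

Definition real_set (D : (nat -> nat) -> Prop) : V :=
  sup {p | M (real p) /\ D p} (fun t => real (proj1_sig t)).

Lemma mem_real_set D x : x ∈ real_set D <-> exists p, M (real p) /\ D p /\ x ≡ real p.
Proof.
  unfold real_set; rewrite mem_sup; split.
  - intros [[p [Mp Dp]] H]; eauto.
  - intros [p [Mp [Dp H]]]; exists (exist _ p (conj Mp Dp)); auto.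
Qed.

Lemma M_real_set D : definable (fun v r s => D (r 0)) -> M (real_set D).
Proof.
  intros HD. destruct (definable_separation (fun x => exists p, M (real p) /\ (D p /\ x ≡ real p))
    (reals M)) as [b [Hb K]].
  - apply definable_ex_real, definable_and; [|defn].
    exact (definable_rename _ (fun i => i) (fun i => i) (fun i => i) HD).
  - apply M_reals.
  - apply (Mcl b); auto. apply eqV_ext; intros z. rewrite K, mem_real_set. split.
    + tauto.
    + intros [p [Mp [Dp E]]]. split; [rewrite E; now apply mem_reals_intro|eauto].
Qed.

Definition real_relation (R : (nat -> nat) -> (nat -> nat) -> Prop) : V :=
  sup {t : (nat -> nat) * (nat -> nat) | M (real (fst t)) /\ M (real (snd t)) /\ R (fst t) (snd t)}
    (fun t => opair (real (fst (proj1_sig t))) (real (snd (proj1_sig t)))).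

Lemma mem_real_relation R x : x ∈ real_relation R <->
  exists p q, M (real p) /\ M (real q) /\ R p q /\ x ≡ opair (real p) (real q).
Proof.
  unfold real_relation; rewrite mem_sup; split.
  - intros [[[p q] [H1 [H2 H3]]] H]; exists p, q; auto.
  - intros [p [q [H1 [H2 [H3 H]]]]]. exists (exist _ (p, q) (conj H1 (conj H2 H3))); auto.
Qed.

Lemma M_real_relation R : definable (fun v r s => R (r 0) (r 1)) -> M (real_relation R).
Proof.
  intros HR. destruct (definable_separation
    (fun x => exists p, M (real p) /\ exists q, M (real q) /\ (R p q /\ x ≡ opair (real p) (real q)))
    (powM M (powM M (reals M)))) as [b [Hb K]].
  - do 2 apply definable_ex_real. apply definable_and; [|defn].
    exact (definable_rename _ (fun i => i) (fun i => match i with 0 => 1 | _ => 0 end) (fun i => i) HR).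
  - do 2 apply M_powM; apply M_reals.
  - apply (Mcl b); auto. apply eqV_ext; intros z. rewrite K, mem_real_relation. split.
    + intros [_ [p [Mp [q [Mq [H E]]]]]]; exists p, q; auto.
    + intros [p [q [Mp [Mq [H E]]]]]. split; [|eauto 6].
      rewrite E. apply opair_powM; auto using M_reals, mem_reals_intro.
Qed.

Lemma opair_real_relation R p q : M (real p) -> M (real q) ->
  opair (real p) (real q) ∈ real_relation R <-> R p q.
Proof.
  intros Mp Mq. rewrite mem_real_relation; split.
  - intros [p' [q' [_ [_ [H E]]]]]. apply opair_inj in E as [E1 E2].
    rewrite real_eq in E1, E2. apply functional_extensionality in E1, E2. now subst.
  - intros H; exists p, q; repeat match goal with |- _ /\ _ => split end; auto; reflexivity.
Qed.

(** Both forcing notions of the proof live on the set of all reals of [M]: every real is a code, and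
    just the order varies. *)
Lemma real_forcing_notion R : (forall p, R p p) -> (forall p q t, R p q -> R q t -> R p t) ->
  forcing_notion (reals M) (real_relation R).
Proof.
  intros Hr Ht. split; [|split; [|split]].
  - exists (real (fun _ => 0)). apply mem_reals_intro, M_real_zero.
  - intros z Hz. apply mem_real_relation in Hz as [p [q [Mp [Mq [_ E]]]]].
    exists (real p), (real q); auto using mem_reals_intro.
  - intros x Hx. apply mem_reals in Hx as [p [Mp E]]. rewrite E. now apply opair_real_relation.
  - intros x y z Hxy Hyz.
    apply mem_real_relation in Hxy as [p [q [Mp [Mq [H1 E1]]]]]. apply opair_inj in E1 as [Ex Ey].
    apply mem_real_relation in Hyz as [q' [t [Mq' [Mt [H2 E2]]]]]. apply opair_inj in E2 as [Ey' Ez].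
    rewrite Ey in Ey'. rewrite real_eq in Ey'. apply functional_extensionality in Ey'. subst q'.
    rewrite Ex, Ez. apply opair_real_relation; eauto.
Qed.

(** ** Names for reals *)

(** Pairing [x] with every condition puts its value in for any nonempty filter, without singling out
    a weakest condition. *)
Definition attach (x : V) : V := sup {p | M (real p)} (fun t => opair x (real (proj1_sig t))).

Lemma mem_attach x z : z ∈ attach x <-> exists p, M (real p) /\ z ≡ opair x (real p).
Proof.
  unfold attach; rewrite mem_sup; split.
  - intros [[p Hp] H]; eauto.
  - intros [p [Hp H]]; exists (exist _ p Hp); auto.
Qed.

(** The canonical (check) name of [numeral k]. *)
Fixpoint num_name (k : nat) : V :=
  match k with
  | 0 => empty
  | S k => unionV (upair (num_name k) (attach (num_name k)))
  end.

Definition upair_name (x y : V) : V := unionV (upair (attach x) (attach y)).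
Definition opair_name (x y : V) : V := upair_name (upair_name x x) (upair_name x y).

Lemma mem_num_name_S k z : z ∈ num_name (S k) <->
  z ∈ num_name k \/ exists p, M (real p) /\ z ≡ opair (num_name k) (real p).
Proof.
  cbn [num_name]. rewrite mem_unionV, <- mem_attach. split.
  - intros [y [Hy Hz]]. apply mem_upair in Hy as [Hy|Hy]; rewrite Hy in Hz; auto.
  - intros [H|H]; eexists; (split; [apply mem_upair|exact H]); [left|right]; reflexivity.
Qed.

Lemma mem_upair_name x y z : z ∈ upair_name x y <->
  exists p, M (real p) /\ (z ≡ opair x (real p) \/ z ≡ opair y (real p)).
Proof.
  unfold upair_name. rewrite mem_unionV. split.
  - intros [u [Hu Hz]]. apply mem_upair in Hu as [Hu|Hu]; rewrite Hu in Hz;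
      apply mem_attach in Hz as [p [Mp E]]; eauto.
  - intros [p [Mp [E|E]]]; [exists (attach x)|exists (attach y)];
      (split; [apply mem_upair|apply mem_attach; eauto]); [left|right]; reflexivity.
Qed.

Lemma mem_num_name k z : z ∈ num_name k <->
  exists i p, i < k /\ M (real p) /\ z ≡ opair (num_name i) (real p).
Proof.
  induction k as [|k IH].
  - split; [intros H; now apply mem_empty in H|intros [i [p [H _]]]; lia].
  - rewrite mem_num_name_S, IH. split.
    + intros [[i [p [Hi H]]]|[p H]]; [exists i, p|exists k, p]; split; auto; lia.
    + intros [i [p [Hi [Mp E]]]]. destruct (Nat.eq_dec i k) as [->|]; eauto.
      left. exists i, p. split; [lia|auto].
Qed.

(** A nice name for a real, with [F] telling which conditions put a pair into its graph. *)
Definition real_name (F : nat -> nat -> (nat -> nat) -> Prop) : V :=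
  sup {t : nat * nat * (nat -> nat) | M (real (snd t)) /\ F (fst (fst t)) (snd (fst t)) (snd t)}
    (fun t => let '(a, b, p) := proj1_sig t in
       opair (opair_name (num_name a) (num_name b)) (real p)).

Lemma mem_real_name F z : z ∈ real_name F <->
  exists a b p, M (real p) /\ F a b p /\ z ≡ opair (opair_name (num_name a) (num_name b)) (real p).
Proof.
  unfold real_name; rewrite mem_sup; split.
  - intros [[[[a b] p] [H1 H2]] H]; exists a, b, p; auto.
  - intros [a [b [p [H1 [H2 H]]]]]. exists (exist _ (a, b, p) (conj H1 H2)); auto.
Qed.

Lemma M_attach x : M x -> M (attach x).
Proof.
  intros Mx. destruct (M_binary_union (upair x x) (reals M)) as [A [MA HA]]; auto using M_upair, M_reals.
  destruct (definable_separation (fun z => exists p, M (real p) /\ z ≡ opair x (real p))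
    (powM M (powM M A))) as [b [Hb K]].
  - defn.
  - now do 2 apply M_powM.
  - apply (Mcl b); auto. apply eqV_ext; intros z. rewrite K, mem_attach. split; [tauto|].
    intros [p [Mp E]]; split; eauto. rewrite E. apply opair_powM; auto.
    + apply HA; left. apply mem_upair; left; reflexivity.
    + apply HA; right. now apply mem_reals_intro.
Qed.

Lemma M_num_name k : M (num_name k).
Proof.
  induction k; cbn [num_name]; [apply M_empty|]. apply M_unionV, M_upair; auto using M_attach.
Qed.

Lemma M_upair_name x y : M x -> M y -> M (upair_name x y).
Proof. intros; apply M_unionV, M_upair; auto using M_attach. Qed.

Lemma M_num_name_sequence : M (sup nat (fun k => opair (numeral k) (num_name k))).
Proof.
  apply (M_recursion num_name (fun k x y =>
    (forall z, z ∈ y -> z ∈ x \/ exists p, M (real p) /\ z ≡ opair x (real p)) /\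
    (forall z, z ∈ x -> z ∈ y) /\
    (forall p, M (real p) -> exists z, z ∈ y /\ z ≡ opair x (real p)))).
  - exact M_num_name.
  - defn.
  - intros k y My. split.
    + intros [H1 [H2 H3]]. apply eqV_ext; intros z. rewrite mem_num_name_S. split; auto.
      intros [H|[p [Mp E]]]; auto. destruct (H3 p Mp) as [z' [Hz' E']]. now rewrite E, <- E'.
    + intros E. split; [|split].
      * intros z Hz. rewrite E in Hz. now apply mem_num_name_S.
      * intros z Hz. rewrite E. apply mem_num_name_S; auto.
      * intros p Mp. eexists; split; [|reflexivity]. rewrite E. apply mem_num_name_S.
        right; exists p; split; [exact Mp|reflexivity].
Qed.

(** The operation [upair_name] is not a term of the definability calculus; this is its bounded
    description. *)
Definition is_upair_name (a x y : V) : Prop :=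
  (forall z, z ∈ a -> exists p, M (real p) /\ (z ≡ opair x (real p) \/ z ≡ opair y (real p))) /\
  (forall p, M (real p) -> (exists z, z ∈ a /\ z ≡ opair x (real p)) /\
                           (exists z, z ∈ a /\ z ≡ opair y (real p))).

Lemma is_upair_name_iff a x y : is_upair_name a x y <-> a ≡ upair_name x y.
Proof.
  split.
  - intros [H1 H2]. apply eqV_ext; intros z. rewrite mem_upair_name. split; auto.
    intros [p [Mp H]]. destruct (H2 p Mp) as [[u [Hu E]] [u' [Hu' E']]].
    destruct H as [H|H]; rewrite H; [now rewrite <- E|now rewrite <- E'].
  - intros E. split.
    + intros z Hz. rewrite E in Hz. now apply mem_upair_name.
    + intros p Mp; split; (eexists; split; [|reflexivity]); rewrite E; apply mem_upair_name; exists p;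
        (split; [exact Mp|]); [left|right]; reflexivity.
Qed.

(** Supplies the sets that bound the quantifiers over names in [M_real_name]. *)
Lemma upair_name_ambient A : M A -> exists B, M B /\
  forall x y, x ∈ A -> y ∈ A -> upair_name x y ∈ B.
Proof.
  intros MA. destruct (M_binary_union A (reals M)) as [C [MC HC]]; auto using M_reals.
  exists (powM M (powM M (powM M C))). split; [now do 3 apply M_powM|].
  intros x y Hx Hy. apply mem_powM; split.
  - intros z Hz. apply mem_upair_name in Hz as [p [Mp [E|E]]]; rewrite E;
      apply opair_powM; auto; apply HC; auto using mem_reals_intro.
  - apply M_upair_name; [exact (Mtr _ _ MA Hx)|exact (Mtr _ _ MA Hy)].
Qed.

Lemma M_real_name F : definable (fun v r s => F (v 0) (v 1) (r 0)) -> M (real_name F).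
Proof.
  intros HF. pose proof M_num_name_sequence as MC.
  set (C := sup nat (fun k => opair (numeral k) (num_name k))) in *.
  (* Two unions reach the components of the pairs in [C], hence every [num_name k]. *)
  set (U := unionV (unionV C)).
  assert (MU : M U) by now do 2 apply M_unionV.
  assert (HU : forall k, num_name k ∈ U).
  { intros k. apply mem_unionV. exists (upair (numeral k) (num_name k)). split.
    - apply mem_unionV. exists (opair (numeral k) (num_name k)). split; [exists k; reflexivity|].
      apply mem_upair; right; reflexivity.
    - apply mem_upair; right; reflexivity. }
  destruct (upair_name_ambient U MU) as [W1 [MW1 HW1]].
  destruct (upair_name_ambient W1 MW1) as [W2 [MW2 HW2]].
  destruct (M_binary_union W2 (reals M)) as [W3 [MW3 HW3]]; auto using M_reals.
  destruct (definable_separation (fun z => exists i j : nat, exists p, M (real p) /\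
     (F i j p /\ exists x, x ∈ U /\ exists y, y ∈ U /\
       ((exists w, w ∈ C /\ w ≡ opair (numeral i) x) /\ (exists w, w ∈ C /\ w ≡ opair (numeral j) y) /\
        exists a, a ∈ W1 /\ exists b, b ∈ W1 /\ exists k, k ∈ W2 /\
         (is_upair_name a x x /\ is_upair_name b x y /\ is_upair_name k a b /\ z ≡ opair k (real p)))))
     (powM M (powM M W3))) as [t [Mt K]].
  - do 2 apply definable_ex_nat. apply definable_ex_real, definable_and.
    + exact (definable_rename _ (fun i => match i with 0 => 1 | _ => 0 end) (fun i => i) (fun i => i) HF).
    + unfold is_upair_name. defn.
  - now do 2 apply M_powM.
  - apply (Mcl t); auto. apply eqV_ext; intros z. rewrite K, mem_real_name.
    assert (HC : forall i x, (exists w, w ∈ C /\ w ≡ opair (numeral i) x) <-> x ≡ num_name i).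
    { intros i x; split.
      - intros [w [[k Hk] E]]. rewrite Hk in E. apply opair_inj in E as [E1 E2].
        apply numeral_inj in E1; subst. now symmetry.
      - intros E. exists (opair (numeral i) (num_name i)). split; [exists i; reflexivity|now rewrite E]. }
    assert (UP : forall x x' y y', x ≡ x' -> y ≡ y' -> upair_name x y ≡ upair_name x' y').
    { intros x x' y y' E E'. apply eqV_ext; intros u. rewrite !mem_upair_name.
      split; intros [p [Mp H]]; exists p; (split; [exact Mp|]); [rewrite <- E, <- E'|rewrite E, E']; auto. }
    split.
    + intros [_ [i [j [p [Mp [HFp [x [_ [y [_ [Hx [Hy [a [_ [b [_ [k [_ [Ha [Hb [Hk E]]]]]]]]]]]]]]]]]]]]].
      apply HC in Hx, Hy. apply is_upair_name_iff in Ha, Hb, Hk.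
      exists i, j, p. split; auto. split; auto. rewrite E, Hk. unfold opair_name.
      rewrite (UP a (upair_name (num_name i) (num_name i)) b (upair_name (num_name i) (num_name j)));
        [reflexivity|rewrite Ha; auto|rewrite Hb; auto].
    + intros [i [j [p [Mp [HFp E]]]]].
      assert (P1 : forall i j, upair_name (num_name i) (num_name j) ∈ W1) by (intros; apply HW1; auto).
      assert (P2 : opair_name (num_name i) (num_name j) ∈ W2) by (apply HW2; auto).
      split.
      * rewrite E. apply opair_powM; auto; apply HW3; auto using mem_reals_intro.
      * exists i, j, p. split; auto. split; auto. exists (num_name i); split; auto.
        exists (num_name j); split; auto. split; [apply HC; reflexivity|].
        split; [apply HC; reflexivity|].
        exists (upair_name (num_name i) (num_name i)); split; auto.
        exists (upair_name (num_name i) (num_name j)); split; auto.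
        exists (opair_name (num_name i) (num_name j)); split; auto.
        rewrite !is_upair_name_iff. repeat (split; [reflexivity|]). exact E.
Qed.

Lemma name_num_name k : name (reals M) (num_name k).
Proof.
  induction k as [k IH] using lt_wf_ind. constructor. intros z Hz.
  apply mem_num_name in Hz as [i [p [Hi [Mp E]]]].
  exists (num_name i), (real p). split; auto using mem_reals_intro.
Qed.

Lemma name_upair_name x y : name (reals M) x -> name (reals M) y -> name (reals M) (upair_name x y).
Proof.
  intros Hx Hy. constructor. intros z Hz. apply mem_upair_name in Hz as [p [Mp [E|E]]];
    [exists x, (real p)|exists y, (real p)]; auto using mem_reals_intro.
Qed.

Lemma name_real_name F : name (reals M) (real_name F).
Proof.
  constructor. intros z Hz. apply mem_real_name in Hz as [a [b [p [Mp [_ E]]]]].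
  exists (opair_name (num_name a) (num_name b)), (real p). split; [|auto using mem_reals_intro].
  unfold opair_name; auto using name_upair_name, name_num_name.
Qed.

(** * Evaluation of names *)

Lemma val_eqV G t v t' v' : val G t v -> t ≡ t' -> v ≡ v' -> val G t' v'.
Proof.
  intros [t0 v0 H1 H2] Et Ev. constructor.
  - intros w Hw. rewrite <- Ev in Hw. destruct (H1 w Hw) as [x [p [K1 [K2 K3]]]].
    exists x, p. now rewrite <- Et.
  - intros x p Hp Hx. rewrite <- Et in Hx. destruct (H2 x p Hp Hx) as [w [K1 K2]].
    exists w. now rewrite <- Ev.
Qed.

Section Evaluation.
Variable G : V.
Hypothesis HG : subset G (reals M).
Hypothesis HG1 : exists p, p ∈ G.

Lemma G_real : exists p, M (real p) /\ real p ∈ G.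
Proof.
  destruct HG1 as [x Hx]. pose proof (HG x Hx) as K. apply mem_reals in K as [p [Mp E]].
  exists p. rewrite E in *. auto.
Qed.

Lemma val_num_name k : val G (num_name k) (numeral k).
Proof.
  induction k as [k IH] using lt_wf_ind. constructor.
  - intros w Hw. apply mem_numeral in Hw as [i [Hi E]].
    destruct G_real as [p [Mp Hp]]. exists (num_name i), (real p). split; auto. split.
    + apply mem_num_name. exists i, p. repeat match goal with |- _ /\ _ => split end; auto; reflexivity.
    + apply (val_eqV _ _ _ _ _ (IH i Hi)); [reflexivity|now symmetry].
  - intros x p Hp Hx. apply mem_num_name in Hx as [i [q [Hi [Mq E]]]]. apply opair_inj in E as [E1 _].
    exists (numeral i). split; [now apply numeral_mem|].
    apply (val_eqV _ _ _ _ _ (IH i Hi)); [now symmetry|reflexivity].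
Qed.

Lemma val_upair_name x y a b : val G x a -> val G y b -> val G (upair_name x y) (upair a b).
Proof.
  intros Hx Hy. constructor.
  - intros w Hw. destruct G_real as [p [Mp Hp]]. apply mem_upair in Hw as [E|E].
    + exists x, (real p). split; auto. split.
      * apply mem_upair_name. exists p; split; auto. left; reflexivity.
      * apply (val_eqV _ _ _ _ _ Hx); [reflexivity|now symmetry].
    + exists y, (real p). split; auto. split.
      * apply mem_upair_name. exists p; split; auto. right; reflexivity.
      * apply (val_eqV _ _ _ _ _ Hy); [reflexivity|now symmetry].
  - intros z p Hp Hz. apply mem_upair_name in Hz as [q [Mq [E|E]]]; apply opair_inj in E as [E _].
    + exists a. split; [apply mem_upair; left; reflexivity|].
      apply (val_eqV _ _ _ _ _ Hx); [now symmetry|reflexivity].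
    + exists b. split; [apply mem_upair; right; reflexivity|].
      apply (val_eqV _ _ _ _ _ Hy); [now symmetry|reflexivity].
Qed.

(** The name is evaluated by hand, so neither the forcing theorem nor closure properties of the
    extension are invoked. *)
Lemma extension_real (F : nat -> nat -> (nat -> nat) -> Prop) f :
  definable (fun v r s => F (v 0) (v 1) (r 0)) ->
  (forall a b, f a = b <-> exists p, M (real p) /\ real p ∈ G /\ F a b p) ->
  extension M (reals M) G (real f).
Proof.
  intros HF Hf. exists (real_name F). split; [now apply M_real_name|].
  split; [apply name_real_name|].
  assert (HV : forall a b, val G (opair_name (num_name a) (num_name b)) (opair (numeral a) (numeral b))).
  { intros a b. unfold opair_name, opair. auto using val_upair_name, val_num_name. }
  constructor.
  - intros w [a E]. destruct (proj1 (Hf a (f a)) eq_refl) as [p [Mp [Hp K]]].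
    exists (opair_name (num_name a) (num_name (f a))), (real p). split; auto. split.
    + apply mem_real_name. exists a, (f a), p. repeat match goal with |- _ /\ _ => split end; auto; reflexivity.
    + apply (val_eqV _ _ _ _ _ (HV a (f a))); [reflexivity|now symmetry].
  - intros x p Hp Hx. apply mem_real_name in Hx as [a [b [q [Mq [K E]]]]].
    apply opair_inj in E as [E1 E2]. rewrite E2 in Hp.
    exists (opair (numeral a) (numeral b)). split.
    + apply opair_mem_real, Hf; eauto.
    + apply (val_eqV _ _ _ _ _ (HV a b)); [now symmetry|reflexivity].
Qed.

End Evaluation.

(** ** The forcing notion adding [d] *)

Lemma definable_uncatchable : definable (fun v r s => uncatchable (r 0) (r 1)).
Proof. unfold uncatchable, blocked, forbidden, fcnt, forb, row. defn. Qed.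

Lemma definable_extends : definable (fun v r s => extends (r 0) (r 1)).
Proof.
  unfold extends.
  do 4 (apply definable_and; [unfold slen, fcnt, entry, forb; defn|]).
  apply definable_and; [unfold forbidden, slen, fcnt, entry, forb; defn|].
  apply definable_all_real, definable_imp; [unfold branch; defn|].
  assert (U : forall i j, definable (fun v r s => uncatchable (r i) (r j))).
  { intros i j. exact (definable_rename _ (fun i => i)
      (fun k => match k with 0 => i | _ => j end) (fun i => i) definable_uncatchable). }
  apply definable_imp; [apply (U 1 0)|]. apply definable_or; [apply (U 2 0)|].
  unfold catches, slen, entry, row. defn.
Qed.

Lemma eventually_different_generic : countable_class M -> exists d,
  eventually_different_over M d /\
  in_some_forcing_extension M (real d) /\
  forall c, branch c -> ~ M (real c) -> forall m, exists k, m <= k /\ d k = c (row k).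
Proof.
  intros HC. pose proof HC as [e He].
  set (P := reals M). set (le := real_relation extends).
  (* Requirement number [i] is to enter the set [e i] of the enumeration, provided that it is
     dense. *)
  destruct (generic_sequence (fun i q => dense P le (e i) -> real q ∈ e i) HC)
    as [ps [d [Mps [Hext [HD [Hlen [Hd [Hev Hcatch]]]]]]]].
  { intros i p Mp. destruct (classic (dense P le (e i))) as [[H1 H2]|H].
    - destruct (H2 (real p)) as [x [Hx Hle]]; [now apply mem_reals_intro|].
      pose proof (H1 x Hx) as K. apply mem_reals in K as [q [Mq E]]. exists q; split; auto.
      split; [|intros _; now rewrite <- E]. apply opair_real_relation; auto. now rewrite <- E.
    - exists p; split; auto. split; [apply extends_refl|tauto]. }
  exists d. split; auto. split; auto.
  (* The filter generated by the sequence of conditions. *)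
  set (G := real_set (fun p => exists i, extends (ps i) p)).
  assert (HG : forall p, M (real p) -> real p ∈ G -> exists i, extends (ps i) p).
  { intros p _ Hp. apply mem_real_set in Hp as [q [_ [K E]]].
    rewrite real_eq in E. apply functional_extensionality in E. now subst. }
  assert (HGi : forall p i, M (real p) -> extends (ps i) p -> real p ∈ G).
  { intros p i Mp Hp. apply mem_real_set. exists p; split; auto. split; eauto. reflexivity. }
  assert (Gsub : subset G P).
  { intros x Hx. apply mem_real_set in Hx as [p [Mp [_ E]]]. rewrite E. now apply mem_reals_intro. }
  assert (Gps : forall i, real (ps i) ∈ G) by (intros i; apply (HGi _ i); auto using extends_refl).
  exists P, le, G. split; [|split; [|split; [split|]]].
  - apply M_opair; [apply M_reals|apply M_real_relation, definable_extends].
  - apply real_forcing_notion; [exact extends_refl|exact extends_trans].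
  - split; [exact Gsub|]. split; [exists (real (ps 0)); auto|]. split.
    + intros x y Hx Hle. apply mem_real_relation in Hle as [p [q [Mp [Mq [K E]]]]].
      apply opair_inj in E as [E1 E2]. rewrite E1 in Hx. rewrite E2.
      destruct (HG p Mp Hx) as [i Hi]. apply (HGi q i); auto. now apply (extends_trans _ p).
    + intros x y Hx Hy. apply mem_real_set in Hx as [p [Mp [[i Hi] E1]]].
      apply mem_real_set in Hy as [q [Mq [[j Hj] E2]]].
      exists (real (ps (Nat.max i j))). split; auto. rewrite E1, E2.
      split; apply opair_real_relation; auto.
      * apply (extends_trans _ (ps i)); auto. apply Hext; lia.
      * apply (extends_trans _ (ps j)); auto. apply Hext; lia.
  - intros D MD HDD. destruct (He D MD) as [i Ei]. destruct (HD i) as [q [Mq [Kq Eq]]].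
    exists (real q). split; [now apply (HGi q (S i))|]. rewrite Ei. apply Kq.
    destruct HDD as [H1 H2]. split.
    + intros x Hx. rewrite <- Ei in Hx. auto.
    + intros p Hp. destruct (H2 p Hp) as [x [Hx Hle]]. exists x. now rewrite <- Ei.
  - apply (extension_real G Gsub) with (F := fun a b p => a < slen p /\ b = entry p a).
    + exists (real (ps 0)); auto.
    + unfold slen, entry. defn.
    + intros a b; split.
      * intros <-. exists (ps (S a)). split; auto. split; auto. split; auto. symmetry; auto.
      * intros [p [Mp [Hp [K ->]]]]. destruct (HG p Mp Hp) as [i Hi].
        pose proof Hi as [H1 [_ [H2 _]]]. rewrite <- H2 by auto. symmetry. apply Hd. lia.
Qed.

(** ** Cohen forcing *)

(** [p 0] is the length of the finite sequence [p 1, ..., p (p 0)]. *)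
Definition cohen (p q : nat -> nat) : Prop :=
  q 0 <= p 0 /\ forall i, i < q 0 -> p (S i) = q (S i).

Lemma cohen_forcing_notion : forcing_notion (reals M) (real_relation cohen).
Proof.
  apply real_forcing_notion.
  - intros p; split; auto.
  - intros p q t [H1 H2] [K1 K2]. split; [lia|]. intros i Hi. rewrite H2 by lia. auto.
Qed.

Lemma M_cohen : M (opair (reals M) (real_relation cohen)).
Proof.
  apply M_opair; [apply M_reals|]. apply M_real_relation. unfold cohen. defn.
Qed.

Lemma cohen_meets G D : generic M (reals M) (real_relation cohen) G ->
  definable (fun v r s => D (r 0)) ->
  (forall p, M (real p) -> exists q, M (real q) /\ cohen q p /\ D q) ->
  exists p, M (real p) /\ real p ∈ G /\ D p.
Proof.
  intros [_ HG] HD Hdense. destruct (HG (real_set D)) as [x [Hx Kx]].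
  - now apply M_real_set.
  - split.
    + intros x Hx. apply mem_real_set in Hx as [p [Mp [_ E]]]. rewrite E. now apply mem_reals_intro.
    + intros x Hx. apply mem_reals in Hx as [p [Mp E]]. destruct (Hdense p Mp) as [q [Mq [Hq Dq]]].
      exists (real q). split; [apply mem_real_set; exists q; repeat match goal with |- _ /\ _ => split end; auto; reflexivity|].
      rewrite E. now apply opair_real_relation.
  - apply mem_real_set in Kx as [p [Mp [Dp E]]]. exists p. rewrite E in *. auto.
Qed.

Lemma cohen_branch G : generic M (reals M) (real_relation cohen) G ->
  exists c, branch c /\ ~ M (real c) /\ extension M (reals M) G (real (fun k => c (row k))).
Proof.
  intros HG. pose proof HG as [[Gsub [Gne [_ Gdir]]] _].
  assert (Hlen : forall k, exists p, M (real p) /\ real p ∈ G /\ k <= p 0).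
  { intros k. apply (cohen_meets G (fun p => k <= p 0)); auto; [defn|].
    intros p Mp. exists (update p 0 (Nat.max k (p 0))). split; [now apply M_update|].
    split; [split; [unfold update; simpl; lia|reflexivity]|unfold update; simpl; lia]. }
  assert (Hcompat : forall p q i, M (real p) -> M (real q) -> real p ∈ G -> real q ∈ G ->
    i < p 0 -> i < q 0 -> p (S i) = q (S i)).
  { intros p q i Mp Mq Hp Hq Hi Hi'. destruct (Gdir _ _ Hp Hq) as [x [Hx [K1 K2]]].
    pose proof (Gsub x Hx) as Kx. apply mem_reals in Kx as [t [Mt E]]. rewrite E in K1, K2.
    apply opair_real_relation in K1 as [_ K1]; auto. apply opair_real_relation in K2 as [_ K2]; auto.
    rewrite <- K1, <- K2; auto. }
  assert (Hc : exists c : nat -> nat, forall i p, M (real p) -> real p ∈ G -> i < p 0 -> p (S i) = c i).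
  { apply (choice (fun i x => forall p, M (real p) -> real p ∈ G -> i < p 0 -> p (S i) = x)).
    intros i. destruct (Hlen (S i)) as [q [Mq [Hq Kq]]]. exists (q (S i)). intros; apply Hcompat; auto. }
  destruct Hc as [c Hc].
  assert (Nc : ~ M (real c)).
  (* If [c] were in [M], the conditions deviating from it would be dense: the next entry is taken
     one larger than the value of [c] there. *)
  { intros Mc. destruct (cohen_meets G (fun p => exists i, i < p 0 /\ ~ p (S i) = c i)) as [p [Mp [Hp [i [Hi K]]]]];
      auto; [defn|].
    intros p Mp. set (p1 := update p (S (p 0)) (S (c (p 0)))).
    exists (update p1 0 (S (p 0))). split; [now do 2 apply M_update|]. split; [split|].
    - unfold update; simpl; lia.
    - intros i Hi. unfold p1, update. simpl (S i =? 0). cbn iota.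
      destruct (Nat.eqb_spec (S i) (S (p 0))); auto; lia.
    - exists (p 0). unfold p1, update. simpl (S (p 0) =? 0). cbn iota. simpl (0 =? 0). cbn iota.
      rewrite Nat.eqb_refl. split; lia. }
  exists (graph_branch c). split; [apply branch_graph_branch|].
  split; [intros H; now apply Nc, M_graph_branch_inv|].
  assert (Hg : forall p k, M (real p) -> real p ∈ G -> row k <= p 0 ->
    graph_branch (fun i => p (S i)) (row k) = graph_branch c (row k)).
  { intros p k Mp Hp Hk. apply graph_branch_local. intros i Hi. apply Hc; auto; lia. }
  apply (extension_real G Gsub Gne)
    with (F := fun k b p => row k <= p 0 /\ graph_branch (fun i => p (S i)) (row k) = b).
  (* The condition is a variable here, not a fixed parameter, so its branch is described through a
     real [u] obeying the recursion. *)
  - apply (definable_ext (fun v r s => row (v 0) <= r 0 0 /\ exists u, M (real u) /\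
      (u 0 = 1 /\ (forall l, (r 0 (S (fst (of_nat l))) = snd (of_nat l) /\ u (S l) = S (2 * u l)) \/
          (~ r 0 (S (fst (of_nat l))) = snd (of_nat l) /\ u (S l) = 2 * u l)) /\ u (row (v 0)) = v 1))).
    + intros v r s Hr _. apply and_iff_compat_l. split.
      * intros [u [_ [H0 [HS <-]]]]. generalize (row (v 0)). induction n0 as [|l IH]; [now rewrite H0|].
        cbn [graph_branch]. rewrite IH. destruct (HS l) as [[E ->]|[E ->]];
          destruct (Nat.eqb_spec (r 0 (S (fst (of_nat l)))) (snd (of_nat l))); auto; contradiction.
      * intros E. exists (graph_branch (fun i => r 0 (S i))). split; [|split; [reflexivity|split; [|exact E]]].
        -- apply M_graph_branch. pose proof (Hr 0) as M0. apply M_real_of_natterm. 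
           apply (natterm_app (r 0)); auto; natt.
        -- intros l. cbn [graph_branch].
           destruct (Nat.eqb_spec (r 0 (S (fst (of_nat l)))) (snd (of_nat l))); auto.
    + unfold row. defn.
  - intros k b; split.
    + intros <-. destruct (Hlen (row k)) as [p [Mp [Hp Kp]]]. exists p; auto.
    + intros [p [Mp [Hp [Kp <-]]]]. symmetry; now apply Hg.
Qed.

End Model.

Theorem theorem7p2 (n : nat) (hn : 2026 <= n) :
  ~ neq_star_universality n /\
  (forall M : V -> Prop, model n M -> countable_class M ->
    exists d : nat -> nat,
      eventually_different_over M d /\
      forall c : nat -> nat, ~ M (real c) ->
        not_eventually_different_over_adjoin n M c d).
Proof.
  assert (Hn : 1 <= n) by lia. split.
  - intros U. pose proof (countable_model_model n) as HM.
    destruct (eventually_different_generic n _ Hn HM countable_model_countable) as [d [H1 [H2 H3]]].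
    destruct (U _ HM countable_model_countable d H1 H2 _ _ (M_cohen n _ Hn HM)
      (cohen_forcing_notion n _ Hn HM)) as [G [HG Hd]].
    destruct (cohen_branch n _ Hn HM G HG) as [c [Bc [Nc Ec]]].
    (* The real of the branch belongs to the Cohen extension, yet [d] agrees with it at arbitrarily
       late positions. *)
    destruct (Hd _ Ec) as [k Hk]. destruct (H3 c Bc Nc k) as [i [Hi E]].
    apply (Hk i Hi). now symmetry.
  - intros M HM HC.
    destruct (eventually_different_generic n M Hn HM HC) as [d [H1 [_ H3]]].
    exists d; split; auto. intros c Nc N HN _ Ncc Hd.
    (* [N] is itself a model, so it contains the branch coding [c] and the real of this branch. The
       branch is outside [M], as [c] could be recovered from it. *)
    destruct (Hd (fun k => graph_branch c (row k))) as [k Hk].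
    { apply (M_row_branch n N Hn HN). now apply (M_graph_branch n N Hn HN). }
    destruct (H3 (graph_branch c) (branch_graph_branch c)) with (m := k) as [i [Hi E]].
    { intros K. apply Nc. now apply (M_graph_branch_inv n M Hn HM). }
    apply (Hk i Hi). now symmetry.
Qed.
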